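(* Suppose the Markov chain $\Xi$ on $\mathbb X\subseteq\mathbb R$ satisfies $(\mathrm T^{\mathrm{out}}_{\alpha,\beta,c})$ and $(\mathrm D'_{\gamma,b})$, and let $q>0$, with $\tau_a:=\min\{n\ge0:|\xi_n|\le a\}$. Then for all $a$ sufficiently large and all $x$ with $|x|>a$: (i) if $\gamma>\alpha-1$, then $\mathbb E_x[\tau_a^q]<\infty$ for $q<1/\alpha$ and $=\infty$ for $q>1/\alpha$; (ii) if $\gamma=\alpha-1$ and $b<c\pi|\csc(\pi\alpha)|$, then $\mathbb E_x[\tau_a^q]<\infty$ for $q<\nu^\star/\alpha$ and $=\infty$ for $q>\nu^\star/\alpha$, where $\nu^\star\in(0,\alpha)$ is the unique solution of $\frac bc=(\nu^\star-1)\frac{\Gamma(1-\alpha)\Gamma(\alpha-\nu^\star)}{\Gamma(2-\nu^\star)}$; (iii) if $\gamma<\alpha-1$ and $b<0$, then $\mathbb E_x[\tau_a^q]<\infty$ for $q<\frac{\alpha}{\gamma+1}$ and $=\infty$ for $q\ge\frac{\alpha}{\gamma+1}$.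
   Context: $\Xi=(\xi_n)_{n\ge0}$ is a time-homogeneous Markov chain on an infinite, unbounded, measurable $\mathbb X\subseteq\mathbb R$. $\mathbb P_x,\mathbb E_x$ refer to the chain started at $x$; $\theta:=\xi_1-\xi_0$; $y_+:=y\mathbf 1\{y\ge0\}$, $y_-:=-y\mathbf 1\{y<0\}$; $\mu(x):=\mathbb E_x[\theta]$. $\Gamma$ is the gamma function. $(\mathrm T^{\mathrm{out}}_{\alpha,\beta,c})$: there exist $\alpha\in(1,2)$, $\beta>\alpha$, $c>0$, $x_0\in\mathbb R_+$ with $\lim_{y\to\infty}\sup_{x\ge x_0}|y^\alpha\mathbb P_x[\theta_+>y]-c|=\lim_{y\to\infty}\sup_{x\le -x_0}|y^\alpha\mathbb P_x[\theta_->y]-c|=0$, $\sup_{x\ge x_0}\mathbb E_x[\theta_-^\beta]<\infty$, and $\sup_{x\le-x_0}\mathbb E_x[\theta_+^\beta]<\infty$. $(\mathrm D'_{\gamma,b})$: there exist $\gamma\ge0$, $b\in\mathbb R$ with $\lim_{x\to+\infty}x^\gamma\mu(x)=\lim_{x\to-\infty}(-|x|^\gamma\mu(x))=b$. *)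

(* Defs.v *)
From HB Require Import structures.
From mathcomp Require Import all_boot all_order all_algebra.
From mathcomp Require Import all_classical all_reals all_analysis.
Set Implicit Arguments. Unset Strict Implicit. Unset Printing Implicit Defensive.
Import Order.TTheory GRing.Theory Num.Theory.
Import numFieldNormedType.Exports.
Local Open Scope classical_set_scope.
Local Open Scope ring_scope.

Section Defs.
Context {R : realType}.

Definition posp (y : R) : R := if 0 <= y then y else 0.
Definition negp (y : R) : R := if y < 0 then - y else 0.

(** Euler's Gamma function: the integral for s > 0, extended to
    non-integer s <= 0 by Gamma(s) = Gamma(s+n) / (s (s+1) ... (s+n-1)). *)
Definition GammaI (s : R) : R :=
  Rintegral (@lebesgue_measure R) `]0%R, +oo[%classic
    (fun t => t `^ (s - 1) * expR (- t)).

Definition Gamma (s : R) : R :=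
  if 0 < s then GammaI s
  else let n := (Num.truncn (- s)).+1 in
       GammaI (s + n%:R) / \prod_(k < n) (s + k%:R).

Context {d : measure_display} {Omega : measurableType d}.

(** Finite-dimensional law of a time-homogeneous Markov chain with transition
    kernel K:  fdd K [:: A0; ...; An] x
      = 1_{A0}(x) * \int K(x,dy1) 1_{A1}(y1) \int K(y1,dy2) ... *)
Fixpoint fdd (K : R.-pker R ~> R) (As : seq (set R)) (y : R) : \bar R :=
  match As with
  | [::] => 1%E
  | A :: As' => ((\1_A y)%:E * \int[K y]_z fdd K As' z)%E
  end.

Definition is_markov_chain (X : set R) (K : R.-pker R ~> R)
    (P : R -> probability Omega R) (xi : nat -> Omega -> R) : Prop :=
  measurable X /\
  (forall n, measurable_fun setT (xi n)) /\
  (forall x, X x -> K x X = 1%E) /\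
  (forall x, X x -> forall As : seq (set R),
     (forall k, (k < size As)%N -> measurable (nth setT As k)) ->
     P x [set w | forall k, (k < size As)%N -> nth setT As k (xi k w)]
       = fdd K As x).

Definition theta (xi : nat -> Omega -> R) (w : Omega) : R := xi 1%N w - xi 0%N w.

Definition drift (P : R -> probability Omega R) (xi : nat -> Omega -> R) (x : R) : R :=
  fine (\int[P x]_w (theta xi w)%:E)%E.

Definition tau (a : R) (xi : nat -> Omega -> R) (w : Omega) : \bar R :=
  match pselect (exists n, `|xi n w| <= a) with
  | left h => (@ex_minn (fun n => `|xi n w| <= a) h)%:R%:E
  | right _ => +oo%E
  end.

Definition tau_moment (P : R -> probability Omega R) (xi : nat -> Omega -> R)
    (a q x : R) : \bar R :=
  (\int[P x]_w (tau a xi w `^ q))%E.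

Definition Tout (X : set R) (P : R -> probability Omega R) (xi : nat -> Omega -> R)
    (alpha beta c x0 : R) : Prop :=
  (1 < alpha < 2) /\ (alpha < beta) /\ (0 < c) /\ (0 <= x0) /\
   (forall eps, 0 < eps -> exists Y, forall y, Y <= y -> forall x, X x -> x0 <= x ->
      `| y `^ alpha * fine (P x [set w | y < posp (theta xi w)]) - c| <= eps) /\
   (forall eps, 0 < eps -> exists Y, forall y, Y <= y -> forall x, X x -> x <= - x0 ->
      `| y `^ alpha * fine (P x [set w | y < negp (theta xi w)]) - c| <= eps) /\
   (exists M : R, forall x, X x -> x0 <= x ->
      (\int[P x]_w (negp (theta xi w) `^ beta)%:E <= M%:E)%E) /\
   (exists M : R, forall x, X x -> x <= - x0 ->
      (\int[P x]_w (posp (theta xi w) `^ beta)%:E <= M%:E)%E).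

Definition Dprime (X : set R) (P : R -> probability Omega R) (xi : nat -> Omega -> R)
    (gamma b : R) : Prop :=
  0 <= gamma /\
  (forall eps, 0 < eps -> exists M, forall x, X x -> M <= x ->
     `| x `^ gamma * drift P xi x - b | <= eps) /\
  (forall eps, 0 < eps -> exists M, forall x, X x -> x <= M ->
     `| - (`|x| `^ gamma * drift P xi x) - b | <= eps).

End Defs.

(* Main.v *)
(** For 0 < nu < alpha, Taylor expansion and the tail of the outward jumps show that, with
    k = min(alpha, 1 + gamma),
      E_x |xi_1|^nu - |x|^nu ~ nu rho(nu) |x|^(nu - k),
    where rho(nu) is b if 1 + gamma < alpha, and otherwise -c H(nu), increased by b if
    1 + gamma = alpha. Here H(nu) = (1 - nu) B(2 - alpha, alpha - nu) / (alpha - 1), which is the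
    right-hand side of the equation for nu*; it decreases in nu, and H(0) = pi / |sin(pi alpha)|
    by the reflection formula.
    If rho(nu) < 0 then |x|^nu is a Lyapunov function and P_x(tau_a > n) = O(n^(-nu / k)). If k = alpha
    and rho(nu) > 0, we compare |x|^nu up to the exit from a ball of radius 2r with the same function
    perturbed by eta r^(nu - nu') |x|^nu', nu < nu' < alpha; since from outside 2r the chain needs of
    order r^s steps to come back below a, for every s < alpha, this gives
    P_x(tau_a > n) >= c' n^(-nu / s).
    If k = 1 + gamma < alpha and b < 0, iterating the Lyapunov bound yields every power n^(-p) with
    p < alpha / k, and a single jump beyond 2r, of probability of order r^(-alpha), after which
    the return takes of order r^k steps, yields the lower bound n^(-alpha / k). *)

Require Import Defs.
From HB Require Import structures.
From mathcomp Require Import all_boot all_order all_algebra.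
From mathcomp Require Import all_classical all_reals all_analysis.
From mathcomp Require Import measurable_realfun.
From mathcomp Require Import ring lra zify.
Import Order.TTheory GRing.Theory Num.Theory.
Import numFieldNormedType.Exports.
Local Open Scope classical_set_scope.
Local Open Scope ring_scope.
Set Implicit Arguments. Unset Strict Implicit. Unset Printing Implicit Defensive.

(** * Integrals over the positive half-line *)

(** No martingale or stopping time appears: survival probabilities are iterated kernel integrals,
    and every drift criterion is an induction on the number of steps. The obstacle is that alpha <
    2, so an outward jump Z has no second moment and the usual second-order expansion of |x|^nu
    fails. The Taylor remainder is therefore kept in integral form: after Tonelli it involves Z only
    through E (Z - v)_+ ~ c v^(1 - alpha) / (alpha - 1), and integrating (x + v)^(nu - 2) v^(1 -
    alpha) produces the Beta value in H. Inward jumps may cross the origin, but they have a moment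
    of order above alpha and only cost O(x^(nu - min(beta, 2))). The return time from radius 2r is
    controlled through moments of order s, which are finite only for s < alpha; with k = alpha this
    loses an arbitrarily small power, which an open range of q absorbs. If 1 + gamma < alpha, s = 1
    + gamma is allowed, nothing is lost, and the boundary exponent is reached. The reflection
    formula is proved by real analysis: Beta s (1 - s) and pi / sin (pi s) obey the same trisection
    identity, and their difference is Lipschitz once the common pole 1 / s cancels. *)

Lemma lebesgue_measure_scale (R : realType) (l : R) (A : set R) :
  0 < l -> measurable A ->
  lebesgue_measure A = (l%:E * lebesgue_measure ( *%R l @^-1` A))%E.
Proof.
move=> l0 mA.
have ml : measurable_fun [set: measurableTypeR R] ( *%R l : measurableTypeR R -> measurableTypeR R).
  exact: mulrl_measurable.
pose m := mscale (NngNum (ltW l0)) (pushforward (@lebesgue_measure R) ( *%R l : measurableTypeR R -> measurableTypeR R)).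
rewrite (@lebesgue_measure_unique R (m ml))//.
move=> _ [[a b] /= _ <-].
rewrite /m /mscale/= /pushforward.
have -> : *%R l @^-1` `]a, b] = `](a / l), (b / l)]%classic.
  apply/seteqP; split => x /=; rewrite !in_itv/= ltr_pdivrMr// ler_pdivlMr//; by rewrite (mulrC x).
rewrite !lebesgue_measure_itv/= !lte_fin ltr_pM2r ?invr_gt0//.
case: ifPn => _; last by rewrite mule0.
rewrite -!EFinD -EFinM; congr EFin. rewrite -mulrBl mulrCA divff ?gt_eqF// mulr1//.
Qed.

Lemma ge0_integral_scale (R : realType) (l : R) (f : R -> \bar R) :
  0 < l -> measurable_fun [set: R] f ->
  (forall x, 0 < x -> (0 <= f x)%E) ->
  (\int[lebesgue_measure]_(x in `]0%R, +oo[) f x =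
   l%:E * \int[lebesgue_measure]_(x in `]0%R, +oo[) f (l * x)%R)%E.
Proof.
move=> l0 mf f0.
have ml : measurable_fun [set: measurableTypeR R] ( *%R l : measurableTypeR R -> measurableTypeR R).
  exact: mulrl_measurable.
pose phi := ( *%R l : measurableTypeR R -> measurableTypeR R).
pose m := mscale (NngNum (ltW l0)) (pushforward (@lebesgue_measure R) phi).
rewrite (eq_measure_integral (m ml)); last first.
  move=> A mA _; exact: lebesgue_measure_scale.
rewrite ge0_integral_mscale; last 3 first.
- by [].
- exact: measurable_funTS.
- by move=> x /=; rewrite in_itv/= andbT; exact: f0.
congr (_ * _)%E.
rewrite ge0_integral_pushforward//=; last 2 first.
- exact: measurable_funTS.
- by move=> x; rewrite inE/= in_itv/= andbT; exact: f0.
congr (integral _ _ _).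
by apply/seteqP; split => x /=; rewrite !in_itv/= !andbT /phi pmulr_rgt0.
Qed.

Ltac mfun := repeat (first [ exact: measurable_cst | exact: measurable_id
  | exact: measurable_fst | exact: measurable_snd | assumption
  | apply: measurable_funD | apply: measurable_funB | apply: measurable_funM
  | apply: (measurableT_comp (measurable_powR _))
  | apply: (measurableT_comp (@measurable_expR _))
  | apply: (measurableT_comp (@measurable_ln _))
  | apply: (measurableT_comp (@normr_measurable _ _))
  | apply: (measurableT_comp (@oppr_measurable _ _))]).

Notation positives := (`]0%R, +oo[%classic).
Notation ipos f := (\int[lebesgue_measure]_(u in positives) (f u)%:E)%E.

Section PositiveHalfLine.
Context {R : realType}.
Implicit Types f g : R -> R.
Notation mu := (@lebesgue_measure R).

Lemma le_ipos f g : measurable_fun [set: R] f -> measurable_fun [set: R] g ->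
  (forall x, 0 < x -> 0 <= f x <= g x) -> (ipos f <= ipos g)%E.
Proof.
move=> mf mg fg; apply: ge0_le_integral => //=.
- by move=> x; rewrite in_itv/= andbT lee_fin => /fg/andP[].
- by apply/measurable_EFinP; exact: measurable_funTS.
- by apply/measurable_EFinP; exact: measurable_funTS.
- by move=> x; rewrite in_itv/= andbT lee_fin => /fg/andP[].
Qed.

Lemma eq_ipos f g : (forall x, 0 < x -> f x = g x) -> ipos f = ipos g.
Proof.
by move=> fg; apply: eq_integral => x; rewrite inE/= in_itv/= andbT => /fg ->.
Qed.

Lemma ipos_ge0 f : (forall x, 0 < x -> 0 <= f x) -> (0 <= ipos f)%E.
Proof.
by move=> f0; apply: integral_ge0 => x /=; rewrite in_itv/= andbT lee_fin => /f0.
Qed.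

Lemma iposD f g : measurable_fun [set: R] f -> measurable_fun [set: R] g ->
  (forall x, 0 < x -> 0 <= f x) -> (forall x, 0 < x -> 0 <= g x) ->
  ipos (fun u => f u + g u) = (ipos f + ipos g)%E.
Proof.
move=> mf mg f0 g0.
rewrite -ge0_integralD//=.
- by move=> x; rewrite in_itv/= andbT lee_fin => /f0.
- by apply/measurable_EFinP; exact: measurable_funTS.
- by move=> x; rewrite in_itv/= andbT lee_fin => /g0.
- by apply/measurable_EFinP; exact: measurable_funTS.
Qed.

Lemma iposZl (k : R) f : measurable_fun [set: R] f -> 0 <= k ->
  (forall x, 0 < x -> 0 <= f x) ->
  ipos (fun u => k * f u) = (k%:E * ipos f)%E.
Proof.
move=> mf k0 f0.
rewrite -ge0_integralZl_EFin//=.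
- by move=> x; rewrite in_itv/= andbT lee_fin => /f0.
- by apply/measurable_EFinP; exact: measurable_funTS.
Qed.

Lemma ipos_scale (l : R) f : 0 < l -> measurable_fun [set: R] f ->
  (forall x, 0 < x -> 0 <= f x) ->
  ipos f = (l%:E * ipos (fun u => f (l * u)))%E.
Proof.
move=> l0 mf f0.
by rewrite (@ge0_integral_scale R l (EFin \o f))//; exact/measurable_EFinP.
Qed.

(** A vanishing integral would force [f = 0] almost everywhere on the half-line, whose Lebesgue
    measure is not 0. *)
Lemma ipos_gt0 f : measurable_fun [set: R] f -> (forall x, 0 < x -> 0 < f x) ->
  (0 < ipos f)%E.
Proof.
move=> mf f0; rewrite lt0e ipos_ge0 ?andbT; last by move=> x /f0/ltW.
apply/negP => /eqP f00.
have mf' : measurable_fun (positives : set R) (EFin \o f).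
  by apply/measurable_EFinP; exact: measurable_funTS.
have : ae_eq mu positives (EFin \o f) (cst 0%E).
  apply/ae_eq_integral_abs => //.
  rewrite -[RHS]f00; apply: eq_integral => x; rewrite inE/= in_itv/= andbT => x0.
  by rewrite ger0_norm// ltW// f0.
move=> [N [mN N0 sN]].
have : (mu positives <= mu N)%E.
  apply: le_measure; rewrite ?inE//= => x /=; rewrite in_itv/= andbT => x0; apply: sN => /=.
  apply/not_implyP; split; first by rewrite in_itv/= x0.
  by move=> [] fx; move: (f0 _ x0); rewrite fx ltxx.
by rewrite N0 lebesgue_measure_itv/= ltry.
Qed.

Section Exhaustion.
Variables (a b : nat -> R) (D : set R).
Hypothesis ab : forall n, 0 < a n < b n.
Hypothesis na : forall n m, (n <= m)%N -> a m <= a n.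
Hypothesis nb : forall n m, (n <= m)%N -> b n <= b m.
Hypothesis DE : forall x, D x <-> exists n, a n <= x <= b n.

(** Monotone convergence. The fundamental theorem of calculus and substitution are applied on
    compact intervals away from 0, where powers with negative exponent are continuous, and this
    lemma carries the result to [D]. *)
Lemma cvg_integral_exhaust f : measurable_fun [set: R] f ->
  (forall x, 0 < x -> 0 <= f x) ->
  (\int[mu]_(x in `[a n, b n]) (f x)%:E)%E @[n --> \oo] -->
  (\int[mu]_(x in D) (f x)%:E)%E.
Proof.
move=> mf f0.
have -> : D = \bigcup_n `[a n, b n]%classic.
  apply/seteqP; split => x.
    by move/DE => [n nx]; exists n => //=; rewrite in_itv/=.
  by move=> [n _ /=]; rewrite in_itv/= => nx; apply/DE; exists n.
apply: ge0_nondecreasing_set_cvg_integral => //.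
- move=> n m nm; rewrite subsetEset => x /=; rewrite !in_itv/= => /andP[ax xb].
  by rewrite (le_trans (na nm))// (le_trans xb) ?nb.
- by move=> n; apply/measurable_EFinP; exact: measurable_funTS.
- move=> n x /=; rewrite in_itv/= => /andP[ax _]; rewrite lee_fin f0//.
  by apply: lt_le_trans ax; have /andP[] := ab n.
Qed.

Lemma integral_exhaust_FTC f F (L : R) : measurable_fun [set: R] f ->
  (forall x, 0 < x -> 0 <= f x) ->
  (forall x, 0 < x -> {for x, continuous f}) ->
  (forall x : R, 0 < x -> is_derive x 1 F (f x)) ->
  F (b n) - F (a n) @[n --> \oo] --> L ->
  (\int[mu]_(x in D) (f x)%:E)%E = L%:E.
Proof.
move=> mf f0 cf dF FL.
have : (F (b n) - F (a n))%:E @[n --> \oo] --> L%:E by apply: cvg_EFin => //; exact: nearW.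
have -> : (fun n => (F (b n) - F (a n))%:E) = (fun n => \int[mu]_(x in `[a n, b n]) (f x)%:E)%E.
  apply/funext => n; have /andP[an abn] := ab n.
  have Fc x : 0 < x -> {for x, continuous F}.
    by move=> x0; apply: differentiable_continuous; apply/derivable1_diffP; exact: (@ex_derive _ _ _ _ _ _ _ (dF _ x0)).
  rewrite (@continuous_FTC2 _ f F)//.
  - apply: continuous_in_subspaceT => x; rewrite inE/= in_itv/= => /andP[ax _].
    by apply: cf; exact: lt_le_trans ax.
  - split.
    + move=> x; rewrite in_itv/= => /andP[ax _].
      by apply: (@ex_derive _ _ _ _ _ _ _ (dF _ _)); exact: lt_trans ax.
    + by apply: cvg_at_right_filter; apply: Fc.
    + by apply: cvg_at_left_filter; apply: Fc; exact: lt_trans abn.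
  - move=> x; rewrite in_itv/= => /andP[ax _].
    by rewrite derive1E (@derive_val _ _ _ _ _ _ _ (dF _ _))//; exact: lt_trans ax.
move=> /cvg_lim h1; have /cvg_lim h2 := cvg_integral_exhaust mf f0.
by rewrite -h1// -h2.
Qed.

End Exhaustion.

(** The shift by 2 makes [xn n] exceed 1, so that [[(xn n)^-1, xn n]] is non-degenerate already for
    n = 0 and cubing its endpoints enlarges it. *)
Let xn (n : nat) : R := n.+2%:R.

Let xn_gt0 n : 0 < xn n. Proof. by rewrite ltr0n. Qed.


Let xn_gt1 n : 1 < xn n. Proof. by rewrite ltr1n. Qed.

Let xnV_lt1 n : (xn n)^-1 < 1. Proof. by rewrite invf_lt1. Qed.

Let xnV_lt n : 0 < (xn n)^-1 < xn n.
Proof. by rewrite invr_gt0 xn_gt0 (lt_trans (xnV_lt1 n)). Qed.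

Let xn_nd n m : (n <= m)%N -> xn n <= xn m. Proof. by rewrite ler_nat. Qed.

Let xnV_ni n m : (n <= m)%N -> (xn m)^-1 <= (xn n)^-1.
Proof. by move=> nm; rewrite lef_pV2 ?posrE// xn_nd. Qed.

Let xn_ge (y : R) k : 0 < y -> (Num.truncn y <= k)%N -> y <= xn k.
Proof.
move=> y0 yk; rewrite (le_trans (ltW (truncnS_gt y)))// ler_nat.
by rewrite ltnS (leq_trans yk).
Qed.

Let xnV_le (y : R) k : 0 < y -> (Num.truncn y^-1 <= k)%N -> (xn k)^-1 <= y.
Proof.
by move=> y0 yk; rewrite -[leRHS]invrK lef_pV2 ?posrE ?invr_gt0// xn_ge ?invr_gt0.
Qed.

Let xn_exhaust (x : R) : positives x <-> exists n, (xn n)^-1 <= x <= xn n.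
Proof.
rewrite /= in_itv/= andbT; split => [x0|[n /andP[+ _]]]; last first.
  by apply: lt_le_trans; rewrite invr_gt0.
exists (maxn (Num.truncn x) (Num.truncn x^-1)).
by rewrite xnV_le ?leq_maxr// xn_ge ?leq_maxl.
Qed.

Let cvg_xny : xn n @[n --> \oo] --> +oo.
Proof.
apply/cvgryPge => M; near=> n.
apply: (@le_trans _ _ n%:R); last by rewrite ler_nat; lia.
near: n; exact: nbhs_infty_ger.
Unshelve. all: by end_near. Qed.

Let cvg_xnV (F : R -> R) (A : R) :
  F x @[x --> 0^'+] --> A -> F (xn n)^-1 @[n --> \oo] --> A.
Proof.
apply: (cvg_comp (fun n => (xn n)^-1) F _).
move=> P [e /= e0 eP]; near=> n; apply: eP => /=; last by rewrite invr_gt0.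
rewrite sub0r normrN gtr0_norm ?invr_gt0//.
rewrite -(invrK e) ltf_pV2 ?posrE ?invr_gt0//.
near: n; exact: (cvgry_gt cvg_xny).
Unshelve. all: by end_near. Qed.

Lemma ipos_FTC f F (A B : R) : measurable_fun [set: R] f ->
  (forall x, 0 < x -> 0 <= f x) ->
  (forall x, 0 < x -> {for x, continuous f}) ->
  (forall x : R, 0 < x -> is_derive x 1 F (f x)) ->
  F x @[x --> 0^'+] --> A -> F x @[x --> +oo] --> B ->
  ipos f = (B - A)%:E.
Proof.
move=> mf f0 cf dF FA FB.
apply: (@integral_exhaust_FTC (fun n => (xn n)^-1) xn) dF _ => //.
apply: cvgB; first by apply: (cvg_comp _ _ cvg_xny FB).
exact: cvg_xnV FA.
Qed.

Lemma integral_powR01 (s : R) : 0 < s ->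
  (\int[mu]_(t in `]0%R, 1%R]) (t `^ (s - 1))%:E)%E = (s^-1)%:E.
Proof.
move=> s0.
apply: (@integral_exhaust_FTC (fun n => (xn n)^-1) (fun=> 1) _ _ _ _ _ _ (fun t => s^-1 * t `^ s)) => //.
- by move=> n; rewrite invr_gt0 xn_gt0/=.
- move=> x /=; rewrite in_itv/=; split => [/andP[x0 x1]|[n /andP[nx x1]]].
    by exists (Num.truncn x^-1); rewrite x1 xnV_le.
  by rewrite x1 (lt_le_trans _ nx)// invr_gt0.
- by move=> x _; exact: powR_ge0.
- move=> x x0; apply: differentiable_continuous; apply/derivable1_diffP.
  by apply: derivable_powR; rewrite in_itv/= x0.
- move=> x x0.
  have -> : x `^ (s - 1) = s^-1 *: (s * x `^ (s - 1)).
    by rewrite /GRing.scale/= mulrA mulVf ?mul1r// gt_eqF.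
  exact: (@is_deriveZ _ _ _ (fun t : R => t `^ s) s^-1 x 1 _ (is_derive1_powR s x0)).
- rewrite powR1 mulr1 -[X in _ --> X]subr0; apply: cvgB; first exact: cvg_cst.
  rewrite -(mulr0 s^-1); apply: cvgMl_tmp; apply: (@cvg_xnV (fun t => t `^ s)).
  exact: powR_cvg0.
Qed.

(* The exhausting intervals [1/n, n] are mapped by cubing onto [1/n^3, n^3], so the compact change of variables passes to the limit. *)
Lemma ipos_cube f : measurable_fun [set: R] f -> (forall x, 0 < x -> 0 <= f x) ->
  (forall x, 0 < x -> {for x, continuous f}) ->
  ipos f = ipos (fun v => f (v ^+ 3) * (3 * v ^+ 2)).
Proof.
move=> mf f0 cf.
have mg : measurable_fun [set: R] (fun v => f (v ^+ 3) * (3 * v ^+ 2)).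
  apply: measurable_funM; last by apply: measurable_funM => //; exact: measurable_funX.
  by apply: measurableT_comp => //; exact: measurable_funX.
have g0 x : 0 < x -> 0 <= f (x ^+ 3) * (3 * x ^+ 2).
  by move=> x0; rewrite mulr_ge0 ?f0 ?exprn_gt0// mulr_ge0// exprn_ge0// ltW.
have dc (x : R) : is_derive x 1 (fun v : R => v ^+ 3) (3 * x ^+ 2).
  rewrite -[X in is_derive _ _ _ X]mulr1.
  exact: (@is_deriveX _ _ (fun v : R => v) 3 x 1 1 (is_derive_id _ _)).
have dcE : (fun v : R => v ^+ 3)^`()%classic = (fun x => 3 * x ^+ 2).
  by apply/funext => x; rewrite derive1E derive_val.
have mono (x y : R) : 0 <= x -> x < y -> x ^+ 3 < y ^+ 3.
  by move=> x0 xy; rewrite ltrXn2r.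
have cd (x : R) : {for x, continuous (fun v : R => 3 * v ^+ 2)}.
  by apply: continuousM; [exact: cvg_cst|exact: exprn_continuous].
have cc (x : R) : {for x, continuous (fun v : R => v ^+ 3)}.
  exact: exprn_continuous.
have c1 : (\int[mu]_(x in `[((xn n)^-1 ^+ 3)%R, (xn n ^+ 3)%R]) (f x)%:E)%E @[n --> \oo] --> ipos f.
  apply: (@cvg_integral_exhaust (fun n => (xn n)^-1 ^+ 3) (fun n => xn n ^+ 3)) => //.
  - move=> n; rewrite exprn_gt0 ?invr_gt0//=.
    by apply: mono; [rewrite invr_ge0 ltW|have /andP[] := xnV_lt n].
  - by move=> n m nm; rewrite lerXn2r ?nnegrE ?invr_ge0 ?(ltW (xn_gt0 _)) ?xnV_ni.
  - by move=> n m nm; rewrite lerXn2r ?nnegrE ?(ltW (xn_gt0 _)) ?xn_nd.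
  - move=> x; rewrite xn_exhaust; split => -[n /andP[nx xn_]].
      exists n; rewrite (le_trans _ nx)/=; last first.
        by rewrite ler_iXnr// ?invr_ge0 ?(ltW (xn_gt0 _))// ltW.
      by rewrite (le_trans xn_)// ler_eXnr// ltW.
    apply/xn_exhaust; rewrite /= in_itv/= andbT (lt_le_trans _ nx)//.
    by rewrite exprn_gt0// invr_gt0.
have c2 : (\int[mu]_(x in `[((xn n)^-1 ^+ 3)%R, (xn n ^+ 3)%R]) (f x)%:E)%E @[n --> \oo] -->
    ipos (fun v => f (v ^+ 3) * (3 * v ^+ 2)).
  rewrite (_ : (fun n => _) = (fun n =>
      \int[mu]_(x in `[((xn n)^-1)%R, xn n]) (f (x ^+ 3) * (3 * x ^+ 2))%R%:E)%E).
    exact: (@cvg_integral_exhaust (fun n => (xn n)^-1) xn).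
  apply/funext => n; have /andP[xV0 xVx] := xnV_lt n.
  rewrite (@integration_by_substitution_increasing _ (fun v => v ^+ 3)) ?dcE//.
  - exact: ltW.
  - move=> x y; rewrite !in_itv/= => /andP[x1 _] _.
    by apply: mono; exact: le_trans (ltW xV0) x1.
  - by move=> x _; exact: cd.
  - by apply: cvgP; apply: cvg_at_right_filter; exact: cd.
  - by apply: cvgP; apply: cvg_at_left_filter; exact: cd.
  - split; first by move=> x _; exact: (@ex_derive _ _ _ _ _ _ _ (dc x)).
      by apply: cvg_at_right_filter; exact: cc.
    by apply: cvg_at_left_filter; exact: cc.
  - apply: continuous_in_subspaceT => x; rewrite inE/= in_itv/= => /andP[x1 _].
    by apply: cf; apply: lt_le_trans x1; rewrite exprn_gt0.
by rewrite -(cvg_lim _ c1)// -(cvg_lim _ c2).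
Qed.

End PositiveHalfLine.

(** * Gamma and Beta functions *)

Section FubiniOnDomains.
Local Open Scope ereal_scope.
Context d1 d2 (T1 : measurableType d1) (T2 : measurableType d2) (R : realType).
Variables (m1 : {sigma_finite_measure set T1 -> \bar R})
  (m2 : {sigma_finite_measure set T2 -> \bar R}).

Lemma fubini_tonelli_dom (D1 : set T1) (D2 : set T2) (f : T1 * T2 -> \bar R) :
  measurable D1 -> measurable D2 -> measurable_fun [set: T1 * T2] f ->
  (forall x y, D1 x -> D2 y -> 0 <= f (x, y)) ->
  \int[m1]_(x in D1) \int[m2]_(y in D2) f (x, y) =
  \int[m2]_(y in D2) \int[m1]_(x in D1) f (x, y).
Proof.
move=> mD1 mD2 mf f0.
pose h := f \_ (D1 `*` D2).
have mD : measurable (D1 `*` D2) by exact: measurableX.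
have mh : measurable_fun [set: T1 * T2] h.
  by have [+ _] := measurable_restrictT f mD; apply; exact: measurable_funTS.
have h0 z : 0 <= h z.
  by rewrite /h patchE; case: ifPn => // /set_mem[]; case: z => x y /=; exact: f0.
have := @fubini_tonelli _ _ _ _ _ m1 m2 h mh h0.
have -> : \int[m1]_x \int[m2]_y h (x, y) = \int[m1]_(x in D1) \int[m2]_(y in D2) f (x, y).
  rewrite [RHS]integral_mkcond; apply: eq_integral => x _; rewrite patchE.
  case: ifPn => xD.
    rewrite [RHS]integral_mkcond; apply: eq_integral => y _; rewrite /h !patchE.
    by rewrite in_setX/= xD.
  rewrite -[RHS](@integral0 _ _ _ m2 setT); apply: eq_integral => y _.
  by rewrite /h patchE in_setX/= (negbTE xD).
move=> ->.
rewrite [RHS]integral_mkcond; apply: eq_integral => y _; rewrite patchE.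
case: ifPn => yD.
  rewrite [RHS]integral_mkcond; apply: eq_integral => x _; rewrite /h !patchE.
  by rewrite in_setX/= yD andbT.
rewrite -[RHS](@integral0 _ _ _ m1 setT); apply: eq_integral => x _.
by rewrite /h patchE in_setX/= (negbTE yD) andbF.
Qed.

End FubiniOnDomains.

Section GammaBeta.
Context {R : realType}.
Notation mu := (@lebesgue_measure R).

Definition gam (s : R) : \bar R := ipos (fun t => t `^ (s - 1) * expR (- t)).

(** Euler's integral of t^(p - 1) (1 - t)^(q - 1) over the unit interval, after t = u / (1 + u).
    Like [gam], it takes values in [\bar R], so that Tonelli applies before finiteness is known. *)
Definition bet (p q : R) : \bar R :=
  ipos (fun u => u `^ (p - 1) * (1 + u) `^ (- (p + q))).

Lemma GammaIE (s : R) : GammaI s = fine (gam s).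
Proof. by []. Qed.

Lemma powRDp (x r t : R) : 0 < x -> x `^ (r + t) = x `^ r * x `^ t.
Proof. by move=> x0; rewrite powRD// (gt_eqF x0) implybT. Qed.

Lemma powRN_cvg0 (q : R) : 0 < q -> x `^ (- q) @[x --> +oo] --> (0 : R).
Proof.
move=> q0; apply/cvgrPdist_lt => e e0.
near=> x.
have x0 : 0 < x by near: x; exact: nbhs_pinfty_gt.
rewrite sub0r normrN ger0_norm ?powR_ge0// powRN.
rewrite -(invrK e) ltf_pV2 ?posrE ?powR_gt0 ?invr_gt0//.
have -> : e^-1 = (e^-1 `^ q^-1) `^ q.
  by rewrite -powRrM mulVf ?gt_eqF// powRr1// invr_ge0 ltW.
have xe : e^-1 `^ q^-1 < x by near: x; exact: nbhs_pinfty_gt.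
by apply: gt0_ltr_powR; rewrite ?nnegrE ?powR_ge0 ?(ltW x0).
Unshelve. all: by end_near. Qed.

Lemma cvg_addy (f : R -> R) (l : R) :
  f x @[x --> +oo] --> l -> f (1 + x) @[x --> +oo] --> l.
Proof.
apply: (cvg_comp (fun x => 1 + x) f) => P [M [rM MP]].
by exists M; split => // x Mx; apply: MP; rewrite (lt_trans Mx)// ltrDr.
Qed.

Lemma continuous_powR (p x : R) : 0 < x -> {for x, continuous (fun y : R => y `^ p)}.
Proof.
move=> x0; apply: differentiable_continuous; apply/derivable1_diffP.
by apply: derivable_powR; rewrite in_itv/= x0.
Qed.

Lemma is_derive_powRD1 (p x : R) : 0 < 1 + x ->
  is_derive x 1 (fun y : R => (1 + y) `^ p) (p * (1 + x) `^ (p - 1)).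
Proof.
move=> x0.
have d1 : is_derive x 1 (fun y : R => 1 + y) 1.
  by rewrite -[X in is_derive _ _ _ X]add0r; apply: is_deriveD.
have := @is_derive1_comp _ (fun y : R => y `^ p) (fun y : R => 1 + y) x _ _ (is_derive1_powR p x0) d1.
by rewrite mulr1.
Qed.

Lemma continuous_powRD1 (p x : R) : 0 < 1 + x ->
  {for x, continuous (fun y : R => (1 + y) `^ p)}.
Proof.
move=> x0; apply: differentiable_continuous; apply/derivable1_diffP.
exact: (@ex_derive _ _ _ _ _ _ _ (is_derive_powRD1 p x0)).
Qed.

(** A primitive is explicit for p = 1. This case supplies the finite comparison integral in
    [gam_lty], the functional equation of [GammaI] and the lower bound [Beta_ge]. *)
Lemma bet1 (q : R) : 0 < q -> bet 1 q = (q^-1)%:E.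
Proof.
move=> q0; rewrite /bet.
rewrite (@eq_ipos _ _ (fun u => (1 + u) `^ (- q - 1))); last first.
  by move=> x x0; rewrite subrr powRr0 mul1r; congr powR; ring.
transitivity ((0 - - q^-1)%:E : \bar R); last by rewrite sub0r opprK.
apply: (@ipos_FTC _ _ (fun u => - q^-1 * (1 + u) `^ (- q))).
- mfun.
- by move=> x _; exact: powR_ge0.
- by move=> x x0; apply: continuous_powRD1; rewrite addr_gt0.
- move=> x x0.
  have -> : (1 + x) `^ (- q - 1) = (- q^-1) *: (- q * (1 + x) `^ (- q - 1)).
    by rewrite /GRing.scale/= mulrA mulrNN mulVf ?mul1r// gt_eqF.
  apply: (@is_deriveZ _ _ _ (fun t : R => (1 + t) `^ (- q))).
  by apply: is_derive_powRD1; rewrite addr_gt0.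
- rewrite -[X in _ --> X](_ : - q^-1 * (1 + 0) `^ (- q) = _); last first.
    by rewrite addr0 powR1 mulr1.
  apply: cvgMl_tmp; apply: cvg_at_right_filter.
  by apply: continuous_powRD1; rewrite addr0.
- rewrite -[X in _ --> X](mulr0 (- q^-1)); apply: cvgMl_tmp.
  by apply: (@cvg_addy (fun x => x `^ (- q))); exact: powRN_cvg0.
Qed.

(** This is [t / p <= expR (t / p)], raised to the power p. *)
Lemma powR_le_expR (p t : R) : 0 < p -> 0 < t -> t `^ p <= p `^ p * expR t.
Proof.
move=> p0 t0.
have h : t / p <= expR (t / p) by rewrite (le_trans _ (expR_ge1Dx _))// lerDr.
have tp : 0 <= t / p by rewrite divr_ge0// ltW.
have -> : t = p * (t / p) by rewrite mulrC divfK// gt_eqF.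
rewrite powRM ?(ltW p0)// ler_wpM2l ?powR_ge0//.
apply: (@le_trans _ _ (expR (t / p) `^ p)).
  by apply: ge0_ler_powR; rewrite ?nnegrE ?expR_ge0// ltW.
by rewrite -expRM (mulrC p).
Qed.

Lemma ipos_split1 (f : R -> R) : measurable_fun [set: R] f ->
  (forall x, 0 < x -> 0 <= f x) ->
  ipos f = (\int[mu]_(t in `]0%R, 1%R]) (f t)%:E + \int[mu]_(t in `]1%R, +oo[) (f t)%:E)%E.
Proof.
move=> mf f0.
rewrite -ge0_integral_setU//=.
- congr (integral _ _ _); apply/seteqP; split => x /=; rewrite !in_itv/= !andbT.
    by move=> x0; have [|] := leP x 1; [left|right]; rewrite ?x0.
  by move=> [/andP[]//|]; exact: lt_trans.
- by apply/measurable_EFinP; exact: measurable_funTS.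
- move=> x [|] /=; rewrite in_itv/= => /andP[x0 _]; rewrite lee_fin f0//.
  exact: lt_trans x0.
- rewrite disj_set2E; apply/eqP/seteqP; split => x //= [].
  by rewrite !in_itv/= andbT => /andP[_ x1]; rewrite ltNge x1.
Qed.

Lemma gam_gt0 (s : R) : (0 < gam s)%E.
Proof.
apply: ipos_gt0 => [|x x0]; last by rewrite mulr_gt0 ?powR_gt0 ?expR_gt0.
by mfun.
Qed.

Lemma gam_lty (s : R) : 0 < s -> (gam s < +oo)%E.
Proof.
move=> s0; rewrite /gam ipos_split1; last 2 first.
- by mfun.
- by move=> x x0; rewrite mulr_ge0 ?powR_ge0 ?expR_ge0.
apply: lte_add_pinfty.
  apply: (@le_lt_trans _ _ (s^-1)%:E); last exact: ltry.
  rewrite -integral_powR01//; apply: ge0_le_integral => //=.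
  - by move=> x _; rewrite lee_fin mulr_ge0 ?powR_ge0 ?expR_ge0.
  - by apply/measurable_EFinP; apply: measurable_funTS; mfun.
  - by apply/measurable_EFinP; apply: measurable_funTS; mfun.
  - move=> x; rewrite in_itv/= => /andP[x0 _]; rewrite lee_fin ler_piMr ?powR_ge0//.
    by rewrite -expR0 ler_expR oppr_le0 ltW.
(* On []1, +oo[] the integrand is at most C (1 + t)^(-2): the factor 4 comes from (1 + t)^2 <= 4
   t^2, the power from [powR_le_expR] with exponent s + 1. *)
pose C : R := 4 * (s + 1) `^ (s + 1).
have sq (y : R) : 1 < y -> (1 + y) ^+ 2 <= 4 * y ^+ 2.
  move=> y1; rewrite -subr_ge0 (_ : _ - _ = (3 * y + 1) * (y - 1)); last by ring.
  by rewrite mulr_ge0//; lra.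
have C0 : 0 <= C by rewrite mulr_ge0 ?powR_ge0.
apply: (@le_lt_trans _ _ (ipos (fun u : R => C * (1 + u) `^ (- 2)))).
  apply: (@le_trans _ _ (\int[mu]_(u in `]1%R, +oo[) (C * (1 + u) `^ (- 2))%:E)%E).
    apply: ge0_le_integral => //=.
    - by move=> x _; rewrite lee_fin mulr_ge0 ?powR_ge0 ?expR_ge0.
    - by apply/measurable_EFinP; apply: measurable_funTS; mfun.
    - by apply/measurable_EFinP; apply: measurable_funTS; mfun.
    - move=> x; rewrite in_itv/= andbT => x1; rewrite lee_fin.
      have x0 : 0 < x by exact: lt_trans x1.
      have x10 : 0 < 1 + x by rewrite addr_gt0.
      rewrite powRN ler_pdivlMr ?powR_gt0// powR_mulrn ?(ltW x10)//.
      rewrite expRN mulrAC ler_pdivrMr ?expR_gt0//.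
      apply: (@le_trans _ _ (x `^ (s - 1) * (4 * x `^ 2))).
        by rewrite ler_wpM2l ?powR_ge0// powR_mulrn ?(ltW x0)// sq.
      rewrite mulrCA -powRDp//.
      rewrite -mulrA ler_wpM2l// (_ : s - 1 + 2 = s + 1); last by ring.
      by apply: powR_le_expR; rewrite // addr_gt0.
  apply: ge0_subset_integral => //=.
  - by apply/measurable_EFinP; apply: measurable_funTS; mfun.
  - by move=> x _; rewrite lee_fin mulr_ge0 ?powR_ge0.
  - by move=> x /=; rewrite !in_itv/= !andbT; exact: lt_trans.
rewrite iposZl//; last 2 first.
- by mfun.
- by move=> x _; exact: powR_ge0.
rewrite lte_mul_pinfty//.
apply: (@le_lt_trans _ _ (bet 1 1)); last by rewrite bet1// ltry.
rewrite /bet; apply: le_ipos; [by mfun|by mfun|] => x x0.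
by rewrite powR_ge0/= subrr powRr0 mul1r.
Qed.

Lemma GammaI_gt0 (s : R) : 0 < s -> 0 < GammaI s.
Proof. by move=> s0; rewrite GammaIE fine_gt0// gam_gt0 gam_lty. Qed.

Lemma gamE (s : R) : 0 < s -> gam s = (GammaI s)%:E.
Proof.
by move=> s0; rewrite GammaIE fineK// ge0_fin_numE ?gam_lty// ltW// gam_gt0.
Qed.

Lemma gam_scale (s l : R) : 0 < l ->
  gam s = ((l `^ s)%:E * ipos (fun t => t `^ (s - 1) * expR (- (l * t))))%E.
Proof.
move=> l0; rewrite /gam (@ipos_scale _ l (fun t => t `^ (s - 1) * expR (- t)) l0); last 2 first.
- by mfun.
- by move=> x x0; rewrite mulr_ge0 ?powR_ge0 ?expR_ge0.
rewrite (@eq_ipos _ _ (fun t => l `^ (s - 1) * (t `^ (s - 1) * expR (- (l * t))))); last first.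
  by move=> x x0; rewrite powRM ?(ltW l0) ?(ltW x0)// mulrA.
rewrite iposZl ?powR_ge0//; last 2 first.
- by mfun.
- by move=> x x0; rewrite mulr_ge0 ?powR_ge0 ?expR_ge0.
rewrite muleA -EFinM; congr (_%:E * _)%E.
rewrite -[X in X * _](powRr1 (ltW l0)) -powRDp//.
by congr powR; ring.
Qed.

(** Rescaling the integral of [gam p] by x inside that of [gam q] gives the double integral of u^(p
    - 1) x^(p + q - 1) exp (- (1 + u) x). Integrating over x first leaves (1 + u)^(- (p + q)) times
    [gam (p + q)]. *)
Lemma gam_bet (p q : R) : 0 < p -> 0 < q ->
  (gam p * gam q = bet p q * gam (p + q))%E.
Proof.
move=> p0 q0.
pose f (z : R * R) : R := z.2 `^ (p - 1) * (z.1 `^ (p + q - 1) * expR (- ((1 + z.2) * z.1))).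
have mf : measurable_fun [set: R * R] f by rewrite /f; mfun.
have f0 z : 0 <= f z by rewrite /f !mulr_ge0 ?powR_ge0 ?expR_ge0.
have fE (x u : R) : 0 < x ->
    f (x, u) = x `^ (q - 1) * expR (- x) * x `^ p * (u `^ (p - 1) * expR (- (x * u))).
  move=> x0; rewrite /f/= (_ : p + q - 1 = (q - 1) + p); last by ring.
  rewrite (@powRDp x (q - 1) p)// (_ : - ((1 + u) * x) = (- x) + - (x * u)); last by ring.
  by rewrite expRD; ring.
transitivity (\int[mu]_(x in positives) \int[mu]_(y in positives) (f (x, y))%:E)%E.
  rewrite muleC [in LHS](gamE p0) -ge0_integralZr//=; last 3 first.
  - by apply/measurable_EFinP; apply: measurable_funTS; mfun.
  - by move=> x _; rewrite lee_fin mulr_ge0 ?powR_ge0 ?expR_ge0.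
  - by rewrite lee_fin ltW// GammaI_gt0.
  apply: eq_integral => x; rewrite inE/= in_itv/= andbT => x0.
  rewrite -(gamE p0) (gam_scale _ x0) muleA -EFinM -iposZl ?mulr_ge0 ?powR_ge0 ?expR_ge0//; last 2 first.
  - by mfun.
  - by move=> u _; rewrite mulr_ge0 ?powR_ge0 ?expR_ge0.
  by apply: eq_ipos => u u0; rewrite fE.
rewrite (@fubini_tonelli_dom _ _ _ _ _ mu mu positives positives (fun z => (f z)%:E))//; last 2 first.
- exact/measurable_EFinP.
- by move=> x y _ _; rewrite lee_fin.
rewrite [in RHS]gamE ?addr_gt0// -ge0_integralZr//=; last 3 first.
- by apply/measurable_EFinP; apply: measurable_funTS; mfun.
- by move=> x _; rewrite lee_fin mulr_ge0 ?powR_ge0.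
- by rewrite lee_fin ltW// GammaI_gt0// addr_gt0.
apply: eq_integral => u; rewrite inE/= in_itv/= andbT => u0.
have u10 : 0 < 1 + u by rewrite addr_gt0.
rewrite -(gamE (addr_gt0 p0 q0)) (gam_scale _ u10) muleA -EFinM -mulrA -powRDp//.
rewrite addNr powRr0 mulr1 -iposZl ?powR_ge0//; first by mfun.
by move=> x x0; rewrite mulr_ge0 ?powR_ge0 ?expR_ge0.
Qed.

Lemma gam1 : gam 1 = 1%E :> \bar R.
Proof.
have dN (x : R) : is_derive x 1 (fun x : R => - expR (- x)) (expR (- x)).
  have dN1 : is_derive x 1 (fun x : R => - x) (- 1) by apply: is_deriveN.
  have d2 := @is_derive1_comp _ expR (fun x : R => - x) x _ _ (is_derive_expR (- x)) dN1.
  have := @is_deriveN _ _ _ _ x 1 _ d2.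
  by rewrite mulrN1 opprK.
have dE (x : R) : {for x, continuous (fun x : R => expR (- x))}.
  by apply: continuous_comp; [exact: continuousN|exact: continuous_expR].
rewrite /gam (@eq_ipos _ _ (fun x => expR (- x))); last first.
  by move=> x x0; rewrite subrr powRr0 mul1r.
transitivity ((0 - -1)%:E : \bar R); last by rewrite sub0r opprK.
apply: (@ipos_FTC _ _ (fun x => - expR (- x))).
- by mfun.
- by move=> x _; exact: expR_ge0.
- by move=> x _; exact: dE.
- rewrite -[X in _ --> - X](@expR0 R) -[X in expR X]oppr0.
  by apply: cvgN; apply: cvg_at_right_filter; exact: dE.
- rewrite -oppr0; apply: cvgN; exact: cvgr_expR.
Qed.

Lemma GammaI1 : GammaI 1 = 1 :> R.
Proof. by rewrite GammaIE gam1. Qed.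

(** The case p = 1 of [gam_bet], with [gam 1 = 1] and [bet1]; no integration by parts is
    involved. *)
Lemma GammaIS (s : R) : 0 < s -> GammaI (s + 1) = s * GammaI s.
Proof.
move=> s0; have := gam_bet ltr01 s0.
rewrite gam1 mul1e bet1// addrC !gamE// ?addr_gt0// -EFinM => -[->].
by rewrite mulrA mulfV ?mul1r// gt_eqF.
Qed.

Lemma bet_ge0 (p q : R) : (0 <= bet p q)%E.
Proof. by apply: ipos_ge0 => x _; rewrite mulr_ge0 ?powR_ge0. Qed.

Lemma bet_gt0 (p q : R) : (0 < bet p q)%E.
Proof.
apply: ipos_gt0 => [|x x0]; first by mfun.
by rewrite mulr_gt0 ?powR_gt0// addr_gt0.
Qed.

(** Read off [gam_bet]: an infinite [bet p q] would make the finite product [gam p * gam q]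
    infinite. *)
Lemma bet_lty (p q : R) : 0 < p -> 0 < q -> (bet p q < +oo)%E.
Proof.
move=> p0 q0; rewrite ltey; apply/eqP => boo.
have := gam_bet p0 q0; rewrite boo !gamE ?addr_gt0// -EFinM.
by rewrite gt0_mulye// lte_fin GammaI_gt0// addr_gt0.
Qed.

End GammaBeta.

(* Locked so that arithmetic tactics do not unfold the integral when comparing atoms. *)
HB.lock Definition Beta (R : realType) (p q : R) : R := fine (bet p q).
Arguments Beta {R} p q.

Section BetaFunction.
Context {R : realType}.


Lemma betE (p q : R) : 0 < p -> 0 < q -> bet p q = (Beta p q)%:E.
Proof.
by move=> p0 q0; rewrite Beta.unlock fineK// ge0_fin_numE ?bet_lty// bet_ge0.
Qed.

Lemma Beta_gt0 (p q : R) : 0 < p -> 0 < q -> 0 < Beta p q.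
Proof. by move=> p0 q0; rewrite -lte_fin -betE// bet_gt0. Qed.

Lemma BetaE (p q : R) : 0 < p -> 0 < q ->
  Beta p q = GammaI p * GammaI q / GammaI (p + q).
Proof.
move=> p0 q0; apply/eqP; rewrite eq_sym -subr_eq0.
have := gam_bet p0 q0; rewrite betE// !gamE ?addr_gt0// -!EFinM => -[->].
by rewrite mulfK ?subrr// gt_eqF// GammaI_gt0// addr_gt0.
Qed.

Lemma BetaC (p q : R) : 0 < p -> 0 < q -> Beta p q = Beta q p.
Proof. by move=> p0 q0; rewrite (BetaE p0 q0) (BetaE q0 p0) (mulrC (GammaI p)) (addrC p). Qed.

Lemma Beta_decr (p q1 q2 : R) : 0 < p -> 0 < q1 -> q1 < q2 -> Beta p q2 < Beta p q1.
Proof.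
move=> p0 q10 q12; have q20 : 0 < q2 := lt_trans q10 q12.
pose g u := u `^ (p - 1) * ((1 + u) `^ (- (p + q1)) - (1 + u) `^ (- (p + q2))).
have g0 x : 0 < x -> 0 < g x.
  move=> x0; rewrite mulr_gt0 ?powR_gt0// subr_gt0.
  have x1 : 1 < 1 + x by rewrite ltrDl.
  rewrite /powR gt_eqF ?addr_gt0// ltr_expR ltr_pM2r ?ln_gt0//.
  by rewrite ltrN2 ltrD2l.
have mg : measurable_fun [set: R] g by mfun.
have : bet p q1 = (bet p q2 + ipos g)%E.
  rewrite -iposD//; last 3 first.
  - by mfun.
  - by move=> x x0; rewrite mulr_ge0 ?powR_ge0.
  - by move=> x /g0/ltW.
  by apply: eq_ipos => x x0; rewrite /g; ring.
have : (0 < ipos g)%E by exact: ipos_gt0.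
rewrite !betE//; case: (ipos g) => //= r r0 [->].
by rewrite ltrDl.
Qed.

(** Since p <= 1, u^(p - 1) >= (1 + u)^(p - 1), which reduces the integral to [bet1]. The bound
    shows the blow-up as q tends to 0 on which [critical_exponent] relies. *)
Lemma Beta_ge (p q : R) : 0 < p -> p <= 1 -> 0 < q -> q^-1 <= Beta p q.
Proof.
move=> p0 p1 q0; rewrite -lee_fin -betE// -bet1//.
rewrite /bet; apply: le_ipos; [by mfun|by mfun|] => x x0.
have x10 : 0 < 1 + x by rewrite addr_gt0.
rewrite mulr_ge0 ?powR_ge0//= subrr powRr0 mul1r.
have -> : (1 + x) `^ (- (1 + q)) = (1 + x) `^ (p - 1) * (1 + x) `^ (- (p + q)).
  rewrite -powRDp//.
  by congr powR; ring.
rewrite ler_wpM2r ?powR_ge0//.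
rewrite -(opprB 1 p) !powRN lef_pV2 ?posrE ?powR_gt0//.
by apply: ge0_ler_powR; rewrite ?nnegrE ?subr_ge0 ?(ltW x0) ?(ltW x10)// lerDr.
Qed.

(* The Lipschitz constant is finite because ln (1 + u) <= (1 + u)^e / e. *)
Lemma Beta_lip (p q1 q2 e : R) : 0 < p -> 0 < e -> e < q1 -> q1 <= q2 ->
  `|Beta p q1 - Beta p q2| <= (q2 - q1) * (e^-1 * Beta p (q1 - e)).
Proof.
move=> p0 e0 eq1 q12.
have q10 : 0 < q1 := lt_trans e0 eq1.
have q20 : 0 < q2 := lt_le_trans q10 q12.
rewrite ger0_norm; last first.
  rewrite subr_ge0; move: q12; rewrite le_eqVlt => /predU1P[->//|q12].
  by rewrite ltW// Beta_decr.
rewrite lerBlDl -lee_fin EFinD EFinM (EFinM e^-1) -!betE ?subr_gt0//.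
rewrite muleA -EFinM -iposZl; last 3 first.
- by mfun.
- by rewrite mulr_ge0 ?invr_ge0 ?(ltW e0)// subr_ge0.
- by move=> x x0; rewrite mulr_ge0 ?powR_ge0.
rewrite -iposD; last 4 first.
- by mfun.
- by mfun.
- by move=> x x0; rewrite mulr_ge0 ?powR_ge0.
- by move=> x x0; rewrite !mulr_ge0 ?powR_ge0 ?invr_ge0 ?(ltW e0)// subr_ge0.
apply: le_ipos; [by mfun|by mfun|] => x x0.
have x10 : 0 < 1 + x by rewrite addr_gt0.
rewrite mulr_ge0 ?powR_ge0//=.
rewrite [X in _ <= _ + X]mulrCA -mulrDr ler_wpM2l ?powR_ge0//.
have -> : (1 + x) `^ (- (p + (q1 - e))) = (1 + x) `^ (- (p + q1)) * (1 + x) `^ e.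
  rewrite -powRDp//.
  by congr powR; ring.
have -> : (1 + x) `^ (- (p + q2)) = (1 + x) `^ (- (p + q1)) * (1 + x) `^ (- (q2 - q1)).
  rewrite -powRDp//.
  by congr powR; ring.
rewrite mulrCA -mulrDr ler_peMr ?powR_ge0//.
have h1 : ln (1 + x) <= e^-1 * (1 + x) `^ e.
  rewrite ler_pdivlMl// -ln_powR.
  have : 0 < (1 + x) `^ e by rewrite powR_gt0.
  set y := _ `^ e => y0; have := @le_ln1Dx _ (y - 1).
  by rewrite (addrC 1 (y - 1)) subrK => h; apply: (le_trans (h _)); lra.
have h2 : 1 - (1 + x) `^ (- (q2 - q1)) <= (q2 - q1) * ln (1 + x).
  rewrite lerBlDr -lerBlDl /powR gt_eqF// mulNr.
  exact: expR_ge1Dx.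
rewrite -lerBlDl; apply: (le_trans h2).
by rewrite -mulrA ler_wpM2l// subr_ge0.
Qed.

End BetaFunction.

(** * The reflection formula *)

Section Reflection.
Context {R : realType}.
Notation mu := (@lebesgue_measure R).
Implicit Types s t x y : R.

Let cpi3 : cos (pi / 3) = 2^-1 :> R.
Proof.
have c0 : 0 < cos (pi / 3) :> R.
  by apply: cos_gt0_pihalf; have := @pi_gt0 R; lra.
have : cos (pi / 3 + (pi / 3 + pi / 3)) = -1 :> R.
  by rewrite -cospi; congr cos; field.
rewrite cosD cosD sinD; have := @cos2Dsin2 R (pi / 3).
move: (cos _) (sin _) c0 => c w c0 h1 h2.
(* The triple-angle formula at pi reads 4 c^3 - 3 c = -1, and 4 c^3 - 3 c + 1 factors in this
   way. *)
have : (c + 1) * (2 * c - 1) ^+ 2 = 0.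
  have -> : (c + 1) * (2 * c - 1) ^+ 2 = 4 * c ^+ 3 - 3 * c + 1 by ring.
  have w2 : w ^+ 2 = 1 - c ^+ 2 by rewrite -h1; ring.
  have -> : 4 * c ^+ 3 - 3 * c + 1 = c * (c * c - w * w) - w * (w * c + c * w) + 1 + 3 * c * (w ^+ 2 - (1 - c ^+ 2)) by ring.
  by rewrite h2 w2; ring.
move=> /eqP; rewrite mulf_eq0 expf_eq0/= => /orP[|]/eqP h; first lra.
lra.
Qed.

(** Rests on sin 3y = 4 sin y sin (y + pi / 3) sin (y + 2 pi / 3). With y = pi s / 3 it is the
    trigonometric counterpart of [f_triple]. *)
Let csc_triple y : 0 < y < pi / 3 ->
  (sin y)^-1 + (sin (y + 2 * (pi / 3)))^-1 =
  3 * (sin (3 * y))^-1 + (sin (y + pi / 3))^-1.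
Proof.
move=> /andP[y0 y3]; have p0 := @pi_gt0 R.
have P0 : 0 < sin y by apply: sin_gt0_pi; lra.
have A0 : 0 < sin (y + pi / 3) by apply: sin_gt0_pi; lra.
have B0 : 0 < sin (y + 2 * (pi / 3)) by apply: sin_gt0_pi; lra.
have w2 : sin (pi / 3) ^+ 2 = 3 / 4 :> R.
  by rewrite sin2cos2 cpi3; field.
have pq := @cos2Dsin2 R y.
have A_E : sin (y + pi / 3) = sin y / 2 + cos y * sin (pi / 3).
  by rewrite sinD cpi3.
have B_E : sin (y + 2 * (pi / 3)) = - sin y / 2 + cos y * sin (pi / 3).
  rewrite (_ : 2 * (pi / 3) = pi / 3 + pi / 3) ?sinD ?cosD ?cpi3; last by ring.
  have -> : (2^-1 * 2^-1 - sin (pi / 3) * sin (pi / 3) = - 2^-1 :> R)%R.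
    by rewrite -(expr2 (sin _)) w2; field.
  by field.
have S_E : sin (3 * y) = 4 * (sin y * sin (y + pi / 3) * sin (y + 2 * (pi / 3))).
  rewrite A_E B_E (_ : 3 * y = y + (y + y)); last by ring.
  rewrite !(sinD, cosD).
  have -> : 4 * (sin y * (sin y / 2 + cos y * sin (pi / 3)) *
      (- sin y / 2 + cos y * sin (pi / 3))) =
     sin y * (4 * cos y ^+ 2 * (sin (pi / 3)) ^+ 2 - sin y ^+ 2) by field.
  by rewrite w2; field.
rewrite S_E; move: pq w2 A_E B_E P0 A0 B0.
move: (sin y) (cos y) (sin (y + pi / 3)) (sin (y + 2 * (pi / 3))) (sin (pi / 3)).
move=> P Q A B w pq w2 AE BE P0 A0 B0.
apply/eqP; rewrite -subr_eq0; apply/eqP.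
have -> : P^-1 + B^-1 - (3 / (4 * (P * A * B)) + A^-1) =
  (4 * A * B + 4 * P * A - 3 - 4 * P * B) / (4 * (P * A * B)).
  by field; rewrite !gt_eqF.
have -> : 4 * A * B + 4 * P * A - 3 - 4 * P * B =
   3 * (Q ^+ 2 + P ^+ 2 - 1) + 4 * Q ^+ 2 * (w ^+ 2 - 3 / 4).
  by rewrite AE BE; field.
by rewrite pq w2 !subrr !mulr0 addr0 mul0r.
Qed.

Let sin_bounds x : 0 < x <= pi / 2 -> x * cos x <= sin x <= x.
Proof.
move=> /andP[x0 xp]; have p0 := @pi_gt0 R.
have [c] := @MVT_segment R sin cos 0 x (ltW x0) (fun y _ => is_derive_sin y) (continuous_subspaceT (@continuous_sin R)).
rewrite in_itv/= => /andP[c0 cx]; rewrite sin0 !subr0 => ->.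
rewrite mulrC ler_pM2r// ler_piMl ?cos_le1 ?(ltW x0)// andbT.
move: cx; rewrite le_eqVlt => /predU1P[->//|cx].
by rewrite ltW// ltr_cos// in_itv/=; apply/andP; split; lra.
Qed.

Let cos_bound x : 0 < x <= pi / 2 -> 1 - cos x <= x ^+ 2.
Proof.
move=> /andP[x0 xp]; have p0 := @pi_gt0 R.
have [c] := @MVT_segment R cos (fun y => - sin y) 0 x (ltW x0) (fun y _ => is_derive_cos y) (continuous_subspaceT (@continuous_cos R)).
rewrite in_itv/= => /andP[c0 cx]; rewrite cos0 subr0 => h.
have -> : 1 - cos x = sin c * x by lra.
rewrite expr2 ler_pM2r//; apply: (le_trans _ cx).
move: c0; rewrite le_eqVlt => /predU1P[<-|c0]; first by rewrite sin0.
have cp : 0 < c <= pi / 2 by apply/andP; split; lra.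
by have /andP[] := sin_bounds cp.
Qed.

(** A crude linear bound is all that [csc_lip] needs. Up to 1/2 it follows from sin y >= y cos y;
    beyond, sin x is at least 3/8 by monotonicity, while x < 2. *)
Let sin_lower x : 0 < x <= pi / 2 -> x / 8 <= sin x.
Proof.
move=> /andP[x0 xp]; have p0 := @pi_gt0 R; have p4 := @pihalf_lt2 R.
have small y : 0 < y <= 2^-1 -> 3 / 4 * y <= sin y.
  move=> /andP[y0 y2]; have p1 := @pihalf_ge1 R.
  have yp : 0 < y <= pi / 2 by apply/andP; split; lra.
  have /andP[h1 _] := sin_bounds yp; have h2 := cos_bound yp.
  apply: le_trans h1; rewrite mulrC ler_pM2l//.
  have : y ^+ 2 <= 1 / 4 by nra.
  lra.
have [x2|x2] := leP x 2^-1.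
  by have := @small x _; rewrite x0 x2 => /(_ isT); lra.
have h : 3 / 4 * 2^-1 <= sin (2^-1) :> R by apply: small; lra.
have : sin 2^-1 < sin x.
  by rewrite ltr_sin// in_itv/=; have p1 := @pihalf_ge1 R; apply/andP; split; lra.
by lra.
Qed.

(** Subtracting the inverse removes the pole of the cosecant. The derivative is (sin^2 z - z^2 cos
    z) / (z^2 sin^2 z): its numerator is at most z^4 in absolute value, and its denominator is at
    least z^4 / 64 by [sin_lower]. *)
Let csc_lip x y : 0 < x -> x <= y -> y <= pi / 2 ->
  `|((sin y)^-1 - y^-1) - ((sin x)^-1 - x^-1)| <= 64 * (y - x).
Proof.
move=> x0 xy yp.
pose k z : R := (sin z)^-1 - z^-1.
pose dk z : R := (- (sin z) ^- 2) * cos z + z ^- 2.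
have zE z : x <= z <= y -> 0 < z <= pi / 2.
  by move=> /andP[xz zy]; rewrite (lt_le_trans x0)//= (le_trans zy).
have s0 z : x <= z <= y -> 0 < sin z.
  by move=> /zE zz; have := sin_lower zz; move: zz => /andP[z0 _]; lra.
have dkE z : x <= z <= y -> is_derive z 1 k (dk z).
  move=> zz; have sz := s0 _ zz; have /andP[z0 _] := zE _ zz.
  have d1 : is_derive z 1 (fun w : R => (sin w)^-1) (- sin z ^- 2 * cos z).
    exact: (@is_deriveV R sin z (cos z) 1 (lt0r_neq0 sz) (is_derive_sin z)).
  have d2 : is_derive z 1 (fun w : R => w^-1) (- z ^- 2 * 1).
    exact: (@is_deriveV R id z 1 1 (lt0r_neq0 z0) (is_derive_id z 1)).
  rewrite /dk -[z ^- 2]opprK -[- z ^- 2]mulr1.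
  exact: (@is_deriveB _ _ _ _ _ z 1 _ _ d1 d2).
have ck : {within `[x, y], continuous k}.
  apply: continuous_in_subspaceT => z; rewrite inE/= in_itv/= => zz.
  apply: differentiable_continuous; apply/derivable1_diffP.
  exact: (@ex_derive _ _ _ _ _ _ _ (dkE _ zz)).
have [c] := @MVT_segment R k dk x y xy (fun z zz => dkE z (subset_itv_oo_cc zz)) ck.
rewrite in_itv/= => cc; rewrite /k => ->.
rewrite normrM [X in _ * X]ger0_norm ?subr_ge0// ler_wpM2r ?subr_ge0//.
have /andP[c0 cp] := zE _ cc; have sc := s0 _ cc.
have /andP[h1 h2] := sin_bounds (zE _ cc).
have h3 := cos_bound (zE _ cc); have h4 := sin_lower (zE _ cc).
have cc0 : 0 <= cos c by apply: cos_ge0_pihalf; have := @pi_gt0 R; lra.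
have -> : dk c = (sin c ^+ 2 - c ^+ 2 * cos c) / (c ^+ 2 * sin c ^+ 2).
  by rewrite /dk; field; rewrite !gt_eqF.
rewrite normrM [X in _ * X]ger0_norm; last first.
  by rewrite invr_ge0 mulr_ge0// sqr_ge0.
rewrite ler_pdivrMr ?mulr_gt0 ?exprn_gt0//.
have c1 : cos c <= 1 := cos_le1 c.
apply: (@le_trans _ _ (c ^+ 4)).
  rewrite ler_norml; apply/andP; split.
    have : (c * cos c) ^+ 2 <= sin c ^+ 2.
      by rewrite lerXn2r ?nnegrE ?mulr_ge0 ?(ltW sc) ?(ltW c0).
    have h5 : 0 <= c ^+ 2 * cos c * (c ^+ 2 - (1 - cos c)).
      by rewrite mulr_ge0 ?subr_ge0// mulr_ge0// sqr_ge0.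
    have h6 : 0 <= c ^+ 4 * (1 - cos c).
      by rewrite mulr_ge0 ?subr_ge0// exprn_ge0// ltW.
    have -> : c ^+ 4 = c ^+ 2 * cos c * (c ^+ 2 - (1 - cos c)) + c ^+ 4 * (1 - cos c)
       + c ^+ 2 * cos c - (c * cos c) ^+ 2 by ring.
    lra.
  have h5 : sin c ^+ 2 <= c ^+ 2 by rewrite lerXn2r ?nnegrE ?(ltW sc) ?(ltW c0).
  have h6 : 0 <= c ^+ 2 * (c ^+ 2 - (1 - cos c)).
    by rewrite mulr_ge0 ?subr_ge0// sqr_ge0.
  have -> : c ^+ 4 = c ^+ 2 * (c ^+ 2 - (1 - cos c)) + c ^+ 2 - c ^+ 2 * cos c by ring.
  lra.
have -> : c ^+ 4 = c ^+ 2 * (64 * (c / 8) ^+ 2) by field.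
rewrite mulrCA ler_wpM2l// ler_wpM2l ?sqr_ge0//.
by rewrite lerXn2r ?nnegrE ?(ltW sc)// divr_ge0// ltW.
Qed.

Let f s : R := Beta s (1 - s).

Let fE s : 0 < s < 1 -> ipos (fun u => u `^ (s - 1) * (1 + u) `^ (-1)) = (f s)%:E.
Proof.
move=> /andP[s0 s1]; transitivity (bet s (1 - s)); last by rewrite betE// subr_gt0.
by apply: eq_ipos => u u0; congr (_ * _ `^ _); ring.
Qed.

Let cube s : 0 < s < 1 ->
  ipos (fun v => 3 * (v `^ (3 * s - 1) * (1 + v ^+ 3) `^ (-1))) = (f s)%:E.
Proof.
move=> s01; rewrite -(fE s01) [RHS]ipos_cube.
- apply: eq_ipos => v v0 /=.
  have -> : (v ^+ 3) `^ (s - 1) * (1 + v ^+ 3) `^ (-1) * (3 * v ^+ 2) =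
     3 * ((v ^+ 3) `^ (s - 1) * v ^+ 2 * (1 + v ^+ 3) `^ (-1)) by ring.
  rewrite -(powR_mulrn 3 (ltW v0)) -powRrM -(powR_mulrn 2 (ltW v0)) -powRDp//.
  by congr (_ * (_ `^ _ * _)); ring.
- by mfun.
- by move=> x x0; rewrite mulr_ge0 ?powR_ge0.
- move=> x x0; apply: continuousM; first exact: continuous_powR.
  by apply: continuous_powRD1; rewrite addr_gt0.
Qed.

Let mcube s : measurable_fun [set: R]
  (fun v : R => 3 * (v `^ (3 * s - 1) * (1 + v ^+ 3) `^ (-1))).
Proof.
apply: measurable_funM; first exact: measurable_cst.
apply: measurable_funM; first exact: measurable_powR.
apply: (measurableT_comp (measurable_powR (-1))); apply: measurable_funD => //; exact: measurable_funX.
Qed.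

(** After u = v^3 the values at s / 3, (s + 1) / 3 and (s + 2) / 3 have integrands 3 v^(s - 1), 3
    v^s and 3 v^(s + 1) over 1 + v^3 = (1 + v) (1 - v + v^2). The identity is arranged without
    subtraction because it is proved on extended integrals. *)
Let f_triple s : 0 < s < 1 ->
  f (s / 3) + f ((s + 2) / 3) = 3 * f s + f ((s + 1) / 3).
Proof.
move=> s01; have /andP[s0 s1] := s01.
have c0 z x : 0 < x -> 0 <= 3 * (x `^ (3 * z - 1) * (1 + x ^+ 3) `^ (-1)).
  by move=> x0; rewrite mulr_ge0// mulr_ge0 ?powR_ge0.
have g0 x : 0 < x -> 0 <= x `^ (s - 1) * (1 + x) `^ (-1).
  by move=> x0; rewrite mulr_ge0 ?powR_ge0.
have h0 : 0 < s / 3 < 1 by apply/andP; split; lra.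
have h1 : 0 < (s + 1) / 3 < 1 by apply/andP; split; lra.
have h2 : 0 < (s + 2) / 3 < 1 by apply/andP; split; lra.
apply/EFin_inj; rewrite !EFinD EFinM -(cube h0) -(cube h1) -(cube h2) -(fE s01).
have mg : measurable_fun [set: R] (fun u : R => u `^ (s - 1) * (1 + u) `^ (-1)) by mfun.
have mg3 : measurable_fun [set: R] (fun u : R => 3 * (u `^ (s - 1) * (1 + u) `^ (-1))) by mfun.
have g30 x : 0 < x -> 0 <= 3 * (x `^ (s - 1) * (1 + x) `^ (-1)).
  by move=> x0; rewrite mulr_ge0 ?g0.
have Z := @iposZl _ 3 _ mg (ler0n R 3) g0.
rewrite -[X in _ = (X + _)%E]Z; apply: etrans (esym _) _; first exact: iposD (mcube _) (mcube _) (c0 _) (c0 _).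
apply: etrans; last exact: iposD mg3 (mcube _) g30 (c0 _).
apply: eq_ipos => v v0.
have v1 : 1 + v != 0 by rewrite gt_eqF ?addr_gt0.
have v3 : 1 + v ^+ 3 != 0 by rewrite gt_eqF ?addr_gt0 ?exprn_gt0.
rewrite !powR_inv1 ?addr_ge0 ?exprn_ge0 ?(ltW v0)//.
rewrite (_ : 3 * (s / 3) - 1 = s - 1); last by field.
rewrite (_ : 3 * ((s + 2) / 3) - 1 = (s - 1) + 2); last by field.
rewrite (_ : 3 * ((s + 1) / 3) - 1 = (s - 1) + 1); last by field.
rewrite (@powRDp _ v (s - 1) 2)// (@powRDp _ v (s - 1) 1)// powRr1 ?(ltW v0)//.
rewrite (powR_mulrn 2 (ltW v0)).
by field; rewrite v1 v3.
Qed.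

Let a s : \bar R := (\int[mu]_(u in `]1%R, +oo[) (u `^ (s - 1) * (1 + u) `^ (-1))%:E)%E.
Let b s : \bar R := (\int[mu]_(u in `]0%R, 1%R]) (u `^ s * (1 + u) `^ (-1))%:E)%E.

Let mI s (D : set R) : measurable D ->
  measurable_fun D (fun u : R => (u `^ s * (1 + u) `^ (-1))%:E).
Proof. by move=> mD; apply/measurable_EFinP; apply: measurable_funTS; mfun. Qed.

Let a_ge0 s : (0 <= a s)%E.
Proof. by apply: integral_ge0 => x _; rewrite lee_fin mulr_ge0 ?powR_ge0. Qed.

Let b_ge0 s : (0 <= b s)%E.
Proof. by apply: integral_ge0 => x _; rewrite lee_fin mulr_ge0 ?powR_ge0. Qed.

(* Splitting the integral at 1 gives f s = 1 / s + a s - b s, whose pole at 0 is that of pi / sin (pi * s). *)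
Let fab s : 0 < s < 1 -> ((f s)%:E + b s = (s^-1)%:E + a s)%E.
Proof.
move=> s01; have /andP[s0 s1] := s01.
rewrite -(fE s01) ipos_split1; last 2 first.
- by mfun.
- by move=> x x0; rewrite mulr_ge0 ?powR_ge0.
rewrite -/(a s) addeAC; congr (_ + _)%E.
rewrite -integral_powR01// -ge0_integralD//=.
- apply: eq_integral => x; rewrite inE/= in_itv/= => /andP[x0 x1].
  rewrite -EFinD; congr EFin; rewrite (_ : x `^ s = x `^ (s - 1) * x); last first.
    by rewrite -[X in _ * X](powRr1 (ltW x0)) -powRDp// subrK.
  have x10 : 0 < 1 + x by rewrite addr_gt0.
  rewrite powR_inv1 ?(ltW x10)// -mulrA -mulrDr -[X in X + x * _]mul1r -mulrDl.
  by rewrite mulfV ?mulr1// gt_eqF.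
- by move=> x _; rewrite lee_fin mulr_ge0 ?powR_ge0.
- exact: mI.
- by move=> x _; rewrite lee_fin mulr_ge0 ?powR_ge0.
- exact: mI.
Qed.

(** The integral of u^(-1/4) / (1 + u) over the half-line. It dominates the increments of both [a]
    and [b] once the logarithm is absorbed into a quarter power by [ln_ub]. *)
Let C : R := f (3 / 4).

Let ln_ub (x : R) : 0 < x -> ln x <= 4 * x `^ (1 / 4).
Proof.
move=> x0; suff : 1 / 4 * ln x <= x `^ (1 / 4) by lra.
have : 0 < x `^ (1 / 4) by rewrite powR_gt0.
rewrite -ln_powR; set y := _ `^ _ => y0; have := @le_ln1Dx _ (y - 1).
by rewrite (addrC 1 (y - 1)) subrK => h; apply: (le_trans (h _)); lra.
Qed.

Let a_mono s t : s <= t -> (a s <= a t)%E.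
Proof.
move=> st; apply: ge0_le_integral => //=.
- by move=> x _; rewrite lee_fin mulr_ge0 ?powR_ge0.
- exact: mI.
- exact: mI.
- move=> x; rewrite in_itv/= andbT => x1; rewrite lee_fin ler_wpM2r ?powR_ge0//.
  by rewrite ler_powR ?(ltW x1)// lerD2r.
Qed.

Let b_mono s t : s <= t -> (b t <= b s)%E.
Proof.
move=> st; apply: ge0_le_integral => //=.
- by move=> x _; rewrite lee_fin mulr_ge0 ?powR_ge0.
- exact: mI.
- exact: mI.
- move=> x; rewrite in_itv/= => /andP[x0 x1]; rewrite lee_fin ler_wpM2r ?powR_ge0//.
  by rewrite ger_powR ?x0.
Qed.

Let quarter_lty (D : set R) : measurable D -> (forall x, D x -> 0 < x) ->
  (\int[mu]_(u in D) (u `^ (- (1 / 4)) * (1 + u) `^ (-1))%:E <= C%:E)%E.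
Proof.
move=> mD D0; rewrite /C -fE; last by apply/andP; split; lra.
rewrite (_ : 3 / 4 - 1 = - (1 / 4)); last by field.
apply: ge0_subset_integral => //=.
- exact: mI.
- by move=> x _; rewrite lee_fin mulr_ge0 ?powR_ge0.
- by move=> x /D0 x0; rewrite /= in_itv/= x0.
Qed.

Let powR_lip (x s t : R) : 0 < x -> x `^ t - x `^ s <= (t - s) * ln x * x `^ t.
Proof.
move=> x0; rewrite lerBlDr -lerBlDl -[X in X - _]mul1r -mulrBl.
rewrite (_ : x `^ s = expR (- ((t - s) * ln x)) * x `^ t); last first.
  rewrite -mulNr opprB (_ : expR _ = x `^ (s - t)) -?powRDp ?subrK//.
  by rewrite /powR gt_eqF.
by rewrite ler_wpM2r ?powR_ge0// expR_ge1Dx.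
Qed.

(** The restriction t <= 1/2 leaves room for the logarithm: x^(1/4) x^(t - 1) <= x^(-1/4) for x >
    1. *)
Let a_lip s t : s <= t <= 2^-1 -> (a t <= a s + (4 * (t - s) * C)%:E)%E.
Proof.
move=> /andP[st t2].
apply: (@le_trans _ _ (a s + (4 * (t - s))%:E * \int[mu]_(u in `]1%R, +oo[)
    (u `^ (- (1 / 4)) * (1 + u) `^ (-1))%:E)%E); last first.
  rewrite leeD2l// (EFinM (4 * (t - s)) C) lee_wpmul2l ?lee_fin ?mulr_ge0 ?subr_ge0//.
  by apply: quarter_lty => // x /=; rewrite in_itv/= andbT; exact: lt_trans.
rewrite -ge0_integralZl_EFin//=; last 3 first.
- by move=> x _; rewrite lee_fin mulr_ge0 ?powR_ge0.
- exact: mI.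
- by rewrite mulr_ge0 ?subr_ge0.
rewrite -ge0_integralD//=; last 4 first.
- by move=> x _; rewrite lee_fin mulr_ge0 ?powR_ge0.
- exact: mI.
- by move=> x _; rewrite lee_fin mulr_ge0 ?mulr_ge0 ?powR_ge0 ?subr_ge0.
- by apply: measurable_funeM; exact: mI.
apply: ge0_le_integral => //=.
- by move=> x _; rewrite lee_fin mulr_ge0 ?powR_ge0.
- exact: mI.
- by apply: emeasurable_funD; [exact: mI|apply: measurable_funeM; exact: mI].
- move=> x; rewrite in_itv/= andbT => x1; rewrite -EFinD lee_fin.
  have x0 : 0 < x := lt_trans ltr01 x1.
  rewrite [_ * (_ * _ `^ (-1))]mulrA -mulrDl ler_wpM2r ?powR_ge0// -lerBlDl.
  apply: (le_trans (powR_lip _ _ x0)).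
  have -> : t - 1 - (s - 1) = t - s by ring.
  rewrite (mulrC 4) -!mulrA ler_wpM2l ?subr_ge0//.
  apply: (@le_trans _ _ (4 * x `^ (1 / 4) * x `^ (t - 1))).
    by rewrite ler_wpM2r ?powR_ge0 ?ln_ub.
  rewrite -mulrA -powRDp// ler_wpM2l// ler_powR ?(ltW x1)//; lra.
Qed.

Let b_lip s t : 0 <= s <= t -> (b s <= b t + (4 * (t - s) * C)%:E)%E.
Proof.
move=> /andP[s0 st].
apply: (@le_trans _ _ (b t + (4 * (t - s))%:E * \int[mu]_(u in `]0%R, 1%R])
    (u `^ (- (1 / 4)) * (1 + u) `^ (-1))%:E)%E); last first.
  rewrite leeD2l// (EFinM (4 * (t - s)) C) lee_wpmul2l ?lee_fin ?mulr_ge0 ?subr_ge0//.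
  by apply: quarter_lty => // x /=; rewrite in_itv/= => /andP[].
rewrite -ge0_integralZl_EFin//=; last 3 first.
- by move=> x _; rewrite lee_fin mulr_ge0 ?powR_ge0.
- exact: mI.
- by rewrite mulr_ge0 ?subr_ge0.
rewrite -ge0_integralD//=; last 4 first.
- by move=> x _; rewrite lee_fin mulr_ge0 ?powR_ge0.
- exact: mI.
- by move=> x _; rewrite lee_fin mulr_ge0 ?mulr_ge0 ?powR_ge0 ?subr_ge0.
- by apply: measurable_funeM; exact: mI.
apply: ge0_le_integral => //=.
- by move=> x _; rewrite lee_fin mulr_ge0 ?powR_ge0.
- exact: mI.
- by apply: emeasurable_funD; [exact: mI|apply: measurable_funeM; exact: mI].
- move=> x; rewrite in_itv/= => /andP[x0 x1]; rewrite -EFinD lee_fin.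
  rewrite [_ * (_ * _ `^ (-1))]mulrA -mulrDl ler_wpM2r ?powR_ge0// -lerBlDl.
  apply: (le_trans (powR_lip _ _ x0)).
  rewrite (_ : (s - t) * ln x = (t - s) * ln x^-1); last first.
    by rewrite lnV ?posrE//; ring.
  rewrite (mulrC 4) -!mulrA ler_wpM2l ?subr_ge0//.
  apply: (@le_trans _ _ (4 * x^-1 `^ (1 / 4) * x `^ s)).
    by rewrite ler_wpM2r ?powR_ge0 ?ln_ub ?invr_gt0.
  rewrite -mulrA ler_wpM2l// -powR_inv1 ?(ltW x0)// -powRrM mulN1r.
  rewrite ler_piMr ?powR_ge0// -[leRHS](powRr0 x) ger_powR ?x0//.
Qed.

Let a_lty s : s <= 2^-1 -> (a s < +oo)%E.
Proof.
move=> s2; apply: (@le_lt_trans _ _ (a (3 / 4))); first by apply: a_mono; lra.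
apply: (@le_lt_trans _ _ C%:E); last exact: ltry.
rewrite /a (_ : 3 / 4 - 1 = - (1 / 4)); last by field.
by apply: quarter_lty => // x /=; rewrite in_itv/= andbT; exact: lt_trans.
Qed.

Let b_lty s : 0 <= s -> (b s < +oo)%E.
Proof.
move=> s0; apply: (@le_lt_trans _ _ (b (- (1 / 4)))); first by apply: b_mono; lra.
apply: (@le_lt_trans _ _ C%:E); last exact: ltry.
by apply: quarter_lty => // x /=; rewrite in_itv/= => /andP[].
Qed.

Let f_lip s t : 0 < s -> s <= t -> t <= 2^-1 ->
  `|(f t - t^-1) - (f s - s^-1)| <= 8 * C * (t - s).
Proof.
move=> s0 st t2.
have s01 : 0 < s < 1 by apply/andP; split; lra.
have t01 : 0 < t < 1 by apply/andP; split; lra.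
have s2 : s <= 2^-1 by lra.
have := a_mono st; have := b_mono st.
have := @a_lip s t; rewrite st t2 => /(_ isT).
have := @b_lip s t; rewrite st (ltW s0) => /(_ isT).
have := fab s01; have := fab t01.
have := a_lty t2; have := a_lty s2; have := a_ge0 s; have := a_ge0 t.
have := @b_lty t; have := @b_lty s; have := b_ge0 s; have := b_ge0 t.
case: (a s) => [as_||]//; case: (a t) => [at_||]//.
case: (b s) => [bs||]//; case: (b t) => [bt||]//.
- move=> _ _ _ _ _ _ _ _; rewrite -!EFinD !lee_fin => -[h1] -[h2] h3 h4 h5 h6.
  by rewrite ler_norml; apply/andP; split; lra.
Qed.

Let h s : R := f s - pi / sin (pi * s).

(** [8 * C] comes from [f_lip]. In the other term one factor pi is the numerator of pi / sin (pi s),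
    the other the rescaling by pi in [csc_lip]. *)
Let L : R := 8 * C + 64 * pi ^+ 2.

Let h_lip_half s t : 0 < s -> s <= t -> t <= 2^-1 -> `|h t - h s| <= L * (t - s).
Proof.
move=> s0 st t2; have p0 := @pi_gt0 R.
have t0 : 0 < t by lra.
have -> : h t - h s = ((f t - t^-1) - (f s - s^-1)) -
   pi * (((sin (pi * t))^-1 - (pi * t)^-1) - ((sin (pi * s))^-1 - (pi * s)^-1)).
  have E x : 0 < x -> pi * (pi * x)^-1 = x^-1.
    by move=> x0; rewrite invfM mulrA mulfV ?mul1r// gt_eqF.
  by rewrite /h !mulrBr !E//; ring.
apply: (le_trans (ler_normB _ _)); rewrite /L (mulrDl (8 * C)); apply: lerD; first exact: f_lip.
rewrite normrM (ger0_norm (ltW p0)).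
have := @csc_lip (pi * s) (pi * t).
rewrite mulr_gt0// ler_pM2l// st ler_pM2l// t2 => /(_ isT isT isT) k.
apply: (@le_trans _ _ (pi * (64 * (pi * t - pi * s)))); first by rewrite ler_pM2l.
lra.
Qed.

Let h_sym s : 0 < s < 1 -> h (1 - s) = h s.
Proof.
move=> /andP[s0 s1]; rewrite /h /f BetaC ?subr_gt0//; last by lra.
congr (_ - _ / _); first by congr Beta; ring.
rewrite mulrBr mulr1 sinB sinpi cospi; ring.
Qed.

(** [h_lip_half] stops at 1/2; the symmetry [h_sym] covers the other half, and a pair on both sides
    of 1/2 is joined through 1/2. *)
Let h_lip s t : 0 < s < 1 -> 0 < t < 1 -> `|h t - h s| <= L * `|t - s|.
Proof.
wlog st : s t / s <= t.
  move=> H s01 t01; have [st|/ltW ts] := leP s t; first exact: H.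
  by rewrite distrC (distrC t); exact: H.
move=> s01 t01; have /andP[s0 s1] := s01; have /andP[t0 t1] := t01.
rewrite (@ger0_norm _ (t - s)) ?subr_ge0//.
have [t2|t2] := leP t 2^-1; first exact: h_lip_half.
have [s2|s2] := leP s 2^-1; last first.
  rewrite -(h_sym s01) -(h_sym t01) distrC (_ : t - s = (1 - s) - (1 - t)); last by ring.
  by apply: h_lip_half; lra.
rewrite (_ : h t - h s = (h t - h 2^-1) + (h 2^-1 - h s)); last by ring.
rewrite (_ : t - s = (t - 2^-1) + (2^-1 - s)); last by ring.
apply: (le_trans (ler_normD _ _)); rewrite mulrDr; apply: lerD; last by apply: h_lip_half.
rewrite -(h_sym t01) distrC (_ : t - 2^-1 = 2^-1 - (1 - t)); last by field.
by apply: h_lip_half; lra.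
Qed.

Let h_triple s : 0 < s < 1 -> 3 * h s = h (s / 3) - h ((s + 1) / 3) + h ((s + 2) / 3).
Proof.
move=> s01; have /andP[s0 s1] := s01; have p0 := @pi_gt0 R.
have := @csc_triple (pi * s / 3); have -> : 0 < pi * s / 3 < pi / 3.
  by rewrite divr_gt0 ?mulr_gt0//= ltr_pM2r ?invr_gt0// -[ltRHS]mulr1 ltr_pM2l.
move=> /(_ isT).
have -> : pi * s / 3 + 2 * (pi / 3) = pi * ((s + 2) / 3) by field.
have -> : pi * s / 3 + pi / 3 = pi * ((s + 1) / 3) by field.
have -> : 3 * (pi * s / 3) = pi * s by field.
have -> : pi * s / 3 = pi * (s / 3) by field.
move=> e1; have e2 := f_triple s01; rewrite /h.
have -> : 3 * (f s - pi / sin (pi * s)) = 3 * f s - pi * (3 / sin (pi * s)) by ring.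
have -> : 3 / sin (pi * s) = (sin (pi * (s / 3)))^-1 +
  (sin (pi * ((s + 2) / 3)))^-1 - (sin (pi * ((s + 1) / 3)))^-1 by rewrite e1; ring.
have -> : 3 * f s = f (s / 3) + f ((s + 2) / 3) - f ((s + 1) / 3) by rewrite e2; ring.
ring.
Qed.

(* By h_triple any Lipschitz constant of h can be divided by 3: h is constant, and
   h_triple then forces the constant to be 0. *)
Let h_lip_iter n s t : 0 < s < 1 -> 0 < t < 1 -> `|h t - h s| <= L / 3 ^+ n * `|t - s|.
Proof.
elim: n s t => [|n IH] s t s01 t01; first by rewrite expr0 divr1; exact: h_lip.
have /andP[s0 s1] := s01; have /andP[t0 t1] := t01.
have k3 k : 0 <= k <= 2 -> `|h ((t + k) / 3) - h ((s + k) / 3)| <= L / 3 ^+ n * (`|t - s| / 3).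
  move=> /andP[k0 k2]; apply: (le_trans (IH _ _ _ _)).
  - by apply/andP; split; lra.
  - by apply/andP; split; lra.
  have -> : (t + k) / 3 - (s + k) / 3 = (t - s) / 3 by field.
  by rewrite normrM (ger0_norm (_ : 0 <= 3^-1))// invr_ge0.
have h0 := k3 0; have h1 := k3 1; have h2 := k3 2.
rewrite !addr0 lexx ler0n in h0; rewrite ler01 ler1n in h1; rewrite lexx ler0n in h2.
move: (h0 isT) (h1 isT) (h2 isT) => {}h0 {}h1 {}h2.
have : 3 * `|h t - h s| <= 3 * (L / 3 ^+ n * (`|t - s| / 3)).
  rewrite -(ger0_norm (_ : 0 <= 3 :> R))// -normrM mulrBr !h_triple//.
  set x := h (t / 3); set y := h ((t + 1) / 3); set z := h ((t + 2) / 3).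
  set x' := h (s / 3); set y' := h ((s + 1) / 3); set z' := h ((s + 2) / 3).
  rewrite (_ : x - y + z - (x' - y' + z') = (x - x') - (y - y') + (z - z')); last by ring.
  apply: (le_trans (ler_normD _ _)).
  have := ler_normB (x - x') (y - y').
  rewrite (ger0_norm (_ : 0 <= 3 :> R))//.
  by move: h0 h1 h2; rewrite -/x -/x' -/y -/y' -/z -/z'; lra.
rewrite ler_pM2l// exprS invfM => /le_trans; apply.
lra.
Qed.

Let h_const s t : 0 < s < 1 -> 0 < t < 1 -> h s = h t.
Proof.
move=> s01 t01; apply/eqP; rewrite eq_sym -subr_eq0 -normr_le0 leNgt; apply/negP => d0.
(* For this n, [h_lip_iter] is contradicted because 3^n > n. *)
have [n] : exists n, L * `|t - s| / `|h t - h s| < n%:R :> R.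
  by exists (Num.truncn (L * `|t - s| / `|h t - h s|)).+1; exact: truncnS_gt.
rewrite ltr_pdivrMr// => Ln.
have := h_lip_iter n s01 t01; rewrite mulrAC ler_pdivlMr ?exprn_gt0// => /le_lt_trans.
move=> /(_ _ Ln); rewrite mulrC ltr_pM2r// ltNge => /negP; apply.
by rewrite -natrX ler_nat ltnW// ltn_expl.
Qed.

Lemma reflection s : 0 < s < 1 -> Beta s (1 - s) = pi / sin (pi * s).
Proof.
move=> s01; apply/eqP; rewrite -subr_eq0 -/(f s) -/(h s).
have /andP[s0 s1] := s01.
have := h_triple s01.
rewrite (@h_const (s / 3) s)// ?(@h_const ((s + 1) / 3) s)// ?(@h_const ((s + 2) / 3) s)//.
- by move=> e; apply/eqP; lra.
- by apply/andP; split; lra.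
- by apply/andP; split; lra.
- by apply/andP; split; lra.
Qed.

End Reflection.

(** * The critical exponent *)

Section CriticalExponent.
Context {R : realType}.
Implicit Types alpha nu : R.

Definition critical_fun alpha nu : R :=
  (1 - nu) / (alpha - 1) * Beta (2 - alpha) (alpha - nu).

Lemma critical_funE alpha nu : 1 < alpha -> alpha < 2 -> 0 < nu < alpha ->
  (nu - 1) * (Gamma (1 - alpha) * Gamma (alpha - nu) / Gamma (2 - nu)) =
  critical_fun alpha nu.
Proof.
move=> a1 a2 /andP[n0 na]; rewrite /critical_fun BetaE; [|lra|lra].
have -> : 2 - alpha + (alpha - nu) = 2 - nu by ring.
rewrite /Gamma ifF; last by apply/negbTE; rewrite -leNgt; lra.
rewrite !ifT; [|lra|lra].
(* Since 0 < alpha - 1 < 1, the extension of [Gamma] takes a single step and divides by the one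
   factor 1 - alpha. *)
rewrite (_ : Num.truncn (- (1 - alpha)) = 0%N); last first.
  by apply/truncn0Pn; rewrite -ltNge; lra.
rewrite big_ord1/= addr0 (_ : 1 - alpha + 1%:R = 2 - alpha); last by ring.
have n1 : 1 - alpha != 0 by rewrite lt_eqF//; lra.
have n2 : alpha - 1 != 0 by rewrite gt_eqF//; lra.
have : GammaI (2 - nu) != 0 by rewrite gt_eqF// GammaI_gt0//; lra.
move: (GammaI _) (GammaI _) (GammaI _) => G1 G2 G3 n3.
by field; rewrite n3 n2 n1.
Qed.

(** For nu < 1 the factor 1 - nu decreases while the Beta factor increases, so the product has no
    evident monotonicity; rewriting (1 - nu) Beta (2 - alpha) (alpha - nu) as a constant over Beta
    (alpha - 1) (1 - nu) settles it. For nu >= 1 the first factor is non-positive and both factors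
    work in the same direction. *)
Lemma critical_fun_decr alpha nu1 nu2 : 1 < alpha -> alpha < 2 ->
  0 < nu1 -> nu1 < nu2 -> nu2 < alpha ->
  critical_fun alpha nu2 < critical_fun alpha nu1.
Proof.
move=> a1 a2 n0 n12 na; rewrite /critical_fun.
have B1 : 0 < Beta (2 - alpha) (alpha - nu1) by apply: Beta_gt0; lra.
have B2 : 0 < Beta (2 - alpha) (alpha - nu2) by apply: Beta_gt0; lra.
have a10 : 0 < (alpha - 1)^-1 by rewrite invr_gt0; lra.
rewrite [ltLHS]mulrAC [ltRHS]mulrAC ltr_pM2r//.
have [n2|n2] := ltP nu2 1; last first.
  have [n1|n1] := ltP nu1 1.
    apply: (@le_lt_trans _ _ 0); last by rewrite mulr_gt0//; lra.
    by rewrite mulr_le0_ge0 ?(ltW B2)//; lra.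
  have : Beta (2 - alpha) (alpha - nu1) < Beta (2 - alpha) (alpha - nu2).
    by apply: Beta_decr; lra.
  move=> B12; rewrite -ltrN2 -!mulNr !opprB.
  apply: (@le_lt_trans _ _ ((nu1 - 1) * Beta (2 - alpha) (alpha - nu2))).
    by rewrite ler_wpM2l ?(ltW B12)//; lra.
  by rewrite ltr_pM2r//; lra.
pose K : R := GammaI (2 - alpha) * GammaI (alpha - 1).
have K0 : 0 < K by rewrite mulr_gt0// GammaI_gt0//; lra.
have E nu : nu < 1 -> 0 < nu ->
    (1 - nu) * Beta (2 - alpha) (alpha - nu) = K / Beta (alpha - 1) (1 - nu).
  move=> nul nug; rewrite (@BetaE _ (2 - alpha)); [|lra|lra].
  rewrite (@BetaE _ (alpha - 1)); [|lra|lra].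
  have -> : 2 - alpha + (alpha - nu) = (1 - nu) + 1 by ring.
  have -> : alpha - 1 + (1 - nu) = alpha - nu by ring.
  rewrite GammaIS; last lra.
  have n1 : 1 - nu != 0 by rewrite gt_eqF//; lra.
  have : GammaI (1 - nu) != 0 by rewrite gt_eqF// GammaI_gt0//; lra.
  have : GammaI (alpha - nu) != 0 by rewrite gt_eqF// GammaI_gt0//; lra.
  have : GammaI (alpha - 1) != 0 by rewrite gt_eqF// GammaI_gt0//; lra.
  rewrite /K; move: (GammaI _) (GammaI _) (GammaI _) (GammaI _) => G1 G2 G3 G4.
  by move=> h1 h2 h3; field; rewrite h1 h2 h3 n1.
rewrite !E//; [|lra|lra].
rewrite ltr_pM2l// ltf_pV2 ?posrE ?Beta_gt0//; [|lra|lra|lra|lra].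
by apply: Beta_decr; lra.
Qed.

(** Both sides equal [GammaI (2 - alpha) * GammaI (alpha - 1)], the right one by [reflection] at
    alpha - 1, which lies in the unit interval. *)
Lemma critical_fun0 alpha : 1 < alpha -> alpha < 2 ->
  critical_fun alpha 0 = pi / `|sin (pi * alpha)|.
Proof.
move=> a1 a2.
have a10 : 0 < alpha - 1 by lra.
have -> : `|sin (pi * alpha)| = sin (pi * (alpha - 1)).
  have -> : pi * alpha = pi * (alpha - 1) + pi by ring.
  rewrite sinDpi normrN ger0_norm//; apply: sin_ge0_pi.
  have p0 := @pi_gt0 R; rewrite mulr_ge0 ?(ltW p0) ?(ltW a10)//= -[leRHS]mulr1.
  by rewrite ler_pM2l//; lra.
rewrite -reflection; last by apply/andP; split; lra.
rewrite /critical_fun !subr0 (@BetaE _ (2 - alpha)); [|lra|lra].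
rewrite (@BetaE _ (alpha - 1)); [|lra|lra].
have -> : 2 - alpha + alpha = 1 + 1 by ring.
have -> : alpha - 1 + (1 - (alpha - 1)) = 1 by ring.
have -> : 1 - (alpha - 1) = 2 - alpha by ring.
have -> : GammaI alpha = (alpha - 1) * GammaI (alpha - 1).
  by rewrite -(GammaIS a10) subrK.
rewrite (GammaIS ltr01) GammaI1; move: (GammaI _) (GammaI _) => G1 G2.
by field; rewrite gt_eqF.
Qed.

Lemma continuous_Beta (p q : R) : 0 < p -> 0 < q -> {for q, continuous (Beta p)}.
Proof.
move=> p0 q0.
(* A Lipschitz constant near q: [Beta_lip] is used with e = q / 4, and for r within q / 4 of q the
   shifted argument stays above q / 2. *)
pose K : R := (q / 4)^-1 * Beta p (q / 2).
have K0 : 0 < K by rewrite mulr_gt0 ?invr_gt0 ?Beta_gt0 ?divr_gt0.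
have near_ r : `|q - r| < q / 4 -> `|Beta p q - Beta p r| <= `|q - r| * K.
  have mono u v : 0 < u -> u <= v -> Beta p v <= Beta p u.
    move=> u0; rewrite le_eqVlt => /predU1P[->//|uv].
    by rewrite ltW// Beta_decr.
  have q4 : 0 < q / 4 by rewrite divr_gt0.
  move=> qr; have [qr1|qr1] := leP q r.
    rewrite (distrC q r) (ger0_norm (_ : 0 <= r - q)); last lra.
    have := @Beta_lip _ p q r (q / 4) p0 q4.
    have -> : q / 4 < q by lra.
    move=> /(_ isT qr1) /le_trans; apply.
    rewrite ler_wpM2l; [by []|lra|].
    by rewrite ler_wpM2l ?invr_ge0 ?(ltW q4)//; apply: mono; lra.
  move: qr; rewrite (ger0_norm (_ : 0 <= q - r)); last lra.
  move=> qr; rewrite distrC.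
  have := @Beta_lip _ p r q (q / 4) p0 q4.
  have -> : q / 4 < r by lra.
  move=> /(_ isT (ltW qr1)) /le_trans; apply.
  rewrite ler_wpM2l; [by []|lra|].
  by rewrite ler_wpM2l ?invr_ge0 ?(ltW q4)//; apply: mono; lra.
apply/cvgrPdist_lt => e e0; near=> r.
have h1 : `|q - r| < q / 4 by near: r; apply: (@nbhsx_ballx _ _ q (q / 4)); rewrite divr_gt0.
have h2 : `|q - r| < e / K by near: r; apply: (@nbhsx_ballx _ _ q (e / K)); rewrite divr_gt0.
apply: (le_lt_trans (near_ _ h1)).
by rewrite -ltr_pdivlMr.
Unshelve. all: by end_near. Qed.

Lemma critical_exponent alpha (B : R) : 1 < alpha -> alpha < 2 ->
  B < pi / `|sin (pi * alpha)| ->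
  exists2 nu, 0 < nu < alpha & critical_fun alpha nu = B.
Proof.
move=> a1 a2; rewrite -critical_fun0// => B0.
(* At alpha - e the first bound makes the coefficient (1 - nu) / (alpha - 1) at most -1/2, and the
   second makes the Beta factor at least 2 (|B| + 1) by [Beta_ge]. So [critical_fun] is below B
   there and the intermediate value theorem applies. *)
pose e : R := Num.min ((alpha - 1) / 2) (2 * (`|B| + 1))^-1.
have e0 : 0 < e.
  rewrite lt_min; apply/andP; split; first by rewrite divr_gt0//; lra.
  by rewrite invr_gt0 mulr_gt0// ltr_wpDl.
have e1 : e <= (alpha - 1) / 2 by rewrite ge_min lexx.
have e2 : e <= (2 * (`|B| + 1))^-1 by rewrite ge_min lexx orbT.
have cf : {within `[0, alpha - e], continuous (critical_fun alpha)}.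
  apply: continuous_in_subspaceT => z; rewrite inE/= in_itv/= => /andP[z0 za].
  suff : {for z, continuous (fun nu => (1 - nu) / (alpha - 1) * Beta (2 - alpha) (alpha - nu))} by [].
  apply: continuousM.
    apply: continuousM; last exact: cvg_cst.
    by apply: continuousB; [exact: cvg_cst|exact: cvg_id].
  apply: (@continuous_comp _ _ _ (fun z : R => alpha - z) (Beta (2 - alpha))).
    by apply: continuousB; [exact: cvg_cst|exact: cvg_id].
  by apply: continuous_Beta; lra.
have hi : critical_fun alpha (alpha - e) <= B.
  rewrite /critical_fun (_ : alpha - (alpha - e) = e); last by ring.
  have h : e^-1 <= Beta (2 - alpha) e by apply: Beta_ge; lra.
  have h1 : 2 * (`|B| + 1) <= e^-1.
    by rewrite -[leLHS]invrK lef_pV2 ?posrE ?invr_gt0 ?mulr_gt0// ltr_wpDl.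
  have h2 : (1 - (alpha - e)) / (alpha - 1) <= - 2^-1.
    by rewrite ler_pdivrMr; lra.
  have h3 : - `|B| <= B by rewrite lerNl -normrN ler_norm.
  have h4 : 0 <= `|B| by [].
  rewrite -(opprK (_ / _)) mulNr; apply: le_trans h3; rewrite lerN2.
  apply: (@le_trans _ _ (2^-1 * Beta (2 - alpha) e)); first lra.
  by rewrite ler_wpM2r; lra.
have ae : 0 <= alpha - e by lra.
have [|nu] := IVT ae cf (v := B).
  by rewrite ge_min hi orbT/= le_max (ltW B0).
rewrite in_itv/= => /andP[n0 na] nB; exists nu => //.
rewrite (_ : nu < alpha) ?andbT; last lra.
move: n0; rewrite le_eqVlt => /predU1P[n0|//].
by move: B0; rewrite n0 nB ltxx.
Qed.

End CriticalExponent.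

(** * Drift criteria for survival probabilities *)

Section Survival.
Local Open Scope ereal_scope.
Context {R : realType} (K : R.-pker R ~> R) (X : set R).
Hypothesis mX : measurable X.
Hypothesis KX : forall x, X x -> K x X = 1.

(** The [n.+1] copies of [B] stand for the times 0 to n. For [B = outside a] this is the probability
    that tau_a > n ([prob_tau_gt]). *)
Definition surv (B : set R) (n : nat) (x : R) : \bar R := fdd K (nseq n.+1 B) x.

Lemma survS B n x : surv B n.+1 x = (\1_B x)%:E * \int[K x]_y surv B n y.
Proof. by []. Qed.

Lemma surv0 B x : surv B 0 x = (\1_B x)%:E.
Proof. by rewrite /surv/= integral_cst// mul1e prob_kernel mule1. Qed.

Lemma measurable_kernel_integral (f : R -> \bar R) :
  measurable_fun [set: R] f -> (forall x, 0 <= f x) ->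
  measurable_fun [set: R] (fun x => \int[K x]_y f y).
Proof.
move=> mf f0.
apply: (@measurable_fun_integral_sfinite_kernel _ _ _ _ _ (fun z => f z.2)) => //.
exact: measurableT_comp.
Qed.

Lemma surv_ge0 B n x : 0 <= surv B n x.
Proof.
elim: n x => [x|n IH x]; first by rewrite surv0 lee_fin.
by rewrite survS mule_ge0// ?lee_fin// integral_ge0.
Qed.

Variable B : set R.
Hypothesis mB : measurable B.

Let ind_le1 x : (\1_B x <= 1 :> R)%R.
Proof. by rewrite indicE; case: (_ \in _). Qed.

Lemma measurable_surv n : measurable_fun [set: R] (surv B n).
Proof.
elim: n => [|n IH].
  rewrite (_ : surv B 0 = EFin \o \1_B); last by apply/funext => x; rewrite surv0.
  by apply/measurable_EFinP.
rewrite (_ : surv B n.+1 = (fun x => (\1_B x)%:E * \int[K x]_y surv B n y)); last exact/funext.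
apply: emeasurable_funM; first exact/measurable_EFinP.
by apply: measurable_kernel_integral => // x; exact: surv_ge0.
Qed.

Lemma kernel_cst x (k : R) : \int[K x]_y k%:E = k%:E.
Proof. by rewrite integral_cst// prob_kernel mule1. Qed.

Lemma surv_le1 n x : surv B n x <= 1.
Proof.
elim: n x => [x|n IH x].
  by rewrite surv0 lee_fin ind_le1.
rewrite survS (@le_trans _ _ (1 * 1))//; last by rewrite mule1.
apply: lee_pmul; rewrite ?lee_fin ?ind_le1//.
- by apply: integral_ge0 => y _; exact: surv_ge0.
- rewrite -(kernel_cst x 1); apply: ge0_le_integral => //.
  + by move=> y _; exact: surv_ge0.
  + exact: measurable_surv.
Qed.

(** Drift conditions are known on [X] only, whereas [K x] lives on the whole line; it gives no mass
    to the complement of [X]. *)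
Lemma kernel_integral_restrict x (f : R -> \bar R) : X x ->
  measurable_fun [set: R] f -> (forall y, 0 <= f y) ->
  \int[K x]_y f y = \int[K x]_(y in X) f y.
Proof.
move=> Xx mf f0; rewrite (@ge0_negligible_integral _ _ _ _ _ (~` X))//.
- by rewrite setTD setCK.
- exact: measurableC.
- have : K x (X `|` ~` X) = K x X + K x (~` X).
    by rewrite measureU ?setICr//; exact: measurableC.
  rewrite (KX Xx) setUv (_ : K x setT = 1); last exact: prob_kernel.
  case: (K x (~` X)) => [r||]//.
  by rewrite -EFinD => -[/eqP]; rewrite addrC -subr_eq subrr => /eqP <-.
Qed.

Lemma kernel_le_integral x (f g : R -> \bar R) : X x ->
  measurable_fun [set: R] f -> measurable_fun [set: R] g ->
  (forall y, 0 <= f y) -> (forall y, 0 <= g y) ->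
  (forall y, X y -> f y <= g y) -> \int[K x]_y f y <= \int[K x]_y g y.
Proof.
move=> Xx mf mg f0 g0 fg; rewrite !(kernel_integral_restrict Xx)//.
by apply: ge0_le_integral => //; exact: measurable_funTS.
Qed.

Lemma survB n x : B x -> surv B n.+1 x = \int[K x]_y surv B n y.
Proof. by move=> Bx; rewrite survS indicE mem_set// mul1e. Qed.

Lemma survN n x : ~ B x -> surv B n x = 0.
Proof.
case: n => [|n] Bx; first by rewrite surv0 indicE memNset.
by rewrite survS indicE memNset// mul0e.
Qed.

Lemma surv_nincr n x : surv B n.+1 x <= surv B n x.
Proof.
elim: n x => [x|n IH x]; have [Bx|Bx] := pselect (B x); rewrite ?(survN _ Bx)//.
  by rewrite [leRHS]surv0 indicE mem_set// surv_le1.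
rewrite !survB//; apply: ge0_le_integral => //.
- by move=> y _; exact: surv_ge0.
- exact: measurable_surv.
- exact: measurable_surv.
Qed.

Lemma surv_mono n m x : (n <= m)%N -> surv B m x <= surv B n x.
Proof.
move=> /subnK <-; elim: (m - n)%N => [//|k IH].
by rewrite addSn; apply: le_trans IH; exact: surv_nincr.
Qed.

Lemma surv_sum_le (f h : R -> R) (n m : nat) :
  measurable_fun [set: R] f -> (forall x, 0 <= f x)%R ->
  (forall x, X x -> B x -> surv B m x <= (h x)%:E) ->
  (forall x, X x -> B x ->
     (h x)%:E + \int[K x]_y (f y)%:E <= (f x)%:E \/ (n%:R <= f x)%R) ->
  forall k x, (k <= n)%N -> X x -> \sum_(j < k) surv B (j + m) x <= (f x)%:E.
Proof.
move=> mf f0 hm hf; elim=> [x _ Xx|k IH x kn Xx].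
  by rewrite big_ord0 lee_fin.
have [Bx|Bx] := pselect (B x); last first.
  by rewrite big1 ?lee_fin// => i _; rewrite survN.
have [hfx|nf] := hf _ Xx Bx; last first.
  apply: (@le_trans _ _ (n%:R)%:E); last by rewrite lee_fin.
  apply: (@le_trans _ _ (\sum_(j < k.+1) 1)).
    by apply: lee_sum => i _; exact: surv_le1.
  by rewrite sumEFin lee_fin sumr_const card_ord ler_nat.
apply: le_trans hfx; rewrite big_ord_recl/= add0n.
apply: leeD; first exact: hm.
rewrite (eq_bigr (fun i : 'I_k => \int[K x]_y surv B (i + m) y)); last first.
  by move=> i _; rewrite /bump/= add1n addSn survB.
rewrite -ge0_integral_sum//; last 2 first.
- by move=> i; exact: measurable_surv.
- by move=> i y _; exact: surv_ge0.
apply: kernel_le_integral => //.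
- by apply: emeasurable_sum => i; exact: measurable_surv.
- exact/measurable_EFinP.
- by move=> y; apply: sume_ge0 => i _; exact: surv_ge0.
- by move=> y Xy; apply: IH => //; exact: ltnW.
Qed.

(* f bounds the sum of the n nonincreasing terms surv B m, ..., surv B (m + n - 1). *)
Lemma surv_upper (f h : R -> R) (n m : nat) :
  measurable_fun [set: R] f -> (forall x, 0 <= f x)%R ->
  (forall x, X x -> B x -> surv B m x <= (h x)%:E) ->
  (forall x, X x -> B x ->
     (h x)%:E + \int[K x]_y (f y)%:E <= (f x)%:E \/ (n%:R <= f x)%R) ->
  forall x, X x -> n%:R%:E * surv B (n + m) x <= (f x)%:E.
Proof.
move=> mf f0 hm hf x Xx.
apply: le_trans (surv_sum_le mf f0 hm hf (leqnn n) Xx).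
rewrite -[X in X%:R%:E](card_ord n) -sum1_card natr_sum -sumEFin.
rewrite ge0_sume_distrl; last by move=> i _; rewrite lee_fin.
apply: lee_sum => i _; rewrite mul1e; apply: surv_mono.
by rewrite leq_add2r ltnW.
Qed.

(** A maximal inequality: w is at least 1 once [B] has been left, and its mean grows by at most e
    per step, so the chain has left [B] by time n with probability at most w x + n e. *)
Lemma surv_lower_additive (w : R -> R) (e : R) :
  measurable_fun [set: R] w -> (forall x, 0 <= w x)%R -> (0 <= e)%R ->
  (forall x, X x -> ~ B x -> 1 <= w x)%R ->
  (forall x, X x -> B x -> \int[K x]_y (w y)%:E <= (w x + e)%:E) ->
  forall n x, X x -> 1 <= surv B n x + (w x + n%:R * e)%:E.
Proof.
move=> mw w0 e0 wN wB; elim=> [x Xx|n IH x Xx].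
  have [Bx|Bx] := pselect (B x).
    by rewrite surv0 indicE mem_set// leeDl// lee_fin addr_ge0// mulr_ge0.
  by rewrite survN// add0e lee_fin mul0r addr0 wN.
have [Bx|Bx] := pselect (B x); last first.
  by rewrite survN// add0e lee_fin (le_trans (wN _ Xx Bx))// lerDl mulr_ge0.
rewrite survB//.
apply: (@le_trans _ _ (\int[K x]_y (surv B n y + (w y + n%:R * e)%:E))).
  rewrite -[leLHS](kernel_cst x 1); apply: kernel_le_integral => //.
  - apply: emeasurable_funD; first exact: measurable_surv.
    by apply/measurable_EFinP; apply: measurable_funD.
  - by move=> y; rewrite adde_ge0 ?surv_ge0// lee_fin addr_ge0// mulr_ge0.
rewrite ge0_integralD//; last 4 first.
- by move=> y _; exact: surv_ge0.
- exact: measurable_surv.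
- by move=> y _; rewrite lee_fin addr_ge0// mulr_ge0.
- by apply/measurable_EFinP; apply: measurable_funD.
rewrite leeD2l//.
under eq_integral do rewrite EFinD.
rewrite ge0_integralD//; last 3 first.
- by move=> y _; rewrite lee_fin.
- exact/measurable_EFinP.
- by move=> y _; rewrite lee_fin mulr_ge0.
rewrite kernel_cst mulrS mulrDl mul1r addrA EFinD leeD2r//.
exact: wB.
Qed.

(** The difference A - D is at most C on [B], non-positive off [B], and does not decrease in mean
    while the chain is in [B]; hence A - D <= C surv. At points where this drift fails, the
    conclusion itself is supplied as the other alternative. The integral of D must be finite in
    order to be cancelled. *)
Lemma surv_lower_sub (A D : R -> R) (C : R) (n : nat) :
  measurable_fun [set: R] A -> measurable_fun [set: R] D ->
  (forall x, 0 <= A x)%R -> (forall x, 0 <= D x)%R -> (0 <= C)%R ->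
  (forall x, X x -> ~ B x -> A x <= D x)%R ->
  (forall x, X x -> B x -> A x <= C + D x)%R ->
  (forall x, X x -> B x ->
     (\int[K x]_y (D y)%:E < +oo /\
      (A x)%:E + \int[K x]_y (D y)%:E <= (D x)%:E + \int[K x]_y (A y)%:E) \/
     (forall m, (m <= n)%N -> (A x)%:E <= C%:E * surv B m x + (D x)%:E)) ->
  forall m x, (m <= n)%N -> X x -> (A x)%:E <= C%:E * surv B m x + (D x)%:E.
Proof.
move=> mA mD A0 D0 C0 AN AC AB; elim=> [x _ Xx|m IH x mn Xx].
  have [Bx|Bx] := pselect (B x); last by rewrite survN// mule0 add0e lee_fin AN.
  by rewrite surv0 indicE mem_set// mule1 -EFinD lee_fin AC.
have [Bx|Bx] := pselect (B x); last by rewrite survN// mule0 add0e lee_fin AN.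
have [[Dy ADx]|] := AB _ Xx Bx; last by apply.
have h : \int[K x]_y (A y)%:E <= C%:E * surv B m.+1 x + \int[K x]_y (D y)%:E.
  rewrite survB// -ge0_integralZl_EFin//; last 2 first.
  - by move=> y _; exact: surv_ge0.
  - exact: measurable_surv.
  rewrite -ge0_integralD//; last 4 first.
  - by move=> y _; rewrite mule_ge0 ?surv_ge0.
  - by apply: measurable_funeM; exact: measurable_surv.
  - by move=> y _; rewrite lee_fin.
  - exact/measurable_EFinP.
  apply: kernel_le_integral => //.
  - exact/measurable_EFinP.
  - apply: emeasurable_funD; last exact/measurable_EFinP.
    by apply: measurable_funeM; exact: measurable_surv.
  - by move=> y; rewrite adde_ge0 ?lee_fin// mule_ge0 ?surv_ge0.
  - by move=> y Xy; apply: IH => //; exact: ltnW.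
have Dfin : \int[K x]_y (D y)%:E \is a fin_num.
  by rewrite ge0_fin_numE// integral_ge0// => y _; rewrite lee_fin.
rewrite -(leeD2rE _ _ Dfin); apply: (le_trans ADx).
by rewrite addeAC [leRHS]addeC leeD2l.
Qed.

End Survival.

(** * Moments from tails *)

Section Moments.
Context {R : realType} {d : measure_display} {T : measurableType d}
  (P : probability T R) (Z : T -> \bar R).
Hypothesis mZ : measurable_fun [set: T] Z.
Hypothesis Z0 : forall w, (0 <= Z w)%E.

Let tail_set k : set T := [set w | ((2 ^+ k)%:E < Z w)%E].

Let m_tail k : measurable (tail_set k).
Proof.
have := @emeasurable_fun_o_infty _ _ _ _ _ measurableT mZ (2 ^+ k)%:E.
by rewrite setTI.
Qed.

Let mterm (q : R) k :
  measurable_fun [set: T] (fun w => ((2 ^+ k) `^ q * \1_(tail_set k) w)%:E).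
Proof.
apply/measurable_EFinP; apply: measurable_funM; first exact: measurable_cst.
exact: measurable_indic.
Qed.

Let int_term (q : R) k :
  (\int[P]_w ((2 ^+ k) `^ q * \1_(tail_set k) w)%:E =
   ((2 ^+ k) `^ q)%:E * P (tail_set k))%E.
Proof.
under eq_integral do rewrite EFinM.
rewrite ge0_integralZl_EFin ?powR_ge0//; first by rewrite integral_indic// setIT.
by apply/measurable_EFinP; exact: measurable_indic.
Qed.

Let pow2 (q : R) k : (2 ^+ k : R) `^ q = (2 `^ q) ^+ k.
Proof. by rewrite -powR_mulrn// -powRrM mulrC powRrM powR_mulrn// powR_ge0. Qed.

(** A geometric sum is controlled by its last term. If Z <= 2^L the top indicator vanishes;
    otherwise all indicators are bounded by 1 and Z^q is at least (2^L)^q. *)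
Lemma dyadic_sum_le (q : R) L w : 0 < q ->
  (((\sum_(k < L) (2 ^+ k) `^ q * \1_(tail_set k) w) * (1 - 2 `^ (- q)))%:E
    <= Z w `^ q)%E.
Proof.
move=> q0.
have x1 : 0 <= 1 - 2 `^ (- q) :> R.
  by rewrite subr_ge0 -[leRHS](powRr0 2) ler_powR ?ler1n// oppr_le0 ltW.
elim: L => [|L IH]; first by rewrite big_ord0 mul0r poweR_ge0.
have [ZL|ZL] := leP (Z w) (2 ^+ L)%:E.
  rewrite big_ord_recr/= indicE memNset ?mulr0 ?addr0//.
  by rewrite /tail_set/= ltNge ZL.
apply: (@le_trans _ _ ((2 ^+ L)%:E `^ q)%E); last first.
  apply: gt0_ler_poweR; [exact: ltW| |by rewrite in_itv/= leey Z0|exact: ltW].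
  by rewrite in_itv/= leey andbT lee_fin exprn_ge0.
rewrite poweR_EFin lee_fin.
apply: (@le_trans _ _ ((\sum_(k < L.+1) (2 ^+ k) `^ q) * (1 - 2 `^ (- q)))).
  rewrite ler_wpM2r//; apply: ler_sum => k _; rewrite ler_piMr ?powR_ge0//.
elim: L {IH ZL} => [|L IH].
  by rewrite big_ord1 expr0 powR1 mul1r gerBl powR_ge0.
rewrite big_ord_recr/= mulrDl; apply: (le_trans (lerD IH (lexx _))).
rewrite !pow2 exprS powRN.
have y0 : 0 < 2 `^ q :> R by rewrite powR_gt0.
set y := 2 `^ q in y0 *; set z := y ^+ L.
by rewrite (_ : z + y * z * (1 - y^-1) = y * z)//; field; rewrite gt_eqF.
Qed.

(** Every dyadic level 2^k with k >= N contributes at least c (1 - 2^(-q)), independently of k. The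
    moment thus diverges at the tail exponent itself, which is what the boundary case of (iii)
    requires. *)
Lemma moment_infty (q c : R) (N : nat) : 0 < q -> 0 < c ->
  (forall n, (N <= n)%N -> ((c * n%:R `^ (- q))%:E <= P [set w | (n%:R%:E < Z w)%E])%E) ->
  (\int[P]_w (Z w `^ q) = +oo)%E.
Proof.
move=> q0 c0 hP; apply/eqyP => A A0.
pose x : R := 1 - 2 `^ (- q).
have x0 : 0 < x.
  by rewrite subr_gt0 powRN invf_lt1 ?powR_gt0// -[ltLHS](powRr0 2) /powR gt_eqF// ltr_expR ltr_pM2r ?ln_gt0 ?ltr1n.
(* The first N levels are discarded, and M further levels already add up to more than A. *)
pose M := (Num.truncn (A / (x * c))).+1.
pose L := (N + M)%N.
apply: (@le_trans _ _ (\int[P]_w ((\sum_(k < L) (2 ^+ k) `^ q * \1_(tail_set k) w) * x)%:E)%E); last first.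
  apply: ge0_le_integral => //.
  - move=> w _; rewrite lee_fin; apply: mulr_ge0; last exact: ltW.
    by apply: sumr_ge0 => i _; apply: mulr_ge0; rewrite ?powR_ge0.
  - apply/measurable_EFinP; apply: measurable_funM => //.
    by apply: measurable_sum => k; apply/measurable_EFinP; exact: mterm.
  - exact: (measurableT_comp (measurable_poweR q) mZ).
  - by move=> w _; exact: dyadic_sum_le.
under eq_integral do rewrite mulr_suml -sumEFin.
rewrite ge0_integral_sum//; last 2 first.
- move=> i; apply/measurable_EFinP; apply: measurable_funM => //; apply/measurable_EFinP; exact: mterm.
- by move=> i w _; rewrite lee_fin !mulr_ge0 ?powR_ge0 ?(ltW x0).
apply: (@le_trans _ _ (\sum_(k < L) (if (N <= k)%N then (x * c)%:E else 0))%E); last first.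
  apply: lee_sum => k _; under eq_integral do rewrite mulrC EFinM.
  rewrite ge0_integralZl_EFin ?(ltW x0)//.
  rewrite int_term; case: ifPn => [Nk|_]; last first.
    by rewrite mule_ge0 ?lee_fin ?(ltW x0)// mule_ge0 ?lee_fin ?powR_ge0.
  rewrite EFinM lee_wpmul2l ?lee_fin ?(ltW x0)//.
  have Nk2 : (N <= 2 ^ k)%N by rewrite (leq_trans Nk)// ltnW// ltn_expl.
  apply: (@le_trans _ _ (((2 ^+ k) `^ q)%:E * (c * (2 ^ k)%:R `^ (- q))%:E)%E).
    rewrite -EFinM lee_fin natrX mulrCA powRN divff ?mulr1// gt_eqF// powR_gt0// exprn_gt0.
  by rewrite lee_wpmul2l ?lee_fin ?powR_ge0// /tail_set -natrX; exact: hP.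
rewrite /L big_split_ord/=; apply: (@le_trans _ _ (0 + \sum_(k < M) (x * c)%:E)%E).
  rewrite add0e sumEFin lee_fin sumr_const card_ord -[leRHS]mulr_natl.
  by rewrite -ler_pdivrMr ?mulr_gt0// ltW// truncnS_gt.
apply: leeD.
  by apply: sume_ge0 => k _; case: ifP => // _; rewrite lee_fin mulr_ge0// ltW.
by apply: lee_sum => k _; rewrite leq_addr.
Qed.

Let pow2_ex (r : R) : 1 < r -> exists k, 2 ^+ k < r <= 2 ^+ k.+1.
Proof.
move=> r1.
have ex : exists n, r <= 2 ^+ n.
  exists (Num.truncn r).+1; apply: (le_trans (ltW (truncnS_gt r))).
  by rewrite -natrX ler_nat ltnW// ltn_expl.
case: (ex_minnP ex) => -[|k] rk mink; first by move: rk; rewrite expr0 leNgt r1.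
exists k; rewrite rk andbT ltNge; apply/negP => /mink.
by rewrite ltnn.
Qed.

(** If 2^k < Z <= 2^(k + 1), then Z^q is at most 2^q (2^k)^q, and the resulting series is geometric
    with ratio 2^(q - p) < 1. The bound is explicit so that it can be uniform over a family of
    laws. *)
Lemma moment_tail (q p C : R) : 0 < q -> q < p -> 0 <= C ->
  (forall k, (P [set w | ((2 ^+ k)%:E < Z w)%E] <= (C * (2 ^+ k) `^ (- p))%:E)%E) ->
  (\int[P]_w (Z w `^ q) <= (1 + C * 2 `^ q / (1 - 2 `^ (q - p)))%:E)%E.
Proof.
move=> q0 qp C0 hP.
pose g k w : \bar R := (2 `^ q * ((2 ^+ k) `^ q * \1_(tail_set k) w))%:E.
have g0 k w : (0 <= g k w)%E by rewrite lee_fin !mulr_ge0 ?powR_ge0.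
have mg k : measurable_fun [set: T] (g k).
  apply/measurable_EFinP; apply: measurable_funM => //.
  by apply/measurable_EFinP; exact: mterm.
have pw w : (Z w `^ q <= 1 + \sum_(0 <= k <oo) g k w)%E.
  have [Z1|Z1] := leP (Z w) 1%E.
    apply: (@le_trans _ _ (1 + 0)%E); last first.
      by rewrite leeD2l// nneseries_ge0.
    rewrite adde0 -(poweR1r q).
    apply: gt0_ler_poweR; [exact: ltW|by rewrite in_itv/= leey Z0| |by []].
    by rewrite in_itv/= leey andbT lee_fin.
  case Zw : (Z w) Z1 => [r| |//].
    rewrite lte_fin => /pow2_ex[k /andP[kr rk]].
    apply: (@le_trans _ _ (g k w)).
      rewrite /g indicE mem_set; last by rewrite /tail_set/= Zw lte_fin.
      rewrite mulr1 -powRM ?exprn_ge0// -exprS poweR_EFin lee_fin.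
      have r0 : 0 <= r by rewrite (le_trans _ (ltW kr))// exprn_ge0.
      by apply: ge0_ler_powR; rewrite ?nnegrE ?exprn_ge0 ?(ltW q0).
    rewrite -[leLHS]add0e; apply: leeD => //.
    apply: le_trans (nneseries_lim_ge k.+1 _) => //.
    by rewrite big_nat_recr//= leeDr// sume_ge0.
  move=> _; suff -> : (\sum_(0 <= k <oo) g k w = +oo)%E by rewrite addey// leey.
  apply/eqyP => A A0.
  apply: le_trans (nneseries_lim_ge (Num.truncn A).+1 _) => //.
  apply: (@le_trans _ _ (\sum_(0 <= i < (Num.truncn A).+1) 1)%E).
    by rewrite sumEFin lee_fin big_const_nat subn0 iter_addr addr0 ltW// truncnS_gt.
  apply: lee_sum => k _; rewrite /g lee_fin indicE mem_set; last by rewrite /tail_set/= Zw ltry.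
  rewrite mulr1 pow2 -exprS exprn_ege1// -[leLHS](powRr0 2) ler_powR ?ler1n ?(ltW q0)//.
apply: (@le_trans _ _ (\int[P]_w (1 + \sum_(0 <= k <oo) g k w))%E).
  apply: ge0_le_integral => //.
  - by move=> w _; exact: poweR_ge0.
  - exact: (measurableT_comp (measurable_poweR q) mZ).
  - by apply: emeasurable_funD => //; apply: ge0_emeasurable_sum.
rewrite ge0_integralD//; last 2 first.
- by move=> w _; apply: nneseries_ge0.
- by apply: ge0_emeasurable_sum.
rewrite EFinD (_ : \int[P]__ 1 = 1)%E; last first.
  by rewrite integral_cst// mul1e; exact: probability_setT.
rewrite leeD2l//.
rewrite integral_nneseries//.
apply: lime_le.
  by apply: is_cvg_nneseries => k _ _; apply: integral_ge0.
apply: nearW => n.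
pose y : R := 2 `^ (q - p).
have y0 : 0 < y by rewrite powR_gt0.
have y1 : y < 1.
  by rewrite -[ltRHS](powRr0 2) /y /powR gt_eqF// ltr_expR ltr_pM2r ?ln_gt0 ?ltr1n// subr_lt0.
apply: (@le_trans _ _ (\sum_(0 <= k < n) (C * 2 `^ q * y ^+ k)%:E)%E).
  apply: lee_sum => k _; rewrite /g; under eq_integral do rewrite EFinM.
  rewrite ge0_integralZl_EFin ?powR_ge0//.
  rewrite int_term (_ : C * 2 `^ q * y ^+ k = 2 `^ q * ((2 ^+ k) `^ q * (C * (2 ^+ k) `^ (- p)))); last first.
    rewrite [X in _ = _ * X]mulrCA -powRDp ?exprn_gt0// pow2 -/y; ring.
  rewrite EFinM lee_wpmul2l ?lee_fin ?powR_ge0// EFinM lee_wpmul2l ?lee_fin ?powR_ge0//.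
  exact: hP.
rewrite sumEFin lee_fin -mulr_sumr ler_wpM2l ?mulr_ge0 ?powR_ge0//.
rewrite -[leRHS]mul1r ler_pdivlMr ?subr_gt0//.
have -> : (\sum_(0 <= k < n) y ^+ k) * (1 - y) = 1 - y ^+ n.
  elim: n => [|n IH]; first by rewrite big_geq// mul0r expr0 subrr.
  by rewrite big_nat_recr//= mulrDl IH exprS; ring.
by rewrite gerBl exprn_ge0// ltW.
Qed.

End Moments.

(** * Hitting times and the law of one step *)

Section Hitting.
Context {R : realType} {d : measure_display} {Omega : measurableType d}.
Variables (X : set R) (K : R.-pker R ~> R) (P : R -> probability Omega R)
  (xi : nat -> Omega -> R).
Hypothesis chain : is_markov_chain X K P xi.

Let mX : measurable X. Proof. by case: chain. Qed.
Let mxi n : measurable_fun [set: Omega] (xi n). Proof. by case: chain => _ []. Qed.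

Definition outside (a : R) : set R := [set y | a < `|y|].

Lemma measurable_outside a : measurable (outside a).
Proof.
have mn : measurable_fun [set: R] (fun y : R => `|y|) by exact: normr_measurable.
have := mn measurableT `]a, +oo[%classic (measurable_itv _).
rewrite setTI; congr measurable; apply/seteqP; split => y /=.
  by rewrite in_itv/= andbT.
by rewrite /outside/= in_itv/= andbT.
Qed.

Lemma tau_gtP a n w :
  (n%:R%:E < tau a xi w)%E <-> forall k, (k < n.+1)%N -> outside a (xi k w).
Proof.
rewrite /tau; case: pselect => [h|h]; last first.
  split=> _; last exact: ltry.
  by move=> k _; rewrite /outside/= ltNge; apply/negP => ka; apply: h; exists k.
case: ex_minnP => m ma mmin; rewrite lte_fin ltr_nat; split=> [nm k kn|h'].
  rewrite /outside/= ltNge; apply/negP => /mmin mk.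
  by move: (leq_trans nm mk); rewrite -ltnS => /(leq_trans kn); rewrite ltnn.
rewrite ltnNge; apply/negP => mn; have := h' m; rewrite ltnS => /(_ mn).
by rewrite /outside/= ltNge ma.
Qed.

Lemma tau_ge0 a w : (0 <= tau a xi w)%E.
Proof. by rewrite /tau; case: pselect => [h|h]; rewrite ?lee_fin ?leey. Qed.

Let measurable_tau_gt a n : measurable [set w | (n%:R%:E < tau a xi w)%E].
Proof.
rewrite (_ : [set w | _] = \bigcap_(k in [set k | (k < n.+1)%N]) (xi k @^-1` outside a)).
  apply: bigcap_measurable => [|k _]; first by exists 0%N.
  rewrite -[X in measurable X]setTI.
  by apply: mxi => //; exact: measurable_outside.
by apply/seteqP; split => w /=; [move/tau_gtP => h k|move=> h; apply/tau_gtP => k]; exact: h.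
Qed.

Lemma measurable_tau a : measurable_fun [set: Omega] (tau a xi).
Proof.
move=> mD; apply: (measurability _ (ErealGenOInfty.measurableE R)) => //.
move=> _ [_ [r ->] <-]; rewrite setTI.
have [r0|r0] := ltP r 0.
  rewrite (_ : _ @^-1` _ = setT) //; apply/seteqP; split => // w _ /=.
  by rewrite in_itv/= andbT (lt_le_trans _ (tau_ge0 a w)).
rewrite (_ : _ @^-1` _ = [set w | ((Num.truncn r)%:R%:E < tau a xi w)%E]).
  exact: measurable_tau_gt.
apply/seteqP; split => w /=; rewrite in_itv/= andbT.
  by move=> rt; apply: le_lt_trans rt; rewrite lee_fin truncn_le.
rewrite /tau; case: pselect => [h|h]; last by move=> _; exact: ltry.
rewrite !lte_fin ltr_nat => h'; apply: (lt_le_trans (truncnS_gt r)).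
by rewrite ler_nat.
Qed.

Lemma prob_tau_gt a n x : X x ->
  P x [set w | (n%:R%:E < tau a xi w)%E] = surv K (outside a) n x.
Proof.
move=> Xx; have [_ [_ [_ h]]] := chain.
have nthE k : (k < n.+1)%N -> nth setT (nseq n.+1 (outside a)) k = outside a.
  by move=> kn; rewrite nth_nseq kn.
rewrite /surv; have := h x Xx (nseq n.+1 (outside a)); rewrite size_nseq => <-; last first.
  by move=> k /nthE ->; exact: measurable_outside.
congr (P x _); apply/seteqP; split => w.
  by move/tau_gtP => h' k kn; rewrite nthE//; exact: h'.
by move=> h'; apply/tau_gtP => k kn; have := h' k kn; rewrite nthE.
Qed.

Lemma tau_moment_infty a q c N x : X x -> 0 < q -> 0 < c ->
  (forall n, (N <= n)%N -> ((c * n%:R `^ (- q))%:E <= surv K (outside a) n x)%E) ->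
  tau_moment P xi a q x = +oo%E.
Proof.
move=> Xx q0 c0 h; apply: (@moment_infty _ _ _ (P x) _ (measurable_tau a) (tau_ge0 a) q c N) => //.
by move=> n Nn; rewrite prob_tau_gt//; exact: h.
Qed.

Lemma tau_moment_lty a q p C x : X x -> 0 < q -> q < p -> 0 <= C ->
  (forall n, (0 < n)%N -> (surv K (outside a) n x <= (C * n%:R `^ (- p))%:E)%E) ->
  (tau_moment P xi a q x < +oo)%E.
Proof.
move=> Xx q0 qp C0 h; apply: le_lt_trans (ltry _).
apply: (@moment_tail _ _ _ (P x) _ (measurable_tau a) (tau_ge0 a) q p C) => // k.
by rewrite -natrX prob_tau_gt//; apply: h; rewrite expn_gt0.
Qed.

Let law A x : X x -> measurable A -> P x (xi 1 @^-1` A) = K x A.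
Proof.
move=> Xx mA; have [_ [_ [_ h]]] := chain.
have := h x Xx [:: setT; A]; rewrite /= indicT/= mul1e.
have -> : (fun z => (\1_A z)%:E * \int[K z]__ 1)%E = (fun z => (\1_A z)%:E).
  by apply/funext => z; rewrite kernel_cst mule1.
rewrite integral_indic// setIT => <-; last by move=> [_|[_|k]] /=.
congr (P x _); apply/seteqP; split => w /=; first by move=> Aw [|[|]].
by move/(_ 1%N isT).
Qed.

Let start x : X x -> P x [set w | xi 0%N w = x] = 1%E.
Proof.
move=> Xx; have [_ [_ [_ h]]] := chain.
have := h x Xx [:: [set x]] => /=.
rewrite kernel_cst mule1 indicE mem_set// => <-; last by move=> [_|k] /=.
congr (P x _); apply/seteqP; split => w /=; first by move=> Aw [|].
by move/(_ 0%N isT).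
Qed.

Lemma measurable_theta : measurable_fun [set: Omega] (theta xi).
Proof. by apply: measurable_funB; exact: mxi. Qed.

(** Links the hypotheses, which concern [theta] under [P x], with the kernel on which [surv] is
    built. The two integrands differ only on the null event that [xi 0] is not x. *)
Lemma kernel_law x (f : R -> \bar R) : X x ->
  measurable_fun [set: R] f -> (forall y, 0 <= f y)%E ->
  (\int[K x]_y f y = \int[P x]_w f (x + theta xi w)%R)%E.
Proof.
move=> Xx mf f0.
transitivity (\int[pushforward (P x) (xi 1%N)]_y f y)%E.
  by apply: eq_measure_integral => A mA _; rewrite /pushforward -law.
rewrite ge0_integral_pushforward// preimage_setT.
apply: ge0_ae_eq_integral => //.
- exact: measurableT_comp.
- by apply: measurableT_comp => //; apply: measurable_funD => //; exact: measurable_theta.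
- by move=> w _; exact: f0.
have mS : measurable [set w | xi 0%N w = x].
  have := @mxi 0%N measurableT [set x] (measurable_set1 x).
  by rewrite setTI.
exists (~` [set w | xi 0%N w = x]); split; first exact: measurableC.
  have := @probability_setC _ _ _ (P x) _ mS.
  by rewrite start// subee.
move=> w /=; apply: contra_not => w0 _.
by rewrite /theta w0 addrC subrK.
Qed.

End Hitting.

(** * Heavy-tailed jumps *)

Section PosNegParts.
Context {R : realType}.
Implicit Types y z : R.

Lemma pospE y : posp y = Num.max y 0.
Proof. by rewrite /posp maxEle; case: leP => y0; case: leP => // ?; lra. Qed.

Lemma negpE y : negp y = Num.max (- y) 0.
Proof. by rewrite /negp maxEle oppr_le0; case: ltP. Qed.

Lemma negpN y : negp (- y) = posp y.
Proof. by rewrite negpE opprK pospE. Qed.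

Lemma pospN y : posp (- y) = negp y.
Proof. by rewrite negpE pospE. Qed.

Lemma posp_ge0 y : 0 <= posp y. Proof. by rewrite pospE le_max lexx orbT. Qed.
Lemma negp_ge0 y : 0 <= negp y. Proof. by rewrite negpE le_max lexx orbT. Qed.

Lemma measurable_posp : measurable_fun [set: R] (@posp R).
Proof.
rewrite (_ : posp = (fun y => Num.max y 0)); last by apply/funext => y; rewrite pospE.
by apply: measurable_maxr.
Qed.

Lemma measurable_negp : measurable_fun [set: R] (@negp R).
Proof.
rewrite (_ : negp = (fun y => Num.max (- y) 0)); last by apply/funext => y; rewrite negpE.
by apply: measurable_maxr => //; exact: oppr_measurable.
Qed.

Lemma normp_powR z (s : R) : 0 < s -> `|z| `^ s = posp z `^ s + negp z `^ s.
Proof.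
move=> s0; rewrite /posp /negp; case: ltrgt0P => z0.
- by rewrite powR0 ?gt_eqF// addr0.
- by rewrite powR0 ?gt_eqF// add0r.
- by rewrite z0 powR0 ?gt_eqF// addr0.
Qed.

Lemma powR_le1D y (s t : R) : 0 <= y -> 0 < s -> s <= t -> y `^ s <= 1 + y `^ t.
Proof.
move=> y0 s0 st; have [y1|y1] := leP y 1.
  apply: (@le_trans _ _ 1); last by rewrite lerDl powR_ge0.
  have p1 : 1 `^ s = 1 :> R by rewrite powR1.
  by rewrite -[leRHS]p1; apply: ge0_ler_powR; rewrite ?nnegrE// ltW.
by rewrite (@le_trans _ _ (y `^ t))// ?lerDr// ler_powR// ltW.
Qed.

End PosNegParts.

Section HeavyTail.
Context {R : realType} {d : measure_display} {T : measurableType d}.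
(** Working with a family of pairs of a law and a jump makes all constants uniform. It is later
    applied to the laws [P x] with the jump from x oriented away from the origin, for |x| >= x0. *)
Variables (J : probability T R -> (T -> R) -> Prop) (alpha beta c : R).
Hypothesis alpha1 : 1 < alpha.
Hypothesis alpha2 : alpha < 2.
Hypothesis alpha_beta : alpha < beta.
Hypothesis c0 : 0 < c.
Hypothesis mJ : forall P Z, J P Z -> measurable_fun [set: T] Z.
Hypothesis tailJ : forall eps : R, 0 < eps -> exists Y, forall y, Y <= y ->
  forall P Z, J P Z -> `|y `^ alpha * fine (P [set w | y < posp (Z w)]) - c| <= eps.
Hypothesis negJ : exists M : R, forall P Z, J P Z ->
  (\int[P]_w (negp (Z w) `^ beta)%:E <= M%:E)%E.

Lemma measurable_gt_posp P Z y : J P Z -> d.-measurable [set w | y < posp (Z w)].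
Proof.
move=> /mJ mZ; have := measurableT_comp measurable_posp mZ => /(_ measurableT).
move=> /(_ `]y, +oo[%classic (measurable_itv _)); rewrite setTI; congr measurable.
by apply/seteqP; split => w /=; rewrite in_itv/= andbT.
Qed.

Lemma prob_gt_fin P Z y : J P Z ->
  P [set w | y < posp (Z w)] = (fine (P [set w | y < posp (Z w)]))%:E.
Proof.
by move=> JPZ; rewrite fineK//; apply: fin_num_measure; exact: (measurable_gt_posp _ JPZ).
Qed.

Lemma tail_bounds (eps : R) : 0 < eps -> exists2 Y : R, 0 < Y & forall y : R, Y <= y ->
  forall P Z, J P Z -> (c - eps) * y `^ (- alpha) <= fine (P [set w | y < posp (Z w)])
     <= (c + eps) * y `^ (- alpha).
Proof.
move=> /tailJ[Y hY]; exists (Num.max Y 1); first by rewrite lt_max ltr01 orbT.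
move=> y; rewrite ge_max => /andP[Yy y1] P Z JPZ.
have y0 : 0 < y by exact: lt_le_trans y1.
have := hY _ Yy _ _ JPZ; rewrite ler_norml powRN => /andP[h1 h2].
have ya : 0 < y `^ alpha by rewrite powR_gt0.
rewrite ler_pdivrMr// ler_pdivlMr// [_ * y `^ alpha]mulrC; apply/andP; split; lra.
Qed.

Lemma tail_upper : exists2 C : R, 0 < C & forall y : R, 0 < y -> forall P Z, J P Z ->
  (P [set w | (y < posp (Z w))%R] <= (C * y `^ (- alpha))%:E)%E.
Proof.
have [Y Y0 hY] := tail_bounds ltr01.
(* For y < Y the trivial bound 1 <= Y^alpha y^(- alpha) is used. *)
exists (c + 1 + Y `^ alpha); first by rewrite ltr_wpDr ?powR_ge0// addr_gt0.
move=> y y0 P Z JPZ; have [yY|Yy] := leP Y y.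
  rewrite prob_gt_fin// lee_fin; have /andP[_ h] := hY _ yY _ _ JPZ.
  by rewrite (le_trans h)// ler_wpM2r ?powR_ge0// lerDl powR_ge0.
apply: (@le_trans _ _ 1%E); first by apply: probability_le1; exact: (measurable_gt_posp _ JPZ).
rewrite lee_fin powRN ler_pdivlMr ?powR_gt0// mul1r.
apply: (@le_trans _ _ (Y `^ alpha)); last by rewrite lerDr addr_ge0// ltW.
have a1 := alpha1; apply: ge0_ler_powR; rewrite ?nnegrE ?(ltW y0) ?(ltW Y0) ?(ltW Yy)//; lra.
Qed.

Lemma moment_posp s : 0 < s -> s < alpha -> exists2 C : R, 0 <= C & forall P Z, J P Z ->
  (\int[P]_w (posp (Z w) `^ s)%:E <= C%:E)%E.
Proof.
move=> s0 sa; have [C C0 hC] := tail_upper.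
have y1 : 2 `^ (s - alpha) < 1 :> R.
  by rewrite -[ltRHS](powRr0 2) /powR gt_eqF// ltr_expR ltr_pM2r ?ln_gt0 ?ltr1n// subr_lt0.
exists (1 + C * 2 `^ s / (1 - 2 `^ (s - alpha))).
  by rewrite addr_ge0// !mulr_ge0 ?(ltW C0) ?powR_ge0 ?invr_ge0// subr_ge0 ltW.
move=> P Z JPZ.
have mp : measurable_fun [set: T] (fun w => (posp (Z w))%:E).
  by apply/measurable_EFinP; exact: (measurableT_comp measurable_posp (mJ JPZ)).
have p0 w : (0 <= (posp (Z w))%:E)%E by rewrite lee_fin posp_ge0.
have := @moment_tail _ _ _ P _ mp p0 s alpha C s0 sa (ltW C0).
by apply => k; apply: hC => //; exact: exprn_gt0.
Qed.

Lemma moment_negp s : 0 < s -> s <= beta -> exists2 C : R, 0 <= C & forall P Z, J P Z ->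
  (\int[P]_w (negp (Z w) `^ s)%:E <= C%:E)%E.
Proof.
move=> s0 sb; have [M hM] := negJ.
exists (1 + `|M|); first by rewrite addr_ge0.
move=> P Z JPZ; have mn := measurableT_comp measurable_negp (mJ JPZ).
have mns t : measurable_fun [set: T] (fun w => (negp (Z w) `^ t)%:E).
  by apply/measurable_EFinP; exact: (measurableT_comp (measurable_powR t) mn).
apply: (@le_trans _ _ (\int[P]_w (1 + (negp (Z w) `^ beta)%:E))%E).
  apply: ge0_le_integral => //.
  - by move=> w _; rewrite lee_fin powR_ge0.
  - by apply: emeasurable_funD.
  - by move=> w _; rewrite -EFinD lee_fin powR_le1D// negp_ge0.
rewrite ge0_integralD//; last by move=> w _; rewrite lee_fin powR_ge0.
rewrite (_ : \int[P]__ 1 = 1)%E; last first.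
  by rewrite integral_cst// mul1e; exact: probability_setT.
rewrite EFinD leeD2l//; apply: (le_trans (hM _ _ JPZ)).
by rewrite lee_fin ler_norm.
Qed.

Lemma moment_norm s : 0 < s -> s < alpha -> exists2 C : R, 0 <= C & forall P Z, J P Z ->
  (\int[P]_w (`|Z w| `^ s)%:E <= C%:E)%E.
Proof.
move=> s0 sa; have [C1 C10 h1] := moment_posp s0 sa.
have [|C2 C20 h2] := @moment_negp s s0.
  by apply: ltW; exact: lt_trans alpha_beta.
exists (C1 + C2); first by rewrite addr_ge0.
move=> P Z JPZ.
under eq_integral do rewrite normp_powR// EFinD.
rewrite ge0_integralD//.
- by rewrite EFinD leeD ?h1 ?h2.
- by move=> w _; rewrite lee_fin powR_ge0.
- apply/measurable_EFinP; apply: (measurableT_comp (measurable_powR s)).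
  exact: (measurableT_comp measurable_posp (mJ JPZ)).
- by move=> w _; rewrite lee_fin powR_ge0.
- apply/measurable_EFinP; apply: (measurableT_comp (measurable_powR s)).
  exact: (measurableT_comp measurable_negp (mJ JPZ)).
Qed.

Lemma integrable_bound (P : probability T R) (f g : T -> R) (C : R) :
  measurable_fun [set: T] f -> measurable_fun [set: T] g ->
  (forall w, `|f w| <= g w) -> (\int[P]_w (g w)%:E <= C%:E)%E ->
  P.-integrable [set: T] (EFin \o f).
Proof.
move=> mf mg fg gC; apply/integrableP; split; first exact/measurable_EFinP.
apply: le_lt_trans (ltry C); apply: le_trans gC.
apply: ge0_le_integral => //.
- by do 2 apply: measurableT_comp => //.
- exact/measurable_EFinP.
- by move=> w _ /=; rewrite lee_fin.
Qed.

Lemma integrable_norm_powR P Z s : 0 < s -> s < alpha -> J P Z ->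
  P.-integrable [set: T] (EFin \o (fun w => `|Z w| `^ s)).
Proof.
move=> s0 sa JPZ; have [C _ hC] := moment_norm s0 sa.
have m1 : measurable_fun [set: T] (fun w => `|Z w| `^ s).
  apply: (measurableT_comp (measurable_powR s)).
  exact: (measurableT_comp (@normr_measurable R setT) (mJ JPZ)).
apply: (integrable_bound m1 m1 _ (hC _ _ JPZ)).
by move=> w; rewrite ger0_norm ?powR_ge0.
Qed.

Lemma integrable_jump P Z : J P Z -> P.-integrable [set: T] (EFin \o Z).
Proof.
move=> JPZ; have [C _ hC] := moment_norm ltr01 alpha1.
apply: (integrable_bound (mJ JPZ) _ _ (hC _ _ JPZ)).
  apply: (measurableT_comp (measurable_powR 1)).
  exact: (measurableT_comp (@normr_measurable R setT) (mJ JPZ)).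
by move=> w; rewrite powRr1.
Qed.

End HeavyTail.

(** * Taylor remainders of powers *)

Section PowerTaylor.
Context {R : realType}.
Implicit Types t u x z p b nu : R.

(** Young's inequality for the product t * 1 with the conjugate exponents p and p / (p - 1),
    multiplied by p. *)
Lemma bernoulli_ge1 t p : 0 <= t -> 1 <= p -> 1 + p * (t - 1) <= t `^ p.
Proof.
move=> t0; rewrite le_eqVlt => /predU1P[<-|p1].
  by rewrite powRr1//; lra.
have p0 : 0 < p by lra.
have := @conjugate_powR _ t 1 p (p / (p - 1)) t0 ler01 p0.
rewrite powR1 mulr1 => /(_ _ _) h.
have q0 : 0 < p / (p - 1) by rewrite divr_gt0//; lra.
have p10 : p - 1 != 0 by rewrite gt_eqF//; lra.
have pn0 : p != 0 by rewrite gt_eqF.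
have pq : p^-1 + (p / (p - 1))^-1 = 1 by field; rewrite p10 pn0.
have := h q0 pq.
have -> : 1 / (p / (p - 1)) = 1 - p^-1 by field; rewrite p10 pn0.
rewrite -(ler_pM2l p0).
have -> : p * (t `^ p / p + (1 - p^-1)) = t `^ p + p - 1 by field.
lra.
Qed.

Lemma bernoulli_le1 t p : 0 <= t -> 0 <= p -> p <= 1 -> t `^ p <= 1 + p * (t - 1).
Proof.
move=> t0; rewrite le_eqVlt => /predU1P[<- _|p0 p1]; first by rewrite powRr0; lra.
have := @bernoulli_ge1 (t `^ p) p^-1 (powR_ge0 _ _).
rewrite invf_ge1// => /(_ p1); rewrite -powRrM mulfV ?gt_eqF// powRr1//.
rewrite -(ler_pM2l p0) mulrDr mulrA mulfV ?gt_eqF// mul1r; lra.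
Qed.

(* For nu in [1, 2] write t^nu = t * t^(nu - 1), and for nu <= 1 write t^nu = t^(nu + 1) / t; Bernoulli applies to the other factor. *)
Lemma powR_quadratic t nu : 2^-1 <= t -> 0 <= nu -> nu <= 2 ->
  `|t `^ nu - 1 - nu * (t - 1)| <= 2 * (t - 1) ^+ 2.
Proof.
move=> t2 n0 n2; have t0 : 0 < t by lra.
have [n1|n1] := leP nu 1.
  have h1 := bernoulli_le1 (ltW t0) n0 n1.
  have := @bernoulli_ge1 t (nu + 1) (ltW t0).
  have -> : 1 <= nu + 1 by lra.
  move=> /(_ isT); rewrite powRDp// powRr1 ?(ltW t0)// => h2.
  rewrite ler_norml; apply/andP; split; last first.
    by have := sqr_ge0 (t - 1); lra.
  have : - (2 * (t - 1) ^+ 2) * t <= (t `^ nu - 1 - nu * (t - 1)) * t.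
    have -> : (t `^ nu - 1 - nu * (t - 1)) * t =
      (t `^ nu * t - (1 + (nu + 1) * (t - 1))) - nu * (t - 1) ^+ 2 by ring.
    have h3 := sqr_ge0 (t - 1).
    have : nu * (t - 1) ^+ 2 <= 2 * t * (t - 1) ^+ 2.
      by rewrite ler_wpM2r//; lra.
    lra.
  by rewrite ler_pM2r.
have h1 := bernoulli_ge1 (ltW t0) (ltW n1).
have := @bernoulli_le1 t (nu - 1) (ltW t0).
have -> : 0 <= nu - 1 by lra.
have -> : nu - 1 <= 1 by lra.
move=> /(_ isT isT); rewrite -(ler_pM2l t0) -{1}[t](powRr1 (ltW t0)) -powRDp//.
rewrite (addrC 1) subrK => h2.
have h3 := sqr_ge0 (t - 1).
have h4 : (nu - 1) * (t - 1) ^+ 2 <= 2 * (t - 1) ^+ 2 by rewrite ler_wpM2r//; lra.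
have h5 : t * (1 + (nu - 1) * (t - 1)) = 1 + nu * (t - 1) + (nu - 1) * (t - 1) ^+ 2 by ring.
by rewrite ler_norml; apply/andP; split; lra.
Qed.

(** For |u| <= 1/2 the remainder is quadratic and u^2 <= |u|^b. Otherwise 2 |u| >= 1, and each of
    the three terms is at most (2 |u|)^b <= 4 |u|^b; this range includes the jumps across the
    origin. *)
Lemma powR_remainder1 u nu b : u < 0 -> 0 < nu -> nu <= b -> 1 <= b -> b <= 2 ->
  `| `|1 + u| `^ nu - 1 - nu * u| <= 16 * `|u| `^ b.
Proof.
move=> u0 n0 nb b1 b2.
have b0 : 0 < b by lra.
have v0 : 0 < `|u| by rewrite normr_gt0 lt_eqF.
have uE : u = - `|u| by rewrite ltr0_norm// opprK.
have [u2|u2] := leP `|u| 2^-1.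
  have h : 2^-1 <= 1 + u by lra.
  rewrite (ger0_norm (_ : 0 <= 1 + u)); last lra.
  have := @powR_quadratic (1 + u) nu h (ltW n0).
  have -> : nu <= 2 by lra.
  move=> /(_ isT); rewrite (_ : 1 + u - 1 = u); last by ring.
  move/le_trans; apply.
  rewrite -real_normK ?num_real// -(powR_mulrn 2 (ltW v0)).
  have : `|u| `^ 2 <= `|u| `^ b by rewrite ger_powR// v0/=; lra.
  have := powR_ge0 `|u| b; lra.
have v1 : 1 <= 2 * `|u| by lra.
have v20 : 0 <= 2 * `|u| by lra.
have p4 : 2 `^ b <= 4 :> R.
  apply: (@le_trans _ _ (2 `^ 2)); first by rewrite ler_powR// ler1n.
  by rewrite powR_mulrn// expr2; lra.
have vb : (2 * `|u|) `^ b <= 4 * `|u| `^ b.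
  by rewrite powRM ?(ltW v0)// ler_wpM2r ?powR_ge0.
have h1 : `|1 + u| `^ nu <= (2 * `|u|) `^ b.
  apply: (@le_trans _ _ ((2 * `|u|) `^ nu)); last by rewrite ler_powR.
  apply: ge0_ler_powR; rewrite ?nnegrE ?(ltW n0)//.
  by rewrite ler_norml; apply/andP; split; lra.
have h2 : 2 * `|u| <= (2 * `|u|) `^ b.
  by rewrite -[leLHS](powRr1 v20) ler_powR.
have h3 : nu * `|u| <= 2 * `|u| by rewrite ler_wpM2r//; lra.
have h0 := powR_ge0 `|1 + u| nu.
have h6 : nu * u = - (nu * `|u|) by rewrite {1}uE mulrN.
have h7 : 0 <= nu * `|u| by rewrite mulr_ge0 ?(ltW n0) ?(ltW v0).
by rewrite ler_norml; apply/andP; split; lra.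
Qed.

Lemma powR_remainder x z nu b : 0 < x -> z < 0 -> 0 < nu -> nu <= b -> 1 <= b -> b <= 2 ->
  `| `|x + z| `^ nu - x `^ nu - nu * x `^ (nu - 1) * z| <= 16 * x `^ (nu - b) * `|z| `^ b.
Proof.
move=> x0 z0 n0 nb b1 b2.
have u0 : z / x < 0 by rewrite pmulr_llt0// invr_gt0.
have := @powR_remainder1 _ nu b u0 n0 nb b1 b2.
have xn : 0 < x `^ nu by rewrite powR_gt0.
rewrite -(ler_pM2l xn) -[X in X * `|_|](gtr0_norm xn) -normrM.
have -> : x `^ nu * (`|1 + z / x| `^ nu - 1 - nu * (z / x)) =
   `|x + z| `^ nu - x `^ nu - nu * x `^ (nu - 1) * z.
  have -> : `|x + z| = x * `|1 + z / x|.
    rewrite -{2}(gtr0_norm x0) -normrM; congr (`|_|).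
    by field; rewrite gt_eqF.
  rewrite powRM ?(ltW x0)//.
  have -> : x `^ nu = x `^ (nu - 1) * x.
    by rewrite -{3}(powRr1 (ltW x0)) -powRDp// subrK.
  by field; rewrite gt_eqF.
have -> // : x `^ nu * (16 * `|z / x| `^ b) = 16 * x `^ (nu - b) * `|z| `^ b.
rewrite normrM (gtr0_norm (_ : 0 < x^-1)) ?invr_gt0// powRM ?invr_ge0 ?(ltW x0)//.
rewrite powRDp// powRN -(powR_inv1 (ltW x0)) -powRrM mulN1r powRN; ring.
Qed.

Notation mu := (@lebesgue_measure R).

Let xplus_derive x v p : 0 < x + v ->
  is_derive v 1 (fun v : R => (x + v) `^ p) (p * (x + v) `^ (p - 1)).
Proof.
move=> xv; have dx : is_derive v 1 (fun v : R => x + v) 1.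
  by rewrite -[X in is_derive _ _ _ X]add0r; apply: is_deriveD.
have := @is_derive1_comp _ (fun y : R => y `^ p) (fun y : R => x + y) v _ _ (is_derive1_powR p xv) dx.
by rewrite mulr1.
Qed.

(** The outcome of one integration by parts of (x + v)^(nu - 2) (z - v); it requires nu different
    from 0 and 1. *)
Let primitive x z nu v : R :=
  (nu - 1)^-1 * ((x + v) `^ (nu - 1) * (z - v)) + (nu * (nu - 1))^-1 * (x + v) `^ nu.

Let taylor_primitive x z nu (v : R) : 0 < x -> 0 <= v -> nu - 1 != 0 -> nu != 0 ->
  is_derive v 1 (primitive x z nu) ((x + v) `^ (nu - 2) * (z - v)).
Proof.
move=> x0 v0 n1 n0.
have xv : 0 < x + v by rewrite ltr_wpDr.
have dz : is_derive v 1 (fun v : R => z - v) (0 - 1).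
  by apply: is_deriveB.
have dp p := @xplus_derive x v p xv.
have d1 := @is_deriveM _ _ _ _ v 1 _ _ (dp (nu - 1)) dz.
have d2 := @is_deriveZ _ _ _ _ (nu - 1)^-1 v 1 _ d1.
have d3 := @is_deriveZ _ _ _ _ (nu * (nu - 1))^-1 v 1 _ (dp nu).
have d4 := @is_deriveD _ _ _ _ _ v 1 _ _ d2 d3.
apply: (is_derive_eq d4); rewrite /GRing.scale/=.
have -> : nu - 1 - 1 = nu - 2 by ring.
by field; rewrite n1 n0.
Qed.

(** Integral form of the second-order remainder. With [posp (z - v)] the domain of integration does
    not depend on z, so a random z can be averaged inside by Tonelli. *)
Lemma ipos_taylor x z nu : 0 < x -> 0 <= z -> nu - 1 != 0 -> nu != 0 ->
  ipos (fun v => (x + v) `^ (nu - 2) * posp (z - v)) =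
  (((x + z) `^ nu - x `^ nu - nu * x `^ (nu - 1) * z) / (nu * (nu - 1)))%:E.
Proof.
move=> x0; rewrite le_eqVlt => /predU1P[<- n1 n0|z0 n1 n0].
  rewrite addr0 subrr mulr0 subrr mul0r; apply: integral0_eq => v /=.
  rewrite in_itv/= andbT => v0.
  by rewrite /posp leNgt sub0r oppr_lt0 v0/= mulr0.
have mf : measurable_fun [set: R] (fun v : R => (x + v) `^ (nu - 2) * posp (z - v)).
  apply: measurable_funM; first by mfun.
  by apply: (measurableT_comp (@measurable_posp R)); mfun.
transitivity (\int[mu]_(v in `]0%R, z]) ((x + v) `^ (nu - 2) * posp (z - v))%:E)%E.
  rewrite (_ : positives = `]0%R, z] `|` `]z, +oo[); last first.
    apply/seteqP; split => v /=; rewrite !in_itv/= !andbT.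
      by move=> v0; have [|] := leP v z; [left|right]; rewrite ?v0.
    by move=> [/andP[]//|]; exact: lt_trans.
  rewrite ge0_integral_setU//=.
  - rewrite [X in (_ + X)%E]integral0_eq ?adde0// => v /=.
    rewrite in_itv/= andbT => zv; rewrite /posp leNgt subr_lt0 zv/= mulr0//.
  - by apply/measurable_EFinP; exact: measurable_funTS.
  - by move=> v _; rewrite lee_fin mulr_ge0 ?powR_ge0 ?posp_ge0.
  - rewrite disj_set2E; apply/eqP/seteqP; split => v //= [].
    by rewrite !in_itv/= andbT => /andP[_ x1]; rewrite ltNge x1.
rewrite integral_itv_obnd_cbnd; last first.
  by apply/measurable_EFinP; exact: measurable_funTS.
transitivity (\int[mu]_(v in `[0%R, z]) ((x + v) `^ (nu - 2) * (z - v))%:E)%E.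
  apply: eq_integral => v; rewrite inE/= in_itv/= => /andP[v0 vz].
  by rewrite /posp subr_ge0 vz.
have dF (v : R) : 0 <= v -> is_derive v 1 (primitive x z nu) ((x + v) `^ (nu - 2) * (z - v)).
  by move=> v0; exact: taylor_primitive.
have cF (v : R) : 0 <= v -> {for v, continuous (primitive x z nu)}.
  move=> v0; apply: differentiable_continuous; apply/derivable1_diffP.
  exact: (@ex_derive _ _ _ _ _ _ _ (dF _ v0)).
rewrite (@continuous_FTC2 _ _ (primitive x z nu))//.
- rewrite -EFinB; congr EFin; rewrite /primitive subrr mulr0 mulr0 add0r addr0 subr0.
  by field; rewrite n1 n0.
- apply: continuous_in_subspaceT => v; rewrite inE/= in_itv/= => /andP[v0 _].
  suff : {for v, continuous (fun v => (x + v) `^ (nu - 2) * (z - v))} by [].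
  apply: continuousM.
    apply: differentiable_continuous; apply/derivable1_diffP.
    have xv : 0 < x + v by rewrite ltr_wpDr.
    exact: (@ex_derive _ _ _ _ _ _ _ (@xplus_derive x v (nu - 2) xv)).
  by apply: continuousB; [exact: cvg_cst|exact: cvg_id].
- split.
  + move=> v; rewrite in_itv/= => /andP[v0 _].
    exact: (@ex_derive _ _ _ _ _ _ _ (dF _ (ltW v0))).
  + by apply: cvg_at_right_filter; exact: cF.
  + by apply: cvg_at_left_filter; apply: cF; exact: ltW.
- move=> v; rewrite in_itv/= => /andP[v0 _].
  by rewrite derive1E (@derive_val _ _ _ _ _ _ _ (dF _ (ltW v0))).
Qed.

Lemma ipos_taylorN x z nu : z < 0 ->
  ipos (fun v => (x + v) `^ (nu - 2) * posp (z - v)) = 0%E.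
Proof.
move=> z0; apply: integral0_eq => v /=; rewrite in_itv/= andbT => v0.
rewrite /posp leNgt (_ : z - v < 0)/= ?mulr0//; lra.
Qed.

(** Substituting v = x u. This is the origin of the Beta value in [critical_fun]: v^(1 - alpha) is
    the order of the mean excess of a jump over v. *)
Lemma ipos_scaled_bet x nu (alpha : R) : 0 < x -> alpha < 2 -> nu < alpha ->
  ipos (fun v => (x + v) `^ (nu - 2) * v `^ (1 - alpha)) =
  (x `^ (nu - alpha) * Beta (2 - alpha) (alpha - nu))%:E.
Proof.
move=> x0 a2 na; rewrite (@ipos_scale _ x)//; last 2 first.
- by mfun.
- by move=> v v0; rewrite mulr_ge0 ?powR_ge0.
rewrite EFinM -betE; [|lra|lra].
rewrite (_ : x `^ (nu - alpha) = x * x `^ (nu - alpha - 1)); last first.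
  by rewrite -{2}(powRr1 (ltW x0)) -powRDp//; congr powR; ring.
rewrite EFinM -muleA /bet; congr (_ * _)%E; rewrite -iposZl ?powR_ge0//; last 2 first.
- by mfun.
- by move=> v v0; rewrite mulr_ge0 ?powR_ge0.
apply: eq_ipos => v v0.
have -> : x + x * v = x * (1 + v) by ring.
have v1 : 0 <= 1 + v by rewrite addr_ge0// ltW.
rewrite !powRM ?(ltW x0) ?(ltW v0)//.
have -> : nu - alpha - 1 = (nu - 2) + (1 - alpha) by ring.
have -> : - (2 - alpha + (alpha - nu)) = nu - 2 by ring.
have -> : 2 - alpha - 1 = 1 - alpha by ring.
by rewrite (powRDp (nu - 2))//; ring.
Qed.

Lemma ipos_scaled_powR (alpha v : R) : 1 < alpha -> 0 < v ->
  ipos (fun r => (v + r) `^ (- alpha)) = (v `^ (1 - alpha) / (alpha - 1))%:E.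
Proof.
move=> a1 v0; rewrite (@ipos_scale _ v)//; last 2 first.
- by mfun.
- by move=> r r0; rewrite powR_ge0.
rewrite EFinM -bet1; last lra.
rewrite (_ : v `^ (1 - alpha) = v * v `^ (- alpha)); last first.
  by rewrite -{2}(powRr1 (ltW v0)) -powRDp.
rewrite EFinM -muleA /bet; congr (_ * _)%E; rewrite -iposZl ?powR_ge0//; last 2 first.
- by mfun.
- by move=> r r0; rewrite mulr_ge0 ?powR_ge0.
apply: eq_ipos => r r0; rewrite subrr powRr0 mul1r.
have -> : v + v * r = v * (1 + r) by ring.
rewrite powRM ?(ltW v0)//; last by rewrite addr_ge0// ltW.
by congr (_ * _ `^ _); ring.
Qed.

End PowerTaylor.

(** * Mean of |x + Z|^nu for a heavy-tailed jump Z *)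

Section Drift.
Context {R : realType} {d : measure_display} {T : measurableType d}.
Variables (J : probability T R -> (T -> R) -> Prop) (alpha beta c : R).
Hypothesis alpha1 : 1 < alpha.
Hypothesis alpha2 : alpha < 2.
Hypothesis alpha_beta : alpha < beta.
Hypothesis c0 : 0 < c.
Hypothesis mJ : forall P Z, J P Z -> measurable_fun [set: T] Z.
Hypothesis tailJ : forall eps : R, 0 < eps -> exists Y, forall y, Y <= y ->
  forall P Z, J P Z -> `|y `^ alpha * fine (P [set w | y < posp (Z w)]) - c| <= eps.
Hypothesis negJ : exists M : R, forall P Z, J P Z ->
  (\int[P]_w (negp (Z w) `^ beta)%:E <= M%:E)%E.

Notation mu := (@lebesgue_measure R).

(** The mean excess E (Z - v)_+, the only feature of the outward tail that enters the averaged
    Taylor remainder. *)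
Let excess (P : probability T R) (Z : T -> R) (v : R) : \bar R :=
  (\int[P]_w (posp (Z w - v))%:E)%E.

Let mposp P Z v : J P Z -> measurable_fun [set: T] (fun w => posp (Z w - v)).
Proof.
move=> /mJ mZ; apply: (measurableT_comp measurable_posp).
exact: measurable_funB.
Qed.

(** Layer-cake formula: (Z - v)_+ exceeds r > 0 exactly when Z_+ exceeds v + r >= Y, and the bounds
    on the tail are integrated over r. *)
Let excess_bounds (eps : R) : 0 < eps -> eps <= c -> exists2 Y : R, 0 < Y &
  forall v, Y <= v -> forall P Z, J P Z ->
  (((c - eps) / (alpha - 1) * v `^ (1 - alpha))%:E <= excess P Z v
    <= ((c + eps) / (alpha - 1) * v `^ (1 - alpha))%:E)%E.
Proof.
move=> e0 ec; have [Y Y0 hY] := tail_bounds tailJ e0; exists Y => // v Yv P Z JPZ.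
have v0 : 0 < v by exact: lt_le_trans Yv.
have a1 := alpha1.
pose V : {RV P >-> R} := mfun_Sub (mem_set (mposp v JPZ)).
have VE : excess P Z v = (\int[mu]_(r in positives) ccdf V r)%E.
  rewrite integral_itv_obnd_cbnd; last by apply: measurable_funTS; exact: ccdf_measurable.
  rewrite -ge0_expectation_ccdf ?expectation_def//.
  by move=> w; exact: posp_ge0.
have cE r : 0 < r -> ccdf V r = (fine (P [set w | v + r < posp (Z w)]))%:E.
  move=> r0; rewrite -(prob_gt_fin mJ _ JPZ) /ccdf /distribution /pushforward/=.
  congr (P _); apply/seteqP; split => w /=; rewrite in_itv/= andbT !pospE !lt_max;
    rewrite [r < 0]ltNge (ltW r0) [v + r < 0]ltNge addr_ge0 ?(ltW v0) ?(ltW r0)//= !orbF;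
    by rewrite ltrBrDl.
have I k : 0 <= k -> ipos (fun r => k * (v + r) `^ (- alpha)) =
    (k / (alpha - 1) * v `^ (1 - alpha))%:E.
  move=> k0; rewrite iposZl//; last 2 first.
  - by mfun.
  - by move=> r r0; exact: powR_ge0.
  by rewrite ipos_scaled_powR// -EFinM; congr EFin; rewrite mulrA mulrAC.
have b r : 0 < r -> (c - eps) * (v + r) `^ (- alpha) <=
    fine (P [set w | v + r < posp (Z w)]) <= (c + eps) * (v + r) `^ (- alpha).
  by move=> r0; apply: hY => //; rewrite (le_trans Yv)// lerDl ltW.
rewrite VE -!I; [|lra|lra].
have mc : measurable_fun (positives : set R) (ccdf V).
  by apply: measurable_funTS; exact: ccdf_measurable.
have mI k : measurable_fun (positives : set R) (fun r => (k * (v + r) `^ (- alpha))%:E).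
  by apply/measurable_EFinP; apply: measurable_funTS; mfun.
have ce : 0 <= c - eps by lra.
apply/andP; split; apply: ge0_le_integral => //.
- by move=> r _; rewrite lee_fin mulr_ge0 ?powR_ge0.
- exact: mI.
- by move=> r /=; rewrite in_itv/= andbT => r0; rewrite cE// lee_fin; have /andP[] := b _ r0.
- exact: mI.
- by move=> r /=; rewrite in_itv/= andbT => r0; rewrite cE// lee_fin; have /andP[] := b _ r0.
Qed.

Let excess_upper : exists2 C : R, 0 <= C & forall v, 0 <= v -> forall P Z, J P Z ->
  (excess P Z v <= C%:E)%E.
Proof.
have [C C0 hC] := moment_posp alpha1 c0 mJ tailJ ltr01 alpha1.
exists C => // v v0 P Z JPZ; apply: le_trans (hC _ _ JPZ).
apply: ge0_le_integral => //.
- by move=> w _; rewrite lee_fin posp_ge0.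
- by apply/measurable_EFinP; exact: (mposp _ JPZ).
- apply/measurable_EFinP; apply: (measurableT_comp (measurable_powR 1)).
  exact: (measurableT_comp measurable_posp (mJ JPZ)).
- move=> w _; rewrite lee_fin powRr1 ?posp_ge0// !pospE.
  by rewrite ge_max !le_max lexx orbT gerBl v0.
Qed.

Let excess_ge0 P Z v : (0 <= excess P Z v)%E.
Proof. by apply: integral_ge0 => w _; rewrite lee_fin posp_ge0. Qed.

Let L (nu x : R) (P : probability T R) (Z : T -> R) : \bar R :=
  (\int[P]_w ipos (fun v => (x + v) `^ (nu - 2) * posp (Z w - v)))%E.

Let m2 (x nu : R) P Z : J P Z ->
  measurable_fun [set: T * R] (fun z : T * R => (x + z.2) `^ (nu - 2) * posp (Z z.1 - z.2)).
Proof.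
move=> JPZ; apply: measurable_funM; first by mfun.
apply: (measurableT_comp (@measurable_posp R)); apply: measurable_funB => //.
exact: (measurableT_comp (mJ JPZ)).
Qed.

Let LE nu x P Z : J P Z -> 0 < x ->
  L nu x P Z = (\int[mu]_(v in positives) (((x + v) `^ (nu - 2))%:E * excess P Z v))%E.
Proof.
move=> JPZ x0.
rewrite /L (@fubini_tonelli_dom _ _ _ _ _ P mu setT positives
  (fun z => ((x + z.2) `^ (nu - 2) * posp (Z z.1 - z.2))%:E))//; last 2 first.
- by apply/measurable_EFinP; exact: (@m2 x nu P Z JPZ).
- by move=> w v _ _; rewrite lee_fin mulr_ge0 ?powR_ge0 ?posp_ge0.
apply: eq_integral => v _ /=.
rewrite -ge0_integralZl_EFin ?powR_ge0//.
- by move=> w _; rewrite lee_fin posp_ge0.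
- by apply/measurable_EFinP; exact: (mposp _ JPZ).
Qed.

Let mexcess P Z : J P Z -> measurable_fun [set: R] (excess P Z).
Proof.
move=> JPZ.
have mf : measurable_fun [set: T * R] (fun z : T * R => (posp (Z z.1 - z.2))%:E).
  apply/measurable_EFinP; apply: (measurableT_comp (@measurable_posp R)).
  apply: measurable_funB => //.
  exact: (measurableT_comp (mJ JPZ)).
apply: (@measurable_fun_fubini_tonelli_G _ _ _ _ _ P
  (fun z : T * R => (posp (Z z.1 - z.2))%:E)) => //.
by move=> z; rewrite lee_fin posp_ge0.
Qed.

Let mweight (x nu : R) : measurable_fun [set: R] (fun v : R => ((x + v) `^ (nu - 2))%:E).
Proof. by apply/measurable_EFinP; mfun. Qed.

(** The asymptotics of [excess] hold for v >= Y only. The range v <= Y contributes O(x^(nu - 2)),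
    negligible against x^(nu - alpha) because alpha < 2. *)
Let L_bounds (nu eps : R) : 0 < nu -> nu < alpha -> 0 < eps ->
  exists2 X0 : R, 0 < X0 & forall x, X0 <= x -> forall P Z, J P Z ->
  L nu x P Z \is a fin_num /\
  `|fine (L nu x P Z) - c / (alpha - 1) * Beta (2 - alpha) (alpha - nu) * x `^ (nu - alpha)|
    <= eps * x `^ (nu - alpha).
Proof.
move=> n0 na e0; have a1 := alpha1; have a2 := alpha2; have cc := c0.
pose B := Beta (2 - alpha) (alpha - nu).
have B0 : 0 < B by apply: Beta_gt0; lra.
pose e : R := Num.min c (eps / 2 * (alpha - 1) / B).
have ep : 0 < e by rewrite lt_min c0 divr_gt0// mulr_gt0 ?divr_gt0//; lra.
have ec : e <= c by rewrite ge_min lexx.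
have eB : e / (alpha - 1) * B <= eps / 2.
  rewrite mulrAC ler_pdivrMr; last lra.
  by rewrite -ler_pdivlMr// ge_min lexx orbT.
have [Y Y0 hY] := excess_bounds ep ec.
have [C1 C10 hC1] := excess_upper.
(* [W] bounds the integral of v^(1 - alpha) over [0, Y]: on that interval 1 <= (1 + Y)^(3 - alpha)
   (1 + v)^(- (3 - alpha)), which leaves the integrand of [bet (2 - alpha) 1]. In [C2] the first
   summand is the error of the upper bound, the second that of the lower bound. *)
pose W : R := (1 + Y) `^ (3 - alpha) * Beta (2 - alpha) 1.
have W0 : 0 <= W by rewrite mulr_ge0 ?powR_ge0// ltW// Beta_gt0//; lra.
pose C2 : R := C1 * Y + c / (alpha - 1) * W.
have ca : 0 < c / (alpha - 1) by rewrite divr_gt0//; lra.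
have C20 : 0 <= C2.
  by apply: addr_ge0; apply: mulr_ge0 => //; exact: ltW.
have small : forall x, Num.max 1 ((C2 / (eps / 2)) `^ (2 - alpha)^-1) <= x ->
    C2 * x `^ (nu - 2) <= eps / 2 * x `^ (nu - alpha).
  move=> x; rewrite ge_max => /andP[x1 xC].
  have x0 : 0 < x by exact: lt_le_trans x1.
  have -> : x `^ (nu - 2) = x `^ (nu - alpha) * x `^ (alpha - 2).
    by rewrite -powRDp//; congr powR; ring.
  rewrite mulrCA [leRHS]mulrC ler_wpM2l ?powR_ge0//.
  rewrite -(opprB 2 alpha) powRN ler_pdivrMr ?powR_gt0// mulrC -ler_pdivrMr ?divr_gt0//.
  have e20 : 0 < eps / 2 by rewrite divr_gt0.
  have Ce : 0 <= C2 / (eps / 2) by rewrite divr_ge0// ltW.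
  have -> : C2 / (eps / 2) = ((C2 / (eps / 2)) `^ (2 - alpha)^-1) `^ (2 - alpha).
    by rewrite -powRrM mulVf ?powRr1// gt_eqF//; lra.
  apply: ge0_ler_powR; rewrite ?nnegrE ?powR_ge0 ?(ltW x0)//; lra.
exists (Num.max 1 ((C2 / (eps / 2)) `^ (2 - alpha)^-1)); first by rewrite lt_max ltr01.
move=> x xX P Z JPZ.
have x1 : 1 <= x by move: xX; rewrite ge_max => /andP[].
have x0 : 0 < x by exact: lt_le_trans x1.
have := small _ xX; set S := C2 * _ => Ssmall.
have xa : 0 < x `^ (nu - alpha) by rewrite powR_gt0.
have BE k : 0 <= k -> ipos (fun v => k * ((x + v) `^ (nu - 2) * v `^ (1 - alpha))) =
    (k * (x `^ (nu - alpha) * B))%:E.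
  move=> k0; rewrite iposZl//; last 2 first.
  - by mfun.
  - by move=> v _; rewrite mulr_ge0 ?powR_ge0.
  by rewrite ipos_scaled_bet// EFinM.
have ind_ge0 v : 0 <= \1_`[0, Y] v :> R by [].
have mind : measurable_fun [set: R] (\1_`[0, Y] : R -> R) by exact: measurable_indic.
have powx v : 0 < v -> (x + v) `^ (nu - 2) <= x `^ (nu - 2).
  move=> v0; rewrite -(opprB 2 nu) !powRN lef_pV2 ?posrE ?powR_gt0 ?addr_gt0//.
  apply: ge0_ler_powR; [lra|by rewrite nnegrE ltW| |by rewrite lerDl ltW].
  by rewrite nnegrE addr_ge0// ltW.
have g1 v : 0 <= c / (alpha - 1) * (v `^ (1 - alpha) * \1_`[0%R, Y] v).
  by apply: mulr_ge0; [exact: ltW|rewrite mulr_ge0 ?powR_ge0].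
have gY v : (0 <= C1 * \1_`[0, Y] v) by rewrite mulr_ge0.
have exc_le v : 0 < v -> (excess P Z v <=
    ((c + e) / (alpha - 1) * v `^ (1 - alpha) + C1 * \1_`[0%R, Y] v)%:E)%E.
  move=> v0; have [Yv|vY] := leP Y v.
    have /andP[_ h] := hY _ Yv _ _ JPZ; apply: (le_trans h).
    by rewrite lee_fin lerDl.
  apply: (le_trans (hC1 _ (ltW v0) _ _ JPZ)); rewrite lee_fin.
  rewrite indicE mem_set/=; last by rewrite in_itv/= !ltW.
  by rewrite mulr1 lerDr mulr_ge0 ?powR_ge0// divr_ge0//; lra.
have exc_ge v : 0 < v -> (((c - e) / (alpha - 1) * v `^ (1 - alpha))%:E <= excess P Z v +
    (c / (alpha - 1) * (v `^ (1 - alpha) * \1_`[0%R, Y] v))%:E)%E.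
  move=> v0; have vp := powR_ge0 v (1 - alpha); have [Yv|vY] := leP Y v.
    have /andP[h _] := hY _ Yv _ _ JPZ; apply: (le_trans h).
    rewrite leeDl// lee_fin; apply: mulr_ge0; first exact: ltW.
    by rewrite mulr_ge0.
  rewrite indicE mem_set/=; last by rewrite in_itv/= !ltW.
  rewrite mulr1 -[leLHS]add0e; apply: leeD; first exact: excess_ge0.
  rewrite lee_fin ler_wpM2r// ler_pM2r ?invr_gt0//; lra.
have upper : (L nu x P Z <= ((c + e) / (alpha - 1) * (x `^ (nu - alpha) * B)
     + x `^ (nu - 2) * (C1 * Y))%:E)%E.
  rewrite LE//.
  apply: (@le_trans _ _ (ipos (fun v => (c + e) / (alpha - 1) * ((x + v) `^ (nu - 2) * v `^ (1 - alpha))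
      + x `^ (nu - 2) * (C1 * \1_`[0%R, Y] v))))%E; last first.
    rewrite iposD//; last 4 first.
    - by mfun.
    - by apply: measurable_funM => //; apply: measurable_funM.
    - by move=> v _; rewrite mulr_ge0 ?divr_ge0 ?mulr_ge0 ?powR_ge0//; lra.
    - by move=> v _; rewrite mulr_ge0 ?powR_ge0.
    rewrite EFinD BE ?divr_ge0//; [|lra|lra].
    rewrite leeD2l// iposZl ?powR_ge0//; last by apply: measurable_funM.
    rewrite EFinM lee_wpmul2l ?lee_fin ?powR_ge0// iposZl//.
    rewrite EFinM lee_wpmul2l ?lee_fin//.
    rewrite integral_indic//; apply: (@le_trans _ _ (mu `[0%R, Y])).
      by apply: le_measure; rewrite ?inE//; exact: measurableI.
    by rewrite lebesgue_measure_itv/= lte_fin Y0 sube0.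
  apply: ge0_le_integral => //.
  - by move=> v _; rewrite mule_ge0 ?lee_fin ?powR_ge0.
  - by apply: emeasurable_funM; apply: measurable_funTS; [exact: mweight|exact: mexcess].
  - apply/measurable_EFinP; apply: measurable_funTS; apply: measurable_funD; first by mfun.
    by apply: measurable_funM => //; apply: measurable_funM.
  - move=> v /=; rewrite in_itv/= andbT => v0.
    apply: (@le_trans _ _ (((x + v) `^ (nu - 2))%:E *
        ((c + e) / (alpha - 1) * v `^ (1 - alpha) + C1 * \1_`[0%R, Y] v)%:E)%E).
      by rewrite lee_wpmul2l ?lee_fin ?powR_ge0// exc_le.
    rewrite -EFinM lee_fin mulrDr mulrCA lerD2l ler_wpM2r//.
    exact: powx.
have lower : (((c - e) / (alpha - 1) * (x `^ (nu - alpha) * B))%:E <=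
    L nu x P Z + (x `^ (nu - 2) * (c / (alpha - 1) * W))%:E)%E.
  rewrite LE//.
  pose g v : R := x `^ (nu - 2) * (c / (alpha - 1) * (v `^ (1 - alpha) * \1_`[0%R, Y] v)).
  have g0 v : 0 <= g v.
    by rewrite /g mulr_ge0 ?powR_ge0.
  have mg : measurable_fun [set: R] g.
    by rewrite /g; mfun.
  apply: (@le_trans _ _ (\int[mu]_(v in positives) (((x + v) `^ (nu - 2))%:E * excess P Z v + (g v)%:E))%E).
    rewrite -BE; last by rewrite divr_ge0//; lra.
    apply: ge0_le_integral => //.
    - by move=> v _; rewrite lee_fin mulr_ge0 ?divr_ge0 ?mulr_ge0 ?powR_ge0//; lra.
    - by apply/measurable_EFinP; apply: measurable_funTS; mfun.
    - apply: emeasurable_funD; last by apply/measurable_EFinP; exact: measurable_funTS.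
      by apply: emeasurable_funM; apply: measurable_funTS; [exact: mweight|exact: mexcess].
    - move=> v /=; rewrite in_itv/= andbT => v0.
      rewrite mulrCA EFinM.
      apply: (@le_trans _ _ (((x + v) `^ (nu - 2))%:E * (excess P Z v +
          (c / (alpha - 1) * (v `^ (1 - alpha) * \1_`[0%R, Y] v))%:E))%E).
        by rewrite lee_wpmul2l ?lee_fin ?powR_ge0// exc_ge.
      rewrite ge0_muleDr ?excess_ge0//; last first.
        by rewrite lee_fin.
      rewrite leeD2l// -EFinM lee_fin /g ler_wpM2r ?powx//.
  rewrite ge0_integralD//; last 4 first.
  - by move=> v _; rewrite mule_ge0 ?lee_fin ?powR_ge0.
  - by apply: emeasurable_funM; apply: measurable_funTS; [exact: mweight|exact: mexcess].
  - by move=> v _; rewrite lee_fin.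
  - by apply/measurable_EFinP; exact: measurable_funTS.
  rewrite leeD2l// /g iposZl ?powR_ge0//; last by mfun.
  rewrite EFinM lee_wpmul2l ?lee_fin ?powR_ge0//.
  rewrite iposZl ?(ltW ca)//; last 2 first.
  - by mfun.
  - by move=> v _; rewrite !mulr_ge0 ?powR_ge0.
  rewrite (EFinM (c / (alpha - 1)) W) lee_wpmul2l ?lee_fin ?(ltW ca)//.
  rewrite /W EFinM -betE; [|lra|lra]; rewrite /bet -iposZl ?powR_ge0//; last 2 first.
  - by mfun.
  - by move=> v v0; rewrite mulr_ge0 ?powR_ge0.
  apply: le_ipos => //; [by mfun|by mfun|] => v v0.
  rewrite mulr_ge0 ?powR_ge0//= (_ : 2 - alpha - 1 = 1 - alpha); last by ring.
  rewrite mulrCA ler_wpM2l ?powR_ge0// indicE.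
  case: (boolP (v \in `[0, Y]%classic)) => [|_]; last by rewrite mulr_ge0 ?powR_ge0.
  rewrite inE/= in_itv/= => /andP[_ vY].
  rewrite (_ : - (2 - alpha + 1) = - (3 - alpha)); last by ring.
  have v1 : 0 < 1 + v by rewrite addr_gt0.
  rewrite powRN ler_pdivlMr ?powR_gt0// mul1r.
  apply: ge0_ler_powR; [lra|by rewrite nnegrE ltW|by rewrite nnegrE addr_ge0// ltW|].
  by rewrite lerD2l.
have L0 : (0 <= L nu x P Z)%E.
  by apply: integral_ge0 => w _; apply: ipos_ge0 => v _; rewrite mulr_ge0 ?powR_ge0 ?posp_ge0.
move: upper lower L0; case: (L nu x P Z) => [l||]//; rewrite -EFinD !lee_fin => upper lower _.
split=> //=; rewrite -/B.
have SE : S = x `^ (nu - 2) * (C1 * Y) + x `^ (nu - 2) * (c / (alpha - 1) * W).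
  by rewrite /S /C2; ring.
have t1 : 0 <= x `^ (nu - 2) * (C1 * Y) by rewrite !mulr_ge0 ?powR_ge0 ?(ltW Y0).
have t2 : 0 <= x `^ (nu - 2) * (c / (alpha - 1) * W).
  by apply: mulr_ge0; rewrite ?powR_ge0//; apply: mulr_ge0 => //; exact: ltW.
have eBx : e / (alpha - 1) * B * x `^ (nu - alpha) <= eps / 2 * x `^ (nu - alpha).
  by rewrite ler_wpM2r// ltW.
have u1 : (c + e) / (alpha - 1) * (x `^ (nu - alpha) * B) =
   c / (alpha - 1) * B * x `^ (nu - alpha) + e / (alpha - 1) * B * x `^ (nu - alpha) by ring.
have u2 : (c - e) / (alpha - 1) * (x `^ (nu - alpha) * B) =
   c / (alpha - 1) * B * x `^ (nu - alpha) - e / (alpha - 1) * B * x `^ (nu - alpha) by ring.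
rewrite u1 in upper; rewrite u2 in lower.
by rewrite ler_norml; apply/andP; split; lra.
Qed.

Lemma powRN_small (C e s : R) : 0 <= C -> 0 < e -> 0 < s ->
  exists2 X0 : R, 1 <= X0 & forall x, X0 <= x -> C * x `^ (- s) <= e.
Proof.
move=> C00 e0 s0; exists (Num.max 1 ((C / e) `^ s^-1)); first by rewrite le_max lexx.
move=> x; rewrite ge_max => /andP[x1 xC].
have x0 : 0 < x by exact: lt_le_trans x1.
rewrite powRN ler_pdivrMr ?powR_gt0// mulrC -ler_pdivrMr//.
have Ce : 0 <= C / e by rewrite divr_ge0// ltW.
have -> : C / e = ((C / e) `^ s^-1) `^ s.
  by rewrite -powRrM mulVf ?powRr1// gt_eqF.
by apply: ge0_ler_powR; rewrite ?nnegrE ?powR_ge0 ?(ltW x0) ?(ltW s0).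
Qed.

(* The Taylor remainder of |x + z|^nu is phip + phin: phip is its value at z_+ and gives the
   leading term of the drift, while phin lives on z < 0 and is negligible. *)
Let phip (nu x z : R) : R := (x + posp z) `^ nu - x `^ nu - nu * x `^ (nu - 1) * posp z.

Let phin (nu x z : R) : R := `|x + z| `^ nu - x `^ nu - nu * x `^ (nu - 1) * z - phip nu x z.

Let mphip nu x P Z : J P Z -> measurable_fun [set: T] (fun w => phip nu x (Z w)).
Proof.
move=> JPZ; have mp := measurableT_comp (@measurable_posp R) (mJ JPZ).
by rewrite /phip; mfun.
Qed.

Let mphin nu x P Z : J P Z -> measurable_fun [set: T] (fun w => phin nu x (Z w)).
Proof.
move=> JPZ; have mZ := mJ JPZ; apply: measurable_funB; last exact: (mphip nu x JPZ).
by mfun.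
Qed.

(** For nu = 1 the function [phip] vanishes. Otherwise [phip] over nu (nu - 1) is the integral
    remainder of [ipos_taylor]; it is non-negative, so its finite mean from [L_bounds] also gives
    integrability. *)
Let drift_pos (nu eps : R) : 0 < nu -> nu < alpha -> 0 < eps ->
  exists2 X0 : R, 0 < X0 & forall x, X0 <= x -> forall P Z, J P Z ->
  P.-integrable [set: T] (EFin \o (fun w => phip nu x (Z w))) /\
  `|\int[P]_w phip nu x (Z w) -
     nu * (nu - 1) * (c / (alpha - 1) * Beta (2 - alpha) (alpha - nu)) * x `^ (nu - alpha)|
    <= eps * x `^ (nu - alpha).
Proof.
move=> n0 na e0; have [n1|n1] := eqVneq nu 1.
  exists 1 => // x x1 P Z JPZ.
  have -> : (fun w => phip nu x (Z w)) = cst 0.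
    apply/funext => w; rewrite /phip n1 subrr powRr0 /=.
    have x0 : 0 <= x by lra.
    have p0 := posp_ge0 (Z w).
    by rewrite (powRr1 x0) (powRr1 (addr_ge0 x0 p0)); lra.
  split; first exact: integrable0.
  rewrite Rintegral_cst// mul0r n1 subrr mulr0 !mul0r subr0 normr0.
  by rewrite mulr_ge0 ?powR_ge0// ltW.
pose k := nu * (nu - 1).
have n10 : nu - 1 != 0 by rewrite subr_eq0.
have nn0 : nu != 0 by rewrite gt_eqF.
have k0 : k != 0 by rewrite mulf_neq0.
have e'0 : 0 < eps / `|k| by rewrite divr_gt0// normr_gt0.
have [X0 X00 hX] := L_bounds n0 na e'0; exists X0 => // x xX P Z JPZ.
have x0 : 0 < x by exact: lt_le_trans xX.
pose j w := phip nu x (Z w) / k.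
have jE w : ipos (fun v => (x + v) `^ (nu - 2) * posp (Z w - v)) = (j w)%:E.
  have [Z0|Z0] := leP 0 (Z w).
    by rewrite ipos_taylor// /j /phip /posp Z0.
  rewrite ipos_taylorN// /j /phip (_ : posp (Z w) = 0); last by rewrite /posp leNgt Z0.
  by rewrite addr0 subrr mulr0 subrr mul0r.
have j0 w : 0 <= j w.
  by rewrite -lee_fin -jE; apply: ipos_ge0 => v _; rewrite mulr_ge0 ?powR_ge0 ?posp_ge0.
have LjE : L nu x P Z = (\int[P]_w (j w)%:E)%E by apply: eq_integral => w _; rewrite jE.
have [Lfin Lb] := hX _ xX _ _ JPZ.
have mj : measurable_fun [set: T] j.
  by apply: measurable_funM => //; exact: (mphip nu x JPZ).
have ij : P.-integrable [set: T] (EFin \o j).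
  apply/integrableP; split; first exact/measurable_EFinP.
  under eq_integral do rewrite gee0_abs ?lee_fin//.
  by rewrite -LjE ltey_eq Lfin.
have jk : (fun w => phip nu x (Z w)) = (fun w => k * j w).
  by apply/funext => w; rewrite /j mulrC divfK.
rewrite jk; split.
  rewrite (_ : EFin \o _ = (fun w => k%:E * (EFin \o j) w)%E); last by apply/funext => w; rewrite EFinM.
  exact: integrableZl.
rewrite RintegralZl// (_ : \int[P]_w j w = fine (L nu x P Z)); last by rewrite LjE.
rewrite -/k -(mulrA k) -mulrBr normrM -ler_pdivlMl ?normr_gt0//.
by rewrite mulrA (mulrC _ eps).
Qed.

(** The exponent b = min(beta, 2) exceeds alpha and is admissible both in [powR_remainder] and in
    [moment_negp], so the error x^(nu - b) is of smaller order than x^(nu - alpha). *)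
Let drift_neg (nu eps : R) : 0 < nu -> nu < alpha -> 0 < eps ->
  exists2 X0 : R, 0 < X0 & forall x, X0 <= x -> forall P Z, J P Z ->
  P.-integrable [set: T] (EFin \o (fun w => phin nu x (Z w))) /\
  `|\int[P]_w phin nu x (Z w)| <= eps * x `^ (nu - alpha).
Proof.
move=> n0 na e0; have a1 := alpha1; have a2 := alpha2; have ab := alpha_beta.
pose b := Num.min beta 2.
have ba : alpha < b by rewrite lt_min alpha_beta alpha2.
have bb : b <= beta by rewrite ge_min lexx.
have b2 : b <= 2 by rewrite ge_min lexx orbT.
have [|C C00 hC] := moment_negp mJ negJ _ bb; first lra.
have [||X0 X01 hX] := @powRN_small (16 * C) eps (b - alpha) _ e0; [by rewrite mulr_ge0|lra|].
exists X0; first lra.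
move=> x xX P Z JPZ; have x0 : 0 < x by lra.
pose g w : R := 16 * x `^ (nu - b) * negp (Z w) `^ b.
have mg : measurable_fun [set: T] g.
  have mn := measurableT_comp (@measurable_negp R) (mJ JPZ).
  by rewrite /g; mfun.
have pg w : `|phin nu x (Z w)| <= g w.
  have g0 : 0 <= g w by rewrite /g mulr_ge0 ?mulr_ge0 ?powR_ge0.
  have [Z0|Z0] := leP 0 (Z w).
    rewrite /phin /phip /posp Z0 (ger0_norm (_ : 0 <= x + Z w)) ?subrr ?normr0//.
    by rewrite addr_ge0// ltW.
  rewrite /phin /phip (_ : posp (Z w) = 0); last by rewrite /posp leNgt Z0.
  rewrite addr0 subrr mulr0 subrr subr0 /g (_ : negp (Z w) = `|Z w|); last first.
    by rewrite /negp Z0 ltr0_norm.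
  by apply: powR_remainder => //; lra.
have Ig : (\int[P]_w (g w)%:E <= (16 * x `^ (nu - b) * C)%:E)%E.
  under eq_integral do rewrite EFinM.
  rewrite ge0_integralZl_EFin ?mulr_ge0 ?powR_ge0//.
  - by rewrite (EFinM _ C) lee_wpmul2l ?lee_fin ?mulr_ge0 ?powR_ge0// hC.
  - by move=> w _; rewrite lee_fin powR_ge0.
  - apply/measurable_EFinP; apply: (measurableT_comp (measurable_powR b)).
    exact: (measurableT_comp (@measurable_negp R) (mJ JPZ)).
have ip := integrable_bound (mphin nu x JPZ) mg pg Ig; split=> //.
apply: (le_trans (le_normr_Rintegral _ ip)) => //.
rewrite -lee_fin /Rintegral fineK; last first.
  apply: integrable_fin_num => //; exact: (integrable_norm ip).
apply: (@le_trans _ _ (16 * x `^ (nu - b) * C)%:E); last first.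
  rewrite lee_fin; have -> : x `^ (nu - b) = x `^ (nu - alpha) * x `^ (- (b - alpha)).
    by rewrite -powRDp//; congr powR; ring.
  rewrite (_ : 16 * _ * C = 16 * C * x `^ (- (b - alpha)) * x `^ (nu - alpha)); last by ring.
  by rewrite ler_wpM2r ?powR_ge0// hX.
apply: le_trans Ig; apply: ge0_le_integral => //.
- by apply/measurable_EFinP; apply: (measurableT_comp (@normr_measurable R setT)); exact: (mphin nu x JPZ).
- exact/measurable_EFinP.
- by move=> w _; rewrite lee_fin.
Qed.

Lemma drift_power (nu eps : R) : 0 < nu -> nu < alpha -> 0 < eps ->
  exists2 X0 : R, 0 < X0 & forall x, X0 <= x -> forall P Z, J P Z ->
  P.-integrable [set: T] (EFin \o (fun w => `|x + Z w| `^ nu)) /\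
  `|\int[P]_w (`|x + Z w| `^ nu) - (x `^ nu + nu * x `^ (nu - 1) * \int[P]_w Z w +
     nu * (nu - 1) * (c / (alpha - 1) * Beta (2 - alpha) (alpha - nu)) * x `^ (nu - alpha))|
    <= eps * x `^ (nu - alpha).
Proof.
move=> n0 na e0; have e20 : 0 < eps / 2 by rewrite divr_gt0.
have [X1 X10 h1] := drift_pos n0 na e20; have [X2 X20 h2] := drift_neg n0 na e20.
exists (Num.max X1 X2); first by rewrite lt_max X10.
move=> x; rewrite ge_max => /andP[xX1 xX2] P Z JPZ.
have [i1 b1] := h1 _ xX1 _ _ JPZ; have [i2 b2] := h2 _ xX2 _ _ JPZ.
have iZ : P.-integrable [set: T] (EFin \o Z).
  exact: (integrable_jump alpha1 alpha_beta c0 mJ tailJ negJ JPZ).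
have ic : P.-integrable [set: T] (EFin \o (fun _ : T => x `^ nu)).
  exact: finite_measure_integrable_cst.
have iZk : P.-integrable [set: T] (EFin \o (fun w => nu * x `^ (nu - 1) * Z w)).
  rewrite (_ : EFin \o _ = (fun w => (nu * x `^ (nu - 1))%:E * (EFin \o Z) w)%E).
    exact: integrableZl.
  by apply/funext => w; rewrite /= EFinM.
have i12 : P.-integrable [set: T] (EFin \o (fun w => phip nu x (Z w) + phin nu x (Z w))).
  exact: (integrableD _ i1 i2).
have icZ : P.-integrable [set: T] (EFin \o (fun w => x `^ nu + nu * x `^ (nu - 1) * Z w)).
  exact: (integrableD _ ic iZk).
have E : (fun w => `|x + Z w| `^ nu) =
  (fun w => (x `^ nu + nu * x `^ (nu - 1) * Z w) + (phip nu x (Z w) + phin nu x (Z w))).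
  by apply/funext => w; rewrite /phin; ring.
rewrite E; split; first exact: (integrableD _ icZ i12).
rewrite RintegralD// RintegralD// RintegralD// RintegralZl// Rintegral_cst//.
rewrite [X in fine X]probability_setT mulr1.
set A := \int[P]_w phip _ _ _ in b1 *; set A' := \int[P]_w phin _ _ _ in b2 *.
move: b1 b2; rewrite !ler_norml => /andP[u1 u2] /andP[u3 u4].
by apply/andP; split; lra.
Qed.

End Drift.

(** * A cut-off function that controls returns from far away *)

Section Weight.
Context {R : realType}.

(* The square makes the function quadratic near 2r, so that the mean of one
   step increases it by O(r^-s) only. *)
Definition weight (r y : R) : R := Num.min 1 ((posp (2 * r - `|y|) / r) ^+ 2).

Lemma weight_ge0 r y : 0 <= weight r y.
Proof. by rewrite le_min ler01 sqr_ge0. Qed.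

Lemma weight_norm r y : weight r `|y| = weight r y.
Proof. by rewrite /weight normr_id. Qed.

Lemma weight_in r y : 0 < r -> `|y| <= r -> weight r y = 1.
Proof.
move=> r0 yr; apply/eqP; rewrite eq_le ge_min lexx/= le_min lexx/=.
apply: exprn_ege1.
by rewrite ler_pdivlMr// mul1r pospE le_max; apply/orP; left; lra.
Qed.

Lemma weight_out r y : 2 * r <= `|y| -> weight r y = 0.
Proof.
move=> yr; rewrite /weight (_ : posp _ = 0); first by rewrite mul0r expr0n/= min_r.
by rewrite pospE max_r// subr_le0.
Qed.

Lemma measurable_weight r : measurable_fun [set: R] (weight r).
Proof.
have mp : measurable_fun [set: R] (fun y : R => posp (2 * r - `|y|)).
  apply: (measurableT_comp measurable_posp); by mfun.
apply: measurable_minr => //; apply: measurable_funX; exact: measurable_funM.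
Qed.

(** With u = (2r - x)_+ / r and t = z / r, the weight at x + z is at most (u - t)_+^2 and at most 1.
    For |t| <= 1 expand the square and use t^2 <= |t|^s; for t > 1 the bound (u - t)_+^2 is 0; for t
    < -1 the bound 1 <= |t|^s is enough. *)
Lemma weight_jump (r s x : R) : 0 < r -> 1 <= s -> s <= 2 -> r <= x ->
  exists2 A : R, `|A| <= 2 / r &
  forall z, weight r (x + z) <= weight r x + A * z + 2 * r `^ (- s) * `|z| `^ s.
Proof.
move=> r0 s1 s2 rx; have x0 : 0 < x by lra.
pose u := posp (2 * r - x) / r.
have u0 : 0 <= u by rewrite divr_ge0 ?posp_ge0// ltW.
have u1 : u <= 1.
  by rewrite ler_pdivrMr// mul1r pospE ge_max (ltW r0) andbT; lra.
have wx : weight r x = u ^+ 2.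
  by rewrite /weight gtr0_norm// -/u min_r// exprn_ile1.
exists (- (2 * u / r)).
  rewrite normrN ger0_norm; last first.
    by apply: divr_ge0; [exact: mulr_ge0|exact: ltW].
  by rewrite ler_wpM2r ?invr_ge0 ?(ltW r0)//; lra.
move=> z; pose t := z / r.
have -> : 2 * r `^ (- s) * `|z| `^ s = 2 * `|t| `^ s.
  rewrite /t normrM normfV (gtr0_norm r0) powRM ?invr_ge0 ?(ltW r0)//.
  by rewrite -(powR_inv1 (ltW r0)) -powRrM mulN1r; ring.
have -> : - (2 * u / r) * z = - (2 * u * t) by rewrite /t; ring.
rewrite wx.
have ut : weight r (x + z) <= posp (u - t) ^+ 2.
  rewrite ge_min; apply/orP; right.
  rewrite ler_sqr ?nnegrE ?divr_ge0 ?posp_ge0 ?(ltW r0)//.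
  rewrite ler_pdivrMr// pospE ge_max mulr_ge0 ?posp_ge0 ?(ltW r0)// andbT.
  apply: (@le_trans _ _ ((u - t) * r)); last by rewrite ler_wpM2r ?(ltW r0)// pospE le_max lexx.
  rewrite mulrBl /u /t !divfK ?gt_eqF//.
  have h1 : x + z <= `|x + z| by exact: ler_norm.
  have h2 : 2 * r - x <= posp (2 * r - x) by rewrite pospE le_max lexx.
  lra.
have w1 : weight r (x + z) <= 1 by rewrite ge_min lexx.
have ts0 : 0 <= `|t| `^ s by exact: powR_ge0.
have u20 : 0 <= u ^+ 2 by exact: sqr_ge0.
have [t1|t1] := leP `|t| 1.
  apply: (le_trans ut).
  have h : posp (u - t) ^+ 2 <= (u - t) ^+ 2.
    by rewrite /posp; case: ifP => // _; rewrite expr0n/= sqr_ge0.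
  have tt : t ^+ 2 <= `|t| `^ s.
    rewrite -real_normK ?num_real// -powR_mulrn//.
    have [->|t0] := eqVneq `|t| 0; first by rewrite !powR0//; lra.
    by apply: ger_powR; rewrite // lt_def t0 normr_ge0.
  have E : (u - t) ^+ 2 = u ^+ 2 - 2 * u * t + t ^+ 2 by ring.
  lra.
have tt : `|t| <= `|t| `^ s.
  by rewrite -[leLHS]powRr1//; apply: ler_powR => //; exact: ltW.
move: t1; rewrite lter_normr => /orP[t1|t1].
  have t0 : 0 <= t by lra.
  move: tt ts0; rewrite (ger0_norm t0) => tt ts0.
  have p0 : posp (u - t) = 0 by rewrite pospE max_r//; lra.
  have ut' : u * t <= 1 * t by rewrite ler_wpM2r.
  move: ut; rewrite p0 expr0n/= => ut; lra.
have t0 : t <= 0 by lra.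
move: tt ts0; rewrite (ler0_norm t0) => tt ts0.
have ut' : 0 <= u * - t by rewrite mulr_ge0//; lra.
lra.
Qed.

End Weight.

Section WeightDrift.
Context {R : realType} {d : measure_display} {T : measurableType d}.
Variables (J : probability T R -> (T -> R) -> Prop) (alpha beta c : R).
Hypothesis alpha1 : 1 < alpha.
Hypothesis alpha2 : alpha < 2.
Hypothesis alpha_beta : alpha < beta.
Hypothesis c0 : 0 < c.
Hypothesis mJ : forall P Z, J P Z -> measurable_fun [set: T] Z.
Hypothesis tailJ : forall eps : R, 0 < eps -> exists Y, forall y, Y <= y ->
  forall P Z, J P Z -> `|y `^ alpha * fine (P [set w | y < posp (Z w)]) - c| <= eps.
Hypothesis negJ : exists M : R, forall P Z, J P Z ->
  (\int[P]_w (negp (Z w) `^ beta)%:E <= M%:E)%E.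

(** The mean of [weight_jump]. Here s < alpha is essential, since it makes the moment of order s of
    the jump finite. *)
Lemma weight_drift (s : R) : 1 <= s -> s < alpha -> exists2 C : R, 0 <= C &
  forall r x : R, 0 < r -> r <= x -> forall P Z, J P Z ->
  (\int[P]_w (weight r (x + Z w))%:E <=
    (weight r x + 2 / r * `|\int[P]_w Z w| + C * r `^ (- s))%:E)%E.
Proof.
move=> s1 sa; have a2 := alpha2; have s0 : 0 < s by lra.
have [C C0 hC] := moment_norm alpha1 alpha_beta c0 mJ tailJ negJ s0 sa.
exists (2 * C); first by rewrite mulr_ge0.
move=> r x r0 rx P Z JPZ.
have [|A A2 hA] := @weight_jump _ r s x r0 s1 _ rx; first lra.
have iZ := integrable_jump alpha1 alpha_beta c0 mJ tailJ negJ JPZ.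
have iZs := integrable_norm_powR alpha1 alpha_beta c0 mJ tailJ negJ s0 sa JPZ.
pose B := 2 * r `^ (- s).
have B0 : 0 <= B by rewrite mulr_ge0 ?powR_ge0.
have ic : P.-integrable [set: T] (EFin \o (fun _ : T => weight r x)).
  exact: finite_measure_integrable_cst.
have iAZ : P.-integrable [set: T] (EFin \o (fun w => A * Z w)).
  rewrite (_ : EFin \o _ = (fun w => A%:E * (EFin \o Z) w)%E).
    exact: integrableZl.
  by apply/funext => w; rewrite /= EFinM.
have iBZ : P.-integrable [set: T] (EFin \o (fun w => B * `|Z w| `^ s)).
  rewrite (_ : EFin \o _ = (fun w => B%:E * (EFin \o (fun w => `|Z w| `^ s)%R) w)%E).
    exact: integrableZl.
  by apply/funext => w; rewrite /= EFinM.
have i1 : P.-integrable [set: T] (EFin \o (fun w => weight r x + A * Z w)).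
  exact: (integrableD _ ic iAZ).
have i2 : P.-integrable [set: T] (EFin \o (fun w => weight r x + A * Z w + B * `|Z w| `^ s)).
  exact: (integrableD _ i1 iBZ).
apply: (@le_trans _ _ (\int[P]_w (weight r x + A * Z w + B * `|Z w| `^ s)%:E)%E).
  apply: ge0_le_integral => //.
  - by move=> w _; rewrite lee_fin weight_ge0.
  - apply/measurable_EFinP; apply: (measurableT_comp (measurable_weight r)).
    by apply: measurable_funD => //; exact: (mJ JPZ).
  - by have /integrableP[] := i2.
  - by move=> w _; rewrite lee_fin; exact: hA.
rewrite -[leLHS]fineK; last exact: integrable_fin_num i2.
rewrite lee_fin -/(Rintegral _ _ _) RintegralD// RintegralD// RintegralZl// RintegralZl// Rintegral_cst//.
rewrite [X in fine X]probability_setT mulr1 -!addrA lerD2l lerD//.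
  apply: (le_trans (ler_norm _)); rewrite normrM ler_wpM2r//.
have -> : 2 * C * r `^ (- s) = B * C by rewrite /B; ring.
rewrite ler_wpM2l// -lee_fin /Rintegral fineK ?hC//.
exact: integrable_fin_num iZs.
Qed.

Lemma tail_lower : exists2 Y : R, 0 < Y & forall y : R, Y <= y -> forall P Z, J P Z ->
  ((c / 2 * y `^ (- alpha))%:E <= P [set w | (y < posp (Z w))%R])%E.
Proof.
have c20 : 0 < c / 2 by rewrite divr_gt0.
have [Y Y0 hY] := tail_bounds tailJ c20.
exists Y => // y Yy P Z JPZ; rewrite (prob_gt_fin mJ _ JPZ) lee_fin.
have /andP[h _] := hY _ Yy _ _ JPZ; apply: le_trans h.
by rewrite (_ : c - c / 2 = c / 2)//; lra.
Qed.

End WeightDrift.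

(** * The outward drift of powers of the chain *)

Section OutwardJumps.
Context {R : realType} {d : measure_display} {Omega : measurableType d}.
Variables (X : set R) (K : R.-pker R ~> R) (P : R -> probability Omega R)
  (xi : nat -> Omega -> R) (alpha beta c x0 gamma b : R).
Hypothesis chain : is_markov_chain X K P xi.
Hypothesis tout : Tout X P xi alpha beta c x0.
Hypothesis dprime : Dprime X P xi gamma b.

(** Orients the jump away from the origin, so that the conditions on the two half-lines merge into
    one and |x| can be treated as a chain started at a positive point. *)
Definition outward (x : R) (w : Omega) : R :=
  if 0 <= x then theta xi w else - theta xi w.

Let J (P' : probability Omega R) (Z : Omega -> R) : Prop :=
  exists x, [/\ X x, x0 <= `|x|, P' = P x & Z = outward x].

Let alpha1 : 1 < alpha. Proof. by case: tout => /andP[]. Qed.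
Let alpha2 : alpha < 2. Proof. by case: tout => /andP[]. Qed.
Let alpha_beta : alpha < beta. Proof. by case: tout => _ []. Qed.
Let c0 : 0 < c. Proof. by case: tout => _ [_ []]. Qed.
Let x00 : 0 <= x0. Proof. by case: tout => _ [_ [_ []]]. Qed.
Let g0 : 0 <= gamma. Proof. by case: dprime. Qed.

Let mJ P' Z : J P' Z -> measurable_fun [set: Omega] Z.
Proof.
move=> [x [_ _ _ ->]]; have mt := measurable_theta chain.
rewrite /outward; case: (0 <= x) => //.
exact: (measurableT_comp (@oppr_measurable R setT) mt).
Qed.

Let tailJ (eps : R) : 0 < eps -> exists Y, forall y, Y <= y ->
  forall P' Z, J P' Z -> `|y `^ alpha * fine (P' [set w | y < posp (Z w)]) - c| <= eps.
Proof.
move=> e0; have [_ [_ [_ [_ [h1 [h2 _]]]]]] := tout.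
have [Y1 hY1] := h1 _ e0; have [Y2 hY2] := h2 _ e0.
exists (Num.max Y1 Y2) => y; rewrite ge_max => /andP[y1 y2] _ _ [x [Xx xx -> ->]].
rewrite /outward; case: (leP 0 x) => x_0.
  by rewrite ger0_norm// in xx; exact: hY1.
rewrite (_ : [set w | _] = [set w | y < negp (theta xi w)]).
  by apply: hY2 => //; rewrite ltr0_norm// in xx; lra.
by apply/seteqP; split => w /=; rewrite pospN.
Qed.

Let negJ : exists M : R, forall P' Z, J P' Z ->
  (\int[P']_w (negp (Z w) `^ beta)%:E <= M%:E)%E.
Proof.
have [_ [_ [_ [_ [_ [_ [[M1 h1] [M2 h2]]]]]]]] := tout.
exists (Num.max M1 M2) => _ _ [x [Xx xx -> ->]].
rewrite /outward; case: (leP 0 x) => x_0.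
  rewrite ger0_norm// in xx.
  by apply: (le_trans (h1 _ Xx xx)); rewrite lee_fin le_max lexx.
rewrite ltr0_norm// in xx.
under eq_integral do rewrite negpN.
apply: (@le_trans _ _ M2%:E); last by rewrite lee_fin le_max lexx orbT.
by apply: h2 => //; lra.
Qed.

Let Jout x : X x -> x0 <= `|x| -> J (P x) (outward x).
Proof. by move=> Xx xx; exists x. Qed.

Lemma outwardE x w : `|x + theta xi w| = `| `|x| + outward x w|.
Proof.
rewrite /outward; case: (leP 0 x) => x_0; first by rewrite (ger0_norm x_0).
by rewrite (ltr0_norm x_0) -opprD normrN.
Qed.

Lemma kernel_norm x (f : R -> \bar R) : X x -> measurable_fun [set: R] f ->
  (forall y, 0 <= f y)%E -> (forall y, f `|y| = f y) ->
  (\int[K x]_y f y = \int[P x]_w f (`|x| + outward x w)%R)%E.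
Proof.
move=> Xx mf f0 fn; rewrite (kernel_law chain)//.
by apply: eq_integral => w _; rewrite -fn outwardE fn.
Qed.

Definition outward_drift (x : R) : R := \int[P x]_w outward x w.

Lemma outward_drift_cvg (eps : R) : 0 < eps -> exists2 M : R, 0 < M &
  forall x, X x -> M <= `|x| -> `| `|x| `^ gamma * outward_drift x - b| <= eps.
Proof.
move=> e0; have [_ [h1 h2]] := dprime.
have [M1 hM1] := h1 _ e0; have [M2 hM2] := h2 _ e0.
have := x00; exists (`|M1| + `|M2| + x0 + 1).
  by rewrite ltr_pwDr// !addr_ge0.
move=> x Xx xM.
have a1 := ler_norm M1; have a2 : - `|M2| <= M2 by have := ler_norm (- M2); rewrite normrN; lra.
have n1 : 0 <= `|M1| by []. have n2 : 0 <= `|M2| by [].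
rewrite /outward_drift /outward; case: (leP 0 x) => x_0.
  rewrite (ger0_norm x_0) in xM *; apply: hM1 => //; lra.
have xx : x0 <= `|x| by lra.
have h := integrable_jump alpha1 alpha_beta c0 mJ tailJ negJ (Jout Xx xx).
have ht : (P x).-integrable [set: Omega] (EFin \o theta xi).
  have := integrableN h; congr (integrable _ _ _).
  by apply/funext => w; rewrite /= /outward leNgt x_0/= opprK.
have -> : \int[P x]_w - theta xi w = - drift P xi x.
  transitivity (\int[P x]_w ((-1) * theta xi w)).
    by apply: eq_Rintegral => w _; rewrite mulN1r.
  by rewrite RintegralZl// mulN1r.
rewrite mulrN; apply: hM2 => //.
by rewrite (ltr0_norm x_0) in xM; lra.
Qed.

Lemma outward_drift_bound : exists C M : R, [/\ 0 <= C, 0 < M &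
  forall x, X x -> M <= `|x| -> `|outward_drift x| <= C * `|x| `^ (- gamma)].
Proof.
have [M M0 hM] := outward_drift_cvg ltr01.
exists (`|b| + 1), M; split => // x Xx xM.
have x_0 : 0 < `|x| by exact: lt_le_trans xM.
rewrite powRN ler_pdivlMr ?powR_gt0// -[X in _ * X]ger0_norm ?powR_ge0// -normrM mulrC.
rewrite -lerBlDl; apply: le_trans (hM _ Xx xM); exact: lerB_dist.
Qed.

Lemma kernel_tail : exists2 Y : R, 0 < Y & forall y : R, Y <= y ->
  forall x, X x -> x0 <= `|x| -> ((c / 2 * y `^ (- alpha))%:E <= K x (outside y))%E.
Proof.
have [Y Y0 hY] := tail_lower c0 mJ tailJ; exists Y => // y Yy x Xx xx.
apply: (le_trans (hY _ Yy _ _ (Jout Xx xx))).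
have mS := measurable_gt_posp mJ y (Jout Xx xx).
have mo := measurable_outside y.
rewrite (_ : P x _ = \int[P x]_w (\1_[set w | (y < posp (outward x w))%R] w)%:E)%E; last first.
  by rewrite integral_indic// setIT.
rewrite (_ : K x _ = \int[K x]_z (\1_(outside y) z)%:E)%E; last first.
  by rewrite integral_indic// setIT.
rewrite kernel_norm//; last 2 first.
- by apply/measurable_EFinP; exact: measurable_indic.
- by move=> z; rewrite !indicE; congr ((nat_of_bool _)%:R%:E); apply/idP/idP; rewrite !inE /outside/= normr_id.
apply: ge0_le_integral => //.
- by apply/measurable_EFinP; exact: measurable_indic.
- apply/measurable_EFinP; apply: (measurableT_comp (measurable_indic mo)).
  by apply: measurable_funD => //; exact: (mJ (Jout Xx xx)).
- move=> w _; rewrite lee_fin !indicE.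
  case: (boolP (w \in _)) => [|_]; last by [].
  rewrite inE => /= h; rewrite mem_set// /outside/= (lt_le_trans h)// pospE ge_max normr_ge0 andbT.
  by rewrite (le_trans _ (ler_norm _))// lerDr.
Qed.

Definition scale : R := Num.min alpha (1 + gamma).

Definition rate (nu : R) : R :=
  (if 1 + gamma <= alpha then b else 0)
  - (if alpha <= 1 + gamma then c * critical_fun alpha nu else 0).

(** With k = [scale], the mean jump enters at order |x|^(nu - 1 - gamma) and the Taylor remainder at
    order |x|^(nu - alpha). Both 1 + gamma - k and alpha - k are non-negative and at least one is 0:
    the terms with exponent 0 form [rate], any other goes into the error. *)
Lemma power_drift (nu eps : R) : 0 < nu -> nu < alpha -> 0 < eps ->
  exists2 X0 : R, 0 < X0 & forall x, X x -> X0 <= `|x| -> exists2 m : R,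
    (\int[K x]_y (`|y| `^ nu)%:E = m%:E)%E &
    `|m - (`|x| `^ nu + nu * rate nu * `|x| `^ (nu - scale))| <= eps * `|x| `^ (nu - scale).
Proof.
move=> n0 na e0; have a1 := alpha1; have := g0.
pose k := scale; have e4 : 0 < eps / 4 by rewrite divr_gt0.
have ka : k <= alpha by rewrite ge_min lexx.
have kg : k <= 1 + gamma by rewrite ge_min lexx orbT.
have e1 : 0 < eps / (4 * nu) by rewrite divr_gt0// mulr_gt0.
have [M1 M10 h1] := outward_drift_cvg e1.
have [X1 X10 h2] := drift_power alpha1 alpha2 alpha_beta c0 mJ tailJ negJ n0 na e4.
pose A := nu * (nu - 1) * (c / (alpha - 1) * Beta (2 - alpha) (alpha - nu)).
have AE : A = - (nu * (c * critical_fun alpha nu)).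
  by rewrite /A /critical_fun; field; lra.
(* Treats a vanishing and a surviving term at once. The four errors (expansion, drift, and these two
   terms) get eps / 4 each. *)
have small (B s : R) : 0 < s \/ s = 0 -> exists2 X0, 1 <= X0 &
    forall x, X0 <= x -> `|B * x `^ (- s) - (if s == 0 then B else 0)| <= eps / 4.
  case=> [s0|->].
    have [X0 X00 hX] := powRN_small (normr_ge0 B) e4 s0.
    exists X0 => // x xX; rewrite gt_eqF// subr0 normrM (ger0_norm (powR_ge0 _ _)).
    exact: hX.
  exists 1 => // x _; rewrite eqxx oppr0 powRr0 mulr1 subrr normr0; exact: ltW.
have [|X2 X21 h3] := small (nu * b) (1 + gamma - k).
  by have [|] := eqVneq (1 + gamma - k) 0; [right|left; rewrite lt_neqAle eq_sym; apply/andP; split=> //; lra].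
have [|X3 X31 h4] := small A (alpha - k).
  by have [|] := eqVneq (alpha - k) 0; [right|left; rewrite lt_neqAle eq_sym; apply/andP; split=> //; lra].
exists (x0 + M1 + X1 + X2 + X3); first by have := x00; lra.
move=> x Xx xX; have xx0 := x00.
have [y1 y2 y3 y4] : [/\ x0 <= `|x|, M1 <= `|x|, X1 <= `|x| & X2 <= `|x|].
  by split; lra.
have y5 : X3 <= `|x| by lra.
have y1' : 1 <= `|x| by lra.
have := h3 _ y4; have := h4 _ y5; have := h1 _ Xx y2.
have [i2 hd] := h2 _ y3 _ _ (Jout Xx y1).
move: hd y1'; rewrite -/A -/(outward_drift x).
move: (outward_drift x) => D; set y := `|x|.
set m := Rintegral _ _ _ => hd y1' hD hA hB.
have y0 : 0 < y by lra.
exists m.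
  rewrite kernel_norm//; last 2 first.
  - by apply/measurable_EFinP; mfun.
  - by move=> z; rewrite normr_id.
  by rewrite /m /Rintegral fineK//; exact: integrable_fin_num i2.
have rE : nu * rate nu = (if 1 + gamma - k == 0 then nu * b else 0) +
    (if alpha - k == 0 then A else 0).
  rewrite /rate AE subr_eq0 subr_eq0 /k /scale minEle.
  have [ag|ga] := leP alpha (1 + gamma); rewrite ?eqxx.
    rewrite (_ : (1 + gamma <= alpha) = (1 + gamma == alpha)).
      by case: ifP => _; ring.
    by rewrite eq_le ag andbT.
  by rewrite (ltW ga) gt_eqF//; ring.
have yk : 0 < y `^ (nu - k) by exact: powR_gt0.
have E1 : y `^ (nu - alpha) = y `^ (- (alpha - k)) * y `^ (nu - k).
  by rewrite -(@powRDp _ y _ _ y0); congr powR; ring.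
have E2 : y `^ (nu - 1) = y `^ (- (1 + gamma - k)) * y `^ (nu - k) * y `^ gamma.
  by rewrite -!(@powRDp _ y _ _ y0); congr powR; ring.
have p1 s : 0 <= s -> y `^ (- s) <= 1.
  by move=> s0; rewrite powRN invf_le1 ?powR_gt0// -[leLHS](powRr0 y) ler_powR.
have q1 := p1 (alpha - k) ltac:(lra).
have q2 := p1 (1 + gamma - k) ltac:(lra).
move: hd; rewrite E1 E2 rE -/k.
have -> : nu * (y `^ (- (1 + gamma - k)) * y `^ (nu - k) * y `^ gamma) * D =
   (nu * b * y `^ (- (1 + gamma - k)) + nu * y `^ (- (1 + gamma - k)) * (y `^ gamma * D - b))
   * y `^ (nu - k) by ring.
rewrite (mulrA A).
move: hA hB hD q1 q2 (powR_ge0 y (- (1 + gamma - k))) (powR_ge0 y (- (alpha - k))).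
set u := y `^ _; set v := y `^ (- _).
set U := A * u; set V := nu * b * v; set tB := (if _ == _ then nu * b else 0).
set tA := (if _ == _ then A else 0); set t := y `^ (nu - k) in yk *.
set del := y `^ gamma * D - b.
move=> hA hB hD u1 v1 v0 u0 hd.
have hdel : `|nu * v * del| <= eps / 4.
  rewrite !normrM (gtr0_norm n0) (ger0_norm v0).
  apply: (@le_trans _ _ (nu * 1 * (eps / (4 * nu)))).
    apply: ler_pM => //; first by rewrite mulr_ge0// ltW.
    by rewrite ler_pM2l.
  by rewrite le_eqVlt; apply/orP; left; apply/eqP; field; lra.
have hm : `|m - (y `^ nu + (V + nu * v * del + U) * t)| <= eps / 4 * t.
  apply: le_trans (_ : eps / 4 * (u * t) <= _).
    by move: hd; congr (`|_| <= _); ring.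
  by rewrite mulrCA ler_piMl// mulr_ge0// ltW.
have -> : m - (y `^ nu + (tB + tA) * t) = (m - (y `^ nu + (V + nu * v * del + U) * t)) +
    ((V - tB) + nu * v * del + (U - tA)) * t by ring.
apply: (le_trans (ler_normD _ _)); rewrite normrM (gtr0_norm yk).
have : `|V - tB + nu * v * del + (U - tA)| <= eps / 4 + eps / 4 + eps / 4.
  apply: (le_trans (ler_normD _ _)); apply: lerD => //.
  by apply: (le_trans (ler_normD _ _)); apply: lerD.
by move=> h; apply: (le_trans (lerD hm (ler_wpM2r (ltW yk) h))); lra.
Qed.

(** [weight r] vanishes at the start and is 1 inside radius a <= r. One step raises its mean by at
    most C r^(- s): s < alpha controls the jump term and s <= 1 + gamma the drift term, of order
    r^(-1 - gamma). With delta = 1 / (2 C), n steps add at most 1/2. *)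
Lemma escape (s : R) : 1 <= s -> s < alpha -> s <= 1 + gamma ->
  exists r0 delta : R, [/\ 0 < r0, 0 < delta & forall a r : R, r0 <= r -> a <= r ->
    forall n : nat, n%:R <= delta * r `^ s -> forall y, X y -> 2 * r <= `|y| ->
    ((1 / 2)%:E <= surv K (outside a) n y)%E].
Proof.
move=> s1 sa sg.
have [C1 [M [C10 M0 hM]]] := outward_drift_bound.
have [C2 C20 hC2] := weight_drift alpha1 alpha2 alpha_beta c0 mJ tailJ negJ s1 sa.
pose C := 2 * C1 + C2 + 1.
have CC : 0 < C by rewrite /C; lra.
exists (x0 + M + 1), (1 / (2 * C)); split; [by have := x00; lra|by rewrite divr_gt0// mulr_gt0|].
move=> a r r0r ar n nr y Xy ry.
have xx0 := x00; have r1 : 1 <= r by lra. have r0 : 0 < r by lra.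
have [mX [_ [KX _]]] := chain.
have mB := measurable_outside a.
have rs : 0 < r `^ s by exact: powR_gt0.
have e0 : 0 <= C * r `^ (- s) by rewrite mulr_ge0 ?powR_ge0// ltW.
have wN x : X x -> ~ outside a x -> 1 <= weight r x.
  move=> _ /negP; rewrite -leNgt => xa.
  by rewrite weight_in// (le_trans xa).
have wK x : X x -> outside a x ->
    (\int[K x]_y (weight r y)%:E <= (weight r x + C * r `^ (- s))%:E)%E.
  move=> Xx ax; rewrite kernel_norm//; last 3 first.
  - by apply/measurable_EFinP; exact: measurable_weight.
  - by move=> z; rewrite lee_fin weight_ge0.
  - by move=> z; rewrite weight_norm.
  (* Within radius r the weight already has its maximal value 1, so its mean cannot increase. *)
  have [xr|rx] := leP `|x| r.
    apply: (@le_trans _ _ (\int[P x]_w 1)%E).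
      apply: ge0_le_integral => //.
      * by move=> w _; rewrite lee_fin weight_ge0.
      * apply/measurable_EFinP; apply: (measurableT_comp (measurable_weight r)).
        apply: measurable_funD => //; rewrite /outward; have mt := measurable_theta chain.
        case: (0 <= x) => //; exact: (measurableT_comp (@oppr_measurable R setT) mt).
      * by move=> w _; rewrite lee_fin ge_min lexx.
    rewrite integral_cst// mul1e [X in (X <= _)%E]probability_setT.
    by rewrite lee_fin weight_in// lerDl mulr_ge0 ?powR_ge0// ltW.
  have x0x : x0 <= `|x| by lra.
  have Mx : M <= `|x| by lra.
  apply: (le_trans (hC2 _ _ r0 (ltW rx) _ _ (Jout Xx x0x))).
  rewrite lee_fin -addrA weight_norm lerD2l /C.
  have -> : (2 * C1 + C2 + 1) * r `^ (- s) = 2 * C1 * r `^ (- s) + C2 * r `^ (- s) + r `^ (- s) by ring.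
  have dr : `|\int[P x]_w outward x w| <= C1 * r `^ (- gamma).
    apply: (le_trans (hM _ Xx Mx)); rewrite ler_wpM2l// !powRN lef_pV2 ?posrE ?powR_gt0//; last by lra.
    by apply: ge0_ler_powR; rewrite ?nnegrE ?g0 ?(ltW r0) ?(ltW rx).
  have h : 2 / r * `|\int[P x]_w outward x w| <= 2 * C1 * r `^ (- s).
    apply: (@le_trans _ _ (2 / r * (C1 * r `^ (- gamma)))).
      by rewrite ler_wpM2l// divr_ge0// ltW.
    rewrite (_ : 2 / r * _ = 2 * C1 * (r `^ (-1) * r `^ (- gamma))); last first.
      by rewrite powR_inv1 ?(ltW r0)//; ring.
    rewrite -powRDp// ler_wpM2l ?mulr_ge0//.
    by apply: ler_powR => //; lra.
  have := powR_ge0 r (- s); lra.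
have := surv_lower_additive mX KX mB (measurable_weight r) (weight_ge0 r) e0 wN wK n Xy.
rewrite weight_out// add0r.
have h : n%:R * (C * r `^ (- s)) <= 1 / 2.
  rewrite mulrCA powRN -ler_pdivlMl// ler_pdivrMr//.
  by apply: (le_trans nr); rewrite le_eqVlt; apply/orP; left; apply/eqP; field; lra.
have := surv_ge0 K (outside a) n y.
case: (surv _ _ _ _) => [u|_ _|//]; last by rewrite leey.
by rewrite -EFinD !lee_fin => _; lra.
Qed.

End OutwardJumps.

(** * Tails of the hitting time *)

Lemma leq_triple_half n : (1 < n)%N -> (n <= 3 * n./2)%N.
Proof. by lia. Qed.

Section SurvivalTails.
Context {R : realType} {d : measure_display} {Omega : measurableType d}.
Variables (X : set R) (K : R.-pker R ~> R) (P : R -> probability Omega R)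
  (xi : nat -> Omega -> R) (alpha beta c x0 gamma b : R).
Hypothesis chain : is_markov_chain X K P xi.
Hypothesis tout : Tout X P xi alpha beta c x0.
Hypothesis dprime : Dprime X P xi gamma b.

Let alpha1 : 1 < alpha. Proof. by case: tout => /andP[]. Qed.
Let alpha2 : alpha < 2. Proof. by case: tout => /andP[]. Qed.
Let c0 : 0 < c. Proof. by case: tout => _ [_ []]. Qed.
Let x00 : 0 <= x0. Proof. by case: tout => _ [_ [_ []]]. Qed.
Let g0 : 0 <= gamma. Proof. by case: dprime. Qed.
Let mX : measurable X. Proof. by case: chain. Qed.
Let KX x : X x -> K x X = 1%E. Proof. by case: chain => _ [_ [h _]]; exact: h. Qed.

Local Notation k := (scale alpha gamma).
Local Notation rho := (rate alpha c gamma b).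

Let k1 : 1 <= k.
Proof. by have a1 := alpha1; have g := g0; rewrite le_min; apply/andP; split; lra. Qed.

Let mpow (nu : R) : measurable_fun [set: R] (fun y : R => `|y| `^ nu).
Proof.
apply: (measurableT_comp (measurable_powR nu)).
exact: (@normr_measurable R setT).
Qed.

Let maffine (k0 l nu : R) : measurable_fun [set: R] (fun y : R => k0 + l * `|y| `^ nu).
Proof. by apply: measurable_funD => //; apply: measurable_funM. Qed.

Let kernel_affine (k0 l m nu x : R) : 0 <= k0 -> 0 <= l ->
  (\int[K x]_y (`|y| `^ nu)%:E = m%:E)%E ->
  (\int[K x]_y (k0 + l * `|y| `^ nu)%:E = (k0 + l * m)%:E)%E.
Proof.
move=> k00 l0 E; under eq_integral do rewrite EFinD EFinM.
have mp : measurable_fun [set: R] (fun y : R => (`|y| `^ nu)%:E).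
  by apply/measurable_EFinP; mfun.
rewrite ge0_integralD//.
- by rewrite kernel_cst ge0_integralZl_EFin// E.
- by move=> y _; rewrite mule_ge0 ?lee_fin ?powR_ge0.
- by apply: measurable_funeM.
Qed.

(** Since nu <= k the drift of |y|^nu may fade as |y| grows, so a multiple of |y|^nu gains one unit
    per step only up to a radius r. [surv_upper] needs no drift where this multiple is at least n,
    and r is chosen to be the radius where it reaches n. *)
Lemma upper_tail (nu : R) : 0 < nu -> nu < alpha -> nu <= k -> rho nu < 0 ->
  exists a0 e : R, 0 < e /\ forall a, a0 <= a -> forall n x, (0 < n)%N -> X x ->
  (surv K (outside a) n x <= ((e * n%:R) `^ (- nu / k) * `|x| `^ nu)%:E)%E.
Proof.
move=> n0 na nk rn; have kk := k1; have k0 : 0 < k by lra.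
pose e := - (nu * rho nu) / 2.
have e0 : 0 < e by rewrite divr_gt0// oppr_gt0 pmulr_rlt0.
have [a0 a00 ha] := power_drift chain tout dprime n0 na e0.
exists a0, e; split => // a a0a n x n_gt0 Xx.
pose N := e * n%:R.
have nr0 : 0 < n%:R :> R by rewrite ltr0n.
have N0 : 0 < N by rewrite mulr_gt0.
(* With r = N^(1/k) this is r^(k - nu) / e. Up to radius r the drift of A |y|^nu is at most -1, and
   beyond r its value is at least A r^nu = N / e = n. *)
pose A := N `^ ((k - nu) / k) / e.
have A0 : 0 <= A by rewrite divr_ge0 ?powR_ge0// ltW.
pose r := N `^ k^-1; have r0 : 0 < r by rewrite powR_gt0.
have AE : A = r `^ (k - nu) / e by rewrite /A /r -powRrM [k^-1 * _]mulrC.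
have mf := maffine 0 A nu.
have f0 (y : R) : 0 <= 0 + A * `|y| `^ nu by rewrite add0r mulr_ge0 ?powR_ge0.
have hm y : X y -> outside a y -> (surv K (outside a) 0 y <= (cst 1 y)%:E)%E.
  by move=> _ _; apply: surv_le1; exact: measurable_outside.
have hf y : X y -> outside a y ->
    ((cst 1 y)%:E + \int[K y]_z (0 + A * `|z| `^ nu)%:E <= (0 + A * `|y| `^ nu)%:E)%E \/
    n%:R <= 0 + A * `|y| `^ nu.
  move=> Xy ay; have ay' : a0 <= `|y| by apply: (le_trans a0a); exact: ltW.
  have y0 : 0 < `|y| by exact: lt_le_trans ay'.
  have [m mE hmb] := ha _ Xy ay'; rewrite !add0r.
  have [yr|ry] := leP `|y| r; [left|right].
    rewrite (kernel_affine _ A0 mE)// -EFinD lee_fin add0r /=.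
    have mle : m <= `|y| `^ nu - e * `|y| `^ (nu - k).
      by move: hmb; rewrite ler_norml => /andP[_]; rewrite /e; lra.
    apply: (@le_trans _ _ (1 + A * (`|y| `^ nu - e * `|y| `^ (nu - k)))).
      by rewrite lerD2l ler_wpM2l.
    suff : 1 <= A * e * `|y| `^ (nu - k) by lra.
    rewrite AE divfK ?gt_eqF// -(opprB k nu) powRN ler_pdivlMr ?powR_gt0// mul1r.
    by apply: ge0_ler_powR; rewrite ?nnegrE ?subr_ge0 ?(ltW r0).
  apply: (@le_trans _ _ (A * r `^ nu)); last first.
    by rewrite ler_wpM2l//; apply: ge0_ler_powR; rewrite ?nnegrE ?(ltW n0) ?(ltW r0) ?(ltW ry).
  rewrite AE mulrAC -powRDp// subrK /r -powRrM mulVf ?gt_eqF// powRr1 ?(ltW N0)//.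
  by rewrite /N mulrAC divff ?gt_eqF// mul1r.
have mB := measurable_outside a.
have := surv_upper mX KX mB mf f0 hm hf Xx; rewrite addn0 add0r.
have := surv_ge0 K (outside a) n x; have := surv_le1 K mB n x.
case: (surv _ _ _ _) => [u| |]//; rewrite -EFinM !lee_fin => _ _ h.
have NE : N `^ (- nu / k) = A / n%:R.
  have -> : - nu / k = (k - nu) / k - 1 by field; rewrite gt_eqF.
  rewrite powRDp// powRN powRr1 ?(ltW N0)// /A /N; field.
  by rewrite !gt_eqF.
by rewrite NE mulrAC ler_pdivlMr// mulrC.
Qed.

(* The bound surv n <= |x|^k / (e n), weakened to its power p - 1, is fed back into surv_upper
   with f a multiple of |x|^(p k). *)
Lemma upper_tail_light (p : R) : 1 < p -> p < 2 -> p * k < alpha ->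
  rho k < 0 -> rho (p * k) < 0 ->
  exists a0 C : R, 0 <= C /\ forall a, a0 <= a -> forall n x, (0 < n)%N -> X x -> a < `|x| ->
  (surv K (outside a) n x <= (C * `|x| `^ (p * k) * n%:R `^ (- p))%:E)%E.
Proof.
move=> p1 p2 pka rk rpk; have kk := k1; have k0 : 0 < k by lra.
have pk0 : 0 < p * k by rewrite mulr_gt0//; lra.
have kpk : k < p * k by rewrite ltr_pMl.
have [a1 [e [e0 h1]]] := upper_tail k0 (lt_trans kpk pka) (lexx _) rk.
pose e' := - (p * k * rho (p * k)) / 2.
have e'0 : 0 < e' by rewrite divr_gt0// oppr_gt0 pmulr_rlt0.
have [a2 a20 h2] := power_drift chain tout dprime pk0 pka e'0.
pose C := e `^ (1 - p) / e'.
have C0 : 0 <= C by rewrite divr_ge0 ?powR_ge0// ltW.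
exists (Num.max a1 (Num.max a2 1)), (1 + 3 `^ p * C); split.
  by rewrite addr_ge0// mulr_ge0 ?powR_ge0.
move=> a; rewrite !ge_max => /and3P[a1a a2a aone].
have mB := measurable_outside a.
have even n x : (0 < n)%N -> X x ->
    (surv K (outside a) (n + n) x <= (C * `|x| `^ (p * k) * n%:R `^ (- p))%:E)%E.
  move=> n_gt0 Xx; have nr0 : 0 < n%:R :> R by rewrite ltr0n.
  have N0 : 0 < e * n%:R by rewrite mulr_gt0.
  pose A := (e * n%:R) `^ (1 - p) / e'.
  have A0 : 0 <= A by rewrite divr_ge0 ?powR_ge0// ltW.
  pose h (y : R) := (e * n%:R) `^ (1 - p) * `|y| `^ (k * (p - 1)).
  have mf := maffine 0 A ((p * k)).
  have f0 (y : R) : 0 <= 0 + A * `|y| `^ (p * k) by rewrite add0r mulr_ge0 ?powR_ge0.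
  have hh y : X y -> outside a y -> (surv K (outside a) n y <= (h y)%:E)%E.
    move=> Xy ay; have y0 : 0 < `|y| by rewrite (lt_trans _ ay)//; lra.
    have := h1 _ a1a n y n_gt0 Xy; rewrite mulNr divff ?gt_eqF//.
    have := surv_le1 K mB n y; have := surv_ge0 K (outside a) n y.
    set u := _ * `|y| `^ k.
    have u0 : 0 < u by rewrite mulr_gt0 ?powR_gt0.
    have hu : h y = u `^ (p - 1).
      rewrite /h /u (powRM _ (powR_ge0 _ _) (powR_ge0 _ _)) -!powRrM mulN1r.
      by congr (powR _ _ * _); ring.
    case: (surv _ _ _ _) => [v| |]//; rewrite !lee_fin hu => v0 v1 vu.
    (* The survival probability is at most min(1, u), hence at most u^(p - 1) because 0 < p - 1 < 1.
       This power is the one that makes [h] proportional to the drift of |y|^(p k). *)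
    have [u1|u1] := leP u 1.
      apply: (le_trans vu); rewrite -[leLHS]powRr1 ?(ltW u0)//.
      by apply: ger_powR; rewrite ?u0//; lra.
    apply: (le_trans v1); rewrite -[leLHS](powRr0 u).
    by apply: ler_powR; [exact: ltW|lra].
  have hf y : X y -> outside a y ->
      ((h y)%:E + \int[K y]_z (0 + A * `|z| `^ (p * k))%:E <= (0 + A * `|y| `^ (p * k))%:E)%E \/
      n%:R <= 0 + A * `|y| `^ (p * k).
    move=> Xy ay; left; have ay' : a2 <= `|y| by apply: (le_trans a2a); exact: ltW.
    have [m mE hmb] := h2 _ Xy ay'.
    rewrite (kernel_affine _ A0 mE)// -EFinD lee_fin !add0r.
    have mle : m <= `|y| `^ (p * k) - e' * `|y| `^ (p * k - k).
      by move: hmb; rewrite ler_norml => /andP[_]; rewrite /e'; lra.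
    apply: (@le_trans _ _ (h y + A * (`|y| `^ (p * k) - e' * `|y| `^ (p * k - k)))).
      by rewrite lerD2l ler_wpM2l.
    have -> : h y = A * e' * `|y| `^ (p * k - k).
      rewrite /h /A divfK ?gt_eqF//; congr (_ * _); congr powR; ring.
    by rewrite le_eqVlt; apply/orP; left; apply/eqP; ring.
  have := surv_upper mX KX mB mf f0 hh hf Xx; rewrite add0r.
  have := surv_ge0 K (outside a) (n + n) x; have := surv_le1 K mB (n + n) x.
  case: (surv _ _ _ _) => [u| |]//; rewrite -EFinM !lee_fin => _ _ hu.
  have -> : C * `|x| `^ (p * k) * n%:R `^ (- p) = A * `|x| `^ (p * k) / n%:R.
    have np : n%:R `^ (- p) = n%:R `^ (1 - p) / n%:R :> R.
      by rewrite -(powR_inv1 (ltW nr0)) -powRDp//; congr powR; ring.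
    by rewrite np /C /A powRM ?(ltW e0) ?(ltW nr0)//; ring.
  by rewrite ler_pdivlMr// mulrC.
move=> n x n_gt0 Xx ax.
have x1 : 1 <= `|x| by rewrite (le_trans aone)// ltW.
have xp : 1 <= `|x| `^ (p * k).
  by rewrite -[leLHS](powRr0 `|x|); apply: ler_powR => //; exact: ltW.
have x3 : 1 <= 3 `^ p :> R by rewrite -[leLHS](powRr0 3); apply: ler_powR; lra.
have nr0 : 0 < n%:R :> R by rewrite ltr0n.
have [n1|n1] := leqP n 1.
  have -> : n = 1%N by apply/eqP; rewrite eqn_leq n1.
  apply: (le_trans (surv_le1 K mB _ _)); rewrite lee_fin powR1 mulr1.
  rewrite -[leLHS]mulr1; apply: ler_pM => //.
  by rewrite lerDl mulr_ge0 ?powR_ge0.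
(* [even] controls 2h steps with 2h <= n. Returning from h to n costs the factor 3^p, as n <= 3h for
   n >= 2; the case n = 1 was treated apart because there h = 0. *)
pose h := n./2; have h0 : (0 < h)%N by rewrite half_gt0.
have nh : (n <= 3 * h)%N by exact: leq_triple_half.
have hn : (h + h <= n)%N by rewrite addnn -[leqRHS]odd_double_half leq_addl.
apply: (le_trans (surv_mono K mB x hn)); apply: (le_trans (even _ _ h0 Xx)).
rewrite lee_fin mulrAC [leRHS]mulrAC ler_wpM2r ?powR_ge0//.
apply: (@le_trans _ _ (3 `^ p * C * n%:R `^ (- p))); last first.
  by rewrite ler_wpM2r ?powR_ge0// lerDr.
rewrite -mulrA mulrCA ler_wpM2l// !powRN.
rewrite -[X in X / _]invrK -invfM lef_pV2 ?posrE ?divr_gt0 ?mulr_gt0 ?invr_gt0 ?powR_gt0 ?ltr0n//.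
rewrite ler_pdivrMl ?powR_gt0// -powRM//.
apply: ge0_ler_powR; rewrite ?nnegrE ?mulr_ge0//; first lra.
by rewrite -natrM ler_nat.
Qed.

(* The survival bound obtained by comparing |.|^nu with the function
   a^nu + eta r^(nu-nu')|.|^nu' up to the first exit from (a, 2r]. *)
Let lower_tail_at (nu : R) : 0 < nu -> nu < alpha -> 0 < rho nu -> alpha <= 1 + gamma ->
  forall s, 1 <= s -> s < alpha ->
  exists a0 eta g C r0 delta : R, [/\ 0 < eta, 0 < g, 0 < C, 0 < r0 & 0 < delta /\
    forall a r, a0 <= a -> a <= r -> r0 <= r -> forall n : nat, n%:R <= delta * r `^ s ->
    forall x, X x -> ((`|x| `^ nu)%:E <= (C * r `^ nu)%:E * surv K (outside a) n x
       + (a `^ nu + eta * r `^ (- g) * `|x| `^ (nu + g))%:E)%E].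
Proof.
move=> n0 na rn ag s s1 sa.
have kE : k = alpha by rewrite /k /scale min_l.
(* The perturbing exponent nu + g is halfway between nu and alpha; g < 1 is used below for (2 r)^g
   <= 2 r^g. *)
pose g := (alpha - nu) / 2; have gp : 0 < g by rewrite divr_gt0// subr_gt0.
have g1 : g < 1 by rewrite /g; have := alpha2; lra.
have na' : nu + g < alpha by rewrite /g; lra.
have n0' : 0 < nu + g by rewrite addr_gt0.
pose e := nu * rho nu / 2; have e0 : 0 < e by rewrite divr_gt0// mulr_gt0.
pose M := `|(nu + g) * rho (nu + g)| + 1.
have M0 : 0 < M by rewrite ltr_pwDr.
have [X1 X10 h1] := power_drift chain tout dprime n0 na e0.
have [X2 X20 h2] := power_drift chain tout dprime n0' na' ltr01.
have sg : s <= 1 + gamma by rewrite (le_trans (ltW sa)).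
have [r0 [delta [r00 d0 hesc]]] := escape chain tout dprime s1 sa sg.
(* For |y| <= 2r the perturbation changes the drift by at most eta r^(- g) M |y|^(nu + g - alpha),
   which is then at most the gain e |y|^(nu - alpha). *)
pose eta := e / (2 * M).
have eta0 : 0 < eta by rewrite divr_gt0// mulr_gt0.
(* C / 2 is the constant in [young]; the factor 2 makes up for the survival probability 1/2 given by
   [escape] beyond 2r. *)
pose C := 2 * eta `^ (- nu / g).
have C0 : 0 < C by rewrite mulr_gt0// powR_gt0.
exists (X1 + X2), eta, g, C, r0, delta; split => //; split => // a r a0a ar r0r n nr x Xx.
have rp : 0 < r by exact: lt_le_trans r0r.
have ap : 0 <= a by lra.
pose l := eta * r `^ (- g).
have l0 : 0 <= l by rewrite mulr_ge0 ?powR_ge0// ltW.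
have mB := measurable_outside a.
have an0 : 0 <= a `^ nu by exact: powR_ge0.
have D0 (y : R) : 0 <= a `^ nu + l * `|y| `^ (nu + g).
  by rewrite addr_ge0// mulr_ge0 ?powR_ge0.
have A0 (y : R) : 0 <= `|y| `^ nu by exact: powR_ge0.
have Cr0 : 0 <= C * r `^ nu by rewrite mulr_ge0 ?powR_ge0// ltW.
have off (y : R) : X y -> ~ outside a y -> `|y| `^ nu <= a `^ nu + l * `|y| `^ (nu + g).
  move=> _ /negP; rewrite -leNgt => ya.
  apply: (@le_trans _ _ (a `^ nu)); last by rewrite lerDl mulr_ge0 ?powR_ge0.
  by apply: ge0_ler_powR; rewrite ?nnegrE ?(ltW n0).
have young (y : R) : 0 < `|y| -> `|y| `^ nu <= C / 2 * r `^ nu + l * `|y| `^ (nu + g).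
  move=> y0.
  pose t := `|y| / r; have t0 : 0 < t by rewrite divr_gt0.
  have yE : `|y| = t * r by rewrite /t divfK ?gt_eqF.
  have tp u : `|y| `^ u = t `^ u * r `^ u by rewrite yE powRM ?ltW.
  rewrite !tp /l /C (mulrC 2) mulfK//.
  have -> : eta * r `^ (- g) * (t `^ (nu + g) * r `^ (nu + g)) =
     eta * t `^ (nu + g) * r `^ nu.
    have -> : r `^ nu = r `^ (- g) * r `^ (nu + g).
      by rewrite -powRDp//; congr powR; ring.
    by ring.
  rewrite -mulrDl ler_wpM2r ?powR_ge0//.
  (* At t = eta^(-1/g) one has eta t^g = 1: below it t^nu is at most eta^(- nu / g), above it t^nu
     is at most eta t^(nu + g). *)
  have [te|et] := leP t (eta `^ (- g^-1)).
    apply: (@le_trans _ _ (eta `^ (- nu / g))); last by rewrite lerDl mulr_ge0 ?powR_ge0 ?(ltW eta0).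
    have -> : - nu / g = - g^-1 * nu by ring.
    by rewrite powRrM; apply: ge0_ler_powR; rewrite ?nnegrE ?powR_ge0 ?(ltW n0) ?(ltW t0).
  apply: (@le_trans _ _ (eta * t `^ (nu + g))); last by rewrite lerDr powR_ge0.
  rewrite (powRDp _ _ t0) mulrCA ler_peMr ?powR_ge0//.
  have -> : 1 = eta * (eta `^ (- g^-1)) `^ g.
    by rewrite -powRrM mulNr mulVf ?gt_eqF// powR_inv1 ?(ltW eta0)// divff ?gt_eqF.
  by rewrite ler_pM2l//; apply: ge0_ler_powR; rewrite ?nnegrE ?powR_ge0 ?(ltW gp) ?(ltW t0) ?(ltW et).
have main (y : R) : X y -> outside a y ->
   ((\int[K y]_z (a `^ nu + l * `|z| `^ (nu + g))%:E < +oo)%E /\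
     ((`|y| `^ nu)%:E + \int[K y]_z (a `^ nu + l * `|z| `^ (nu + g))%:E <=
      (a `^ nu + l * `|y| `^ (nu + g))%:E + \int[K y]_z (`|z| `^ nu)%:E)%E) \/
   (forall m, (m <= n)%N -> ((`|y| `^ nu)%:E <= (C * r `^ nu)%:E * surv K (outside a) m y +
      (a `^ nu + l * `|y| `^ (nu + g))%:E)%E).
  move=> Xy ay; have y1 : X1 <= `|y| by rewrite /outside/= in ay; lra.
  have y2 : X2 <= `|y| by rewrite /outside/= in ay; lra.
  have y0 : 0 < `|y| by lra.
  have [yr|ry] := leP `|y| (2 * r); [left|right].
    have [m1 E1 b1] := h1 _ Xy y1; have [m2 E2 b2] := h2 _ Xy y2.
    rewrite (kernel_affine an0 l0 E2) E1; split; first exact: ltry.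
    rewrite -!EFinD lee_fin.
    move: b1 b2; rewrite kE !ler_norml => /andP[b1 _] /andP[_ b2].
    have b1' : `|y| `^ nu + e * `|y| `^ (nu - alpha) <= m1.
      by move: b1; rewrite (_ : nu * rho nu = e + e) ?mulrDl; [lra|rewrite /e; lra].
    have b2' : m2 <= `|y| `^ (nu + g) + M * `|y| `^ (nu + g - alpha).
      have : (nu + g) * rho (nu + g) * `|y| `^ (nu + g - alpha) <= (M - 1) * `|y| `^ (nu + g - alpha).
        by rewrite ler_wpM2r ?powR_ge0// /M addrK ler_norm.
      by rewrite mulrBl; lra.
    have cmp : l * (M * `|y| `^ (nu + g - alpha)) <= e * `|y| `^ (nu - alpha).
      have -> : nu + g - alpha = (nu - alpha) + g by ring.
      rewrite (powRDp _ _ y0) /l /eta powRN.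
      have rg : 0 < r `^ g by rewrite powR_gt0.
      have : `|y| `^ g <= 2 * r `^ g.
        apply: (@le_trans _ _ ((2 * r) `^ g)).
          by apply: ge0_ler_powR; rewrite ?nnegrE ?(ltW gp)// mulr_ge0// ltW.
        rewrite powRM ?(ltW rp)// ler_wpM2r ?(ltW rg)//.
        by rewrite -[leRHS]powRr1//; apply: ler_powR; [lra|exact: ltW].
      have -> : e / (2 * M) / r `^ g * (M * (`|y| `^ (nu - alpha) * `|y| `^ g)) =
         (e * `|y| `^ (nu - alpha)) * (`|y| `^ g / (2 * r `^ g)).
        by field; rewrite !gt_eqF.
      move=> h; rewrite ger_pMr ?mulr_gt0 ?powR_gt0// ler_pdivrMr ?mul1r//.
      by rewrite mulr_gt0.
    have := ler_wpM2l l0 b2'; lra.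
  (* Beyond 2r the drift comparison is replaced by the conclusion itself: the chain survives n steps
     with probability at least 1/2, and [young] bounds |y|^nu. *)
  move=> m mn; have hs : ((1 / 2)%:E <= surv K (outside a) m y)%E.
    apply: (hesc _ _ r0r ar) => //; last exact: ltW.
    by apply: le_trans nr; rewrite ler_nat.
  apply: (@le_trans _ _ ((C * r `^ nu)%:E * (1 / 2)%:E + (a `^ nu + l * `|y| `^ (nu + g))%:E)%E); last first.
    by rewrite leeD2r// lee_wpmul2l// lee_fin.
  rewrite -EFinM -EFinD lee_fin.
  have := young y y0; lra.
have crude (y : R) : X y -> outside a y -> `|y| `^ nu <= C * r `^ nu + (a `^ nu + l * `|y| `^ (nu + g)).
  move=> _ ay; have y0 : 0 < `|y| by rewrite (le_lt_trans ap).
  by have := young y y0; lra.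
exact: (surv_lower_sub mX KX mB (mpow nu) (maffine (a `^ nu) l (nu + g)) A0 D0 Cr0 off crude main (leqnn n) Xx).
Qed.

(** The radius r with delta r^s = n, the least one for which [escape] covers n steps. *)
Let large_radius (delta s r0 : R) : 0 < delta -> 0 < s -> 0 < r0 ->
  exists2 N : nat, (0 < N)%N & forall n : nat, (N <= n)%N ->
    r0 <= (n%:R / delta) `^ s^-1 /\ n%:R <= delta * ((n%:R / delta) `^ s^-1) `^ s.
Proof.
move=> d0 s0 r00.
have dr0 : 0 <= delta * r0 `^ s by rewrite mulr_ge0 ?powR_ge0// ltW.
exists (Num.bound (delta * r0 `^ s)).+1 => // n Nn.
have h : delta * r0 `^ s <= n%:R.
  apply: (le_trans (ltW (archi_boundP dr0))); rewrite ler_nat; exact: ltnW.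
have nd : 0 <= n%:R / delta by rewrite divr_ge0// ltW.
split; last by rewrite -powRrM mulVf ?gt_eqF// powRr1// mulrCA divff ?mulr1// gt_eqF.
have -> : r0 = (r0 `^ s) `^ s^-1 by rewrite -powRrM divff ?gt_eqF// powRr1// ltW.
apply: ge0_ler_powR; rewrite ?nnegrE ?powR_ge0 ?invr_ge0 ?(ltW s0)//.
by rewrite ler_pdivlMr// mulrC.
Qed.

(** The gap t = |x|^nu - a^nu is positive as |x| > a. For large r the perturbation takes at most
    half of it, so the survival probability is at least t / (2 C r^nu), where r is of order
    n^(1/s). *)
Lemma lower_tail (nu s : R) : 0 < nu -> nu < alpha -> 0 < rho nu -> alpha <= 1 + gamma ->
  1 <= s -> s < alpha ->
  exists a0 : R, forall a, a0 <= a -> forall x, X x -> a < `|x| ->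
  exists2 c' : R, 0 < c' & exists N : nat, forall n : nat, (N <= n)%N ->
    ((c' * n%:R `^ (- (nu / s)))%:E <= surv K (outside a) n x)%E.
Proof.
move=> n0 na rn ag s1 sa.
have [a1 [eta [g [C [r0 [delta [eta0 gp C0 r00 [d0 h]]]]]]]] := lower_tail_at n0 na rn ag s1 sa.
exists (Num.max a1 1) => a; rewrite ge_max => /andP[a1a aone] x Xx ax.
have a0 : 0 < a by lra.
have s0 : 0 < s by lra.
pose t := `|x| `^ nu - a `^ nu.
have t0 : 0 < t by rewrite subr_gt0; apply: gt0_ltr_powR; rewrite ?nnegrE ?(ltW a0).
have t20 : 0 < t / 2 by rewrite divr_gt0.
have [|R1 R11 hR1] := @powRN_small _ (eta * `|x| `^ (nu + g)) (t / 2) g _ t20 gp.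
  by rewrite mulr_ge0 ?powR_ge0// ltW.
have [|N N0 hN] := @large_radius delta s (r0 + a + R1) d0 s0; first by lra.
exists (t / 2 / C * delta `^ (nu / s)); first by rewrite mulr_gt0 ?powR_gt0// divr_gt0.
exists N => n Nn; have [rr nr] := hN _ Nn.
move: rr nr; set r := _ `^ s^-1 => rr nr.
have rp : 0 < r by lra.
have := h a r a1a ltac:(lra) ltac:(lra) n nr x Xx.
have := hR1 r ltac:(lra).
have := surv_ge0 K (outside a) n x; have := surv_le1 K (measurable_outside a) n x.
case: (surv _ _ _ _) => [u| |]//; rewrite -EFinM -EFinD !lee_fin => _ u0 h1 h2.
have nr0 : 0 < n%:R :> R by rewrite ltr0n (leq_trans N0).
have rE : r `^ nu = n%:R `^ (nu / s) / delta `^ (nu / s).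
  rewrite /r -powRrM (mulrC s^-1) powRM ?invr_ge0 ?(ltW d0) ?(ltW nr0)//.
  by rewrite -(powR_inv1 (ltW d0)) -powRrM mulN1r powRN.
have rn0 : 0 < r `^ nu by rewrite powR_gt0.
have -> : t / 2 / C * delta `^ (nu / s) * n%:R `^ (- (nu / s)) = t / 2 / (C * r `^ nu).
  by rewrite rE powRN; field; rewrite !gt_eqF ?powR_gt0.
rewrite ler_pdivrMr ?mulr_gt0// [leRHS]mulrC.
have e1 : eta * r `^ (- g) * `|x| `^ (nu + g) = eta * `|x| `^ (nu + g) * r `^ (- g) by ring.
by rewrite /t in h1 *; lra.
Qed.

(** Since 1 + gamma < alpha, [escape] applies with s = 1 + gamma itself. The exponent is therefore
    exact, which yields the boundary case of (iii). *)
Lemma lower_tail_light : 1 + gamma < alpha ->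
  exists a0 : R, forall a, a0 <= a -> forall x, X x -> a < `|x| ->
  exists2 c' : R, 0 < c' & exists N : nat, forall n : nat, (N <= n)%N ->
    ((c' * n%:R `^ (- (alpha / (1 + gamma))))%:E <= surv K (outside a) n x)%E.
Proof.
move=> ga; have g := g0; have s1 : 1 <= 1 + gamma by lra.
have s0 : 0 < 1 + gamma by lra.
have [r0 [delta [r00 d0 hesc]]] := escape chain tout dprime s1 ga (lexx _).
have [Y Y0 hY] := kernel_tail chain tout.
exists (x0 + 1) => a a0a x Xx ax; have xx0 := x00.
have a0 : 0 < a by lra.
have [|N N0 hN] := @large_radius delta (1 + gamma) (r0 + a + Y) d0 s0; first by lra.
pose al := alpha / (1 + gamma).
have cc := c0.
(* c / 2 from [kernel_tail] for the jump beyond 2r, times the probability 1/2 of surviving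
   afterwards; the other two factors come from (2 r)^(- alpha). *)
exists (c / 4 * 2 `^ (- alpha) * delta `^ al); first by rewrite !mulr_gt0 ?powR_gt0 ?divr_gt0.
(* The time is at least 1, and its first step is spent on the jump. *)
exists N => -[|n] Nn; first by have := leq_trans N0 Nn.
have [rr nr] := hN _ Nn; move: rr nr; set r := _ `^ _ => rr nr.
have rp : 0 < r by lra.
have mB := measurable_outside a; have mr := measurable_outside (2 * r).
rewrite survB//.
have tail : ((c / 2 * (2 * r) `^ (- alpha))%:E <= K x (outside (2 * r)))%E.
  by apply: hY => //; lra.
apply: (@le_trans _ _ (\int[K x]_y ((1 / 2)%:E * (\1_(outside (2 * r)) y)%:E))%E); last first.
  apply: (kernel_le_integral mX KX Xx).
  - by apply: measurable_funeM; apply/measurable_EFinP; exact: measurable_indic.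
  - exact: measurable_surv.
  - by move=> y; rewrite mule_ge0 ?lee_fin.
  - by move=> y; exact: surv_ge0.
  - move=> y Xy; have [yr|yr] := pselect (outside (2 * r) y); last first.
      by rewrite indicE memNset// mule0 surv_ge0.
    rewrite indicE mem_set// mule1; apply: (hesc a r) => //; [lra|lra| |].
      by apply: le_trans nr; rewrite ler_nat.
    by rewrite ltW.
rewrite ge0_integralZl_EFin//; last by apply/measurable_EFinP; exact: measurable_indic.
rewrite integral_indic// setIT.
apply: (@le_trans _ _ ((1 / 2)%:E * (c / 2 * (2 * r) `^ (- alpha))%:E)%E); last first.
  by rewrite lee_wpmul2l// lee_fin.
rewrite -EFinM lee_fin powRM ?(ltW rp)//.
have -> : r `^ (- alpha) = delta `^ al * n.+1%:R `^ (- al).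
  rewrite /r -powRrM powRM ?invr_ge0 ?(ltW d0)//.
  rewrite -(powR_inv1 (ltW d0)) -powRrM mulrC; congr (powR _ _ * powR _ _); rewrite /al; field; lra.
by rewrite le_eqVlt; apply/orP; left; apply/eqP; rewrite -/al; field.
Qed.

Local Notation moment a q x := (tau_moment P xi a q x).

(** Strict inequality between q and nus / alpha leaves room for an exponent nu strictly between nus
    and q alpha, on the side of nus where [rho nu] has the sign that is needed. *)
Lemma moment_dichotomy (nus q : R) : alpha <= 1 + gamma -> 0 < nus < alpha -> 0 < q ->
  (forall nu, 0 < nu -> nu < nus -> rho nu < 0) ->
  (forall nu, nus < nu -> nu < alpha -> 0 < rho nu) ->
  exists a0 : R, forall a, a0 <= a -> forall x, X x -> a < `|x| ->
    (q < nus / alpha -> (moment a q x < +oo)%E) /\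
    (nus / alpha < q -> moment a q x = +oo%E).
Proof.
move=> ag /andP[n0 na] q0 neg pos; have a1 := alpha1.
have al0 : 0 < alpha by lra.
have kE : k = alpha by rewrite /scale min_l.
have [qn|nq|qn] := ltgtP q (nus / alpha).
- pose nu := (q * alpha + nus) / 2.
  have qn' : q * alpha < nus by rewrite -ltr_pdivlMr.
  have qa0 : 0 < q * alpha by rewrite mulr_gt0.
  have [nu0 nun] : 0 < nu /\ nu < nus by split; rewrite /nu; lra.
  have [|a0 [e [e0 ha]]] := upper_tail nu0 (lt_trans nun na) _ (neg _ nu0 nun).
    by rewrite kE; lra.
  exists a0 => a aa x Xx ax; split => // _.
  apply: (@tau_moment_lty _ _ _ _ _ _ _ chain a q (nu / alpha) (e `^ (- nu / alpha) * `|x| `^ nu) x) => //.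
  + by rewrite ltr_pdivlMr// /nu; lra.
  + by rewrite mulr_ge0 ?powR_ge0.
  + move=> n n_gt0; apply: (le_trans (ha a aa n x n_gt0 Xx)).
    by rewrite kE lee_fin powRM ?(ltW e0)// mulrAC mulNr.
- pose nu := (nus + Num.min alpha (q * alpha)) / 2.
  have qn' : nus < q * alpha by rewrite -ltr_pdivrMr.
  have nm : nus < Num.min alpha (q * alpha) by rewrite lt_min na.
  have ma : Num.min alpha (q * alpha) <= alpha by rewrite ge_min lexx.
  have mq : Num.min alpha (q * alpha) <= q * alpha by rewrite ge_min lexx orbT.
  have [nun nua nuq] : [/\ nus < nu, nu < alpha & nu < q * alpha] by split; rewrite /nu; lra.
  have nu0 : 0 < nu by lra.
  (* Chosen so that the tail exponent nu / s is at most q; s < alpha because nu < q alpha. *)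
  pose s := Num.max 1 (nu / q).
  have s1 : 1 <= s by rewrite le_max lexx.
  have sa : s < alpha by rewrite gt_max a1 ltr_pdivrMr// mulrC.
  have [a0 ha] := lower_tail nu0 nua (pos _ nun nua) ag s1 sa.
  exists a0 => a aa x Xx ax; split => // _.
  have [c' c'0 [N hN]] := ha a aa x Xx ax.
  apply: (@tau_moment_infty _ _ _ _ _ _ _ chain a q c' N.+1 x) => // n Nn.
  apply: le_trans (hN n (ltnW Nn)); rewrite lee_fin ler_wpM2l ?(ltW c'0)//.
  apply: ler_powR; first by rewrite ler1n (leq_trans _ Nn).
  rewrite lerN2 ler_pdivrMr; last lra.
  by rewrite mulrC -ler_pdivrMr// le_max lexx orbT.
- by exists 0 => a _ x _ _; split.
Qed.

Lemma moment_light (q : R) : gamma < alpha - 1 -> b < 0 -> 0 < q ->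
  exists a0 : R, forall a, a0 <= a -> forall x, X x -> a < `|x| ->
    (q < alpha / (gamma + 1) -> (moment a q x < +oo)%E) /\
    (alpha / (gamma + 1) <= q -> moment a q x = +oo%E).
Proof.
move=> ga b0 q0; have a1 := alpha1; have a2 := alpha2; have g := g0.
have kp : 0 < 1 + gamma by lra.
have kE : k = 1 + gamma by rewrite /scale min_r//; lra.
have rE nu : rho nu = b.
  by rewrite /rate ifT ?ifF ?subr0//; [apply/negbTE; rewrite -ltNge|]; lra.
rewrite (addrC gamma).
have k1a : 1 < alpha / (1 + gamma) by rewrite ltr_pdivlMr//; lra.
have ka2 : alpha / (1 + gamma) < 2 by rewrite ltr_pdivrMr//; lra.
have [qa|aq] := ltP q (alpha / (1 + gamma)).
(* Strictly between max(1, q) and alpha / (1 + gamma), which is below 2; so p > q and p satisfies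
   the conditions of [upper_tail_light]. *)
- pose p := (Num.max 1 q + alpha / (1 + gamma)) / 2.
  have m1 : Num.max 1 q < alpha / (1 + gamma) by rewrite gt_max k1a.
  have m2 : 1 <= Num.max 1 q by rewrite le_max lexx.
  have m3 : q <= Num.max 1 q by rewrite le_max lexx orbT.
  have [p1 p2 pq pa] : [/\ 1 < p, p < 2, q < p & p < alpha / (1 + gamma)].
    by split; rewrite /p; lra.
  have pka : p * k < alpha by rewrite kE -ltr_pdivlMr.
  have [rk rpk] : rho k < 0 /\ rho (p * k) < 0 by rewrite !rE.
  have [a0 [C [C0 hC]]] := upper_tail_light p1 p2 pka rk rpk.
  exists a0 => a aa x Xx ax; split => // _.
  apply: (@tau_moment_lty _ _ _ _ _ _ _ chain a q p (C * `|x| `^ (p * k)) x) => //.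
  + by rewrite mulr_ge0 ?powR_ge0.
  + by move=> n n_gt0; exact: hC.
- have [|a0 ha] := lower_tail_light; first lra.
  exists a0 => a aa x Xx ax; split => // _.
  have [c' c'0 [N hN]] := ha a aa x Xx ax.
  apply: (@tau_moment_infty _ _ _ _ _ _ _ chain a q c' N.+1 x) => // n Nn.
  apply: le_trans (hN n (ltnW Nn)); rewrite lee_fin ler_wpM2l ?(ltW c'0)//.
  apply: ler_powR; first by rewrite ler1n (leq_trans _ Nn).
  by rewrite lerN2.
Qed.

End SurvivalTails.

Unset Implicit Arguments.

Theorem theorem2p4 (R : realType) (d : measure_display) (Omega : measurableType d)
    (X : set R) (K : R.-pker R ~> R) (P : R -> probability Omega R)
    (xi : nat -> Omega -> R)
    (alpha beta c x0 gamma b q : R) :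
  is_markov_chain X K P xi ->
  ~ finite_set X ->
  (forall M : R, exists x, X x /\ M < `|x|) ->
  Tout X P xi alpha beta c x0 ->
  Dprime X P xi gamma b ->
  0 < q ->
  exists a0 : R, forall a : R, a0 <= a -> forall x : R, X x -> a < `|x| ->
  [/\
   (* (i) *)
   (alpha - 1 < gamma ->
      (q < 1 / alpha -> (tau_moment P xi a q x < +oo)%E) /\
      (1 / alpha < q -> tau_moment P xi a q x = +oo%E)),
   (* (ii) *)
   (gamma = alpha - 1 -> b < c * pi / `|sin (pi * alpha)| ->
      exists nu : R,
        [/\ 0 < nu < alpha,
            b / c = (nu - 1) * (Gamma (1 - alpha) * Gamma (alpha - nu) / Gamma (2 - nu)),
            (forall nu' : R, 0 < nu' < alpha ->
               b / c = (nu' - 1) * (Gamma (1 - alpha) * Gamma (alpha - nu') / Gamma (2 - nu')) ->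
               nu' = nu),
            (q < nu / alpha -> (tau_moment P xi a q x < +oo)%E) &
            (nu / alpha < q -> tau_moment P xi a q x = +oo%E)]) &
   (* (iii) *)
   (gamma < alpha - 1 -> b < 0 ->
      (q < alpha / (gamma + 1) -> (tau_moment P xi a q x < +oo)%E) /\
      (alpha / (gamma + 1) <= q -> tau_moment P xi a q x = +oo%E))].
Proof.
move=> chain _ _ tout dprime q0.
have [/andP[a1 a2] [_ [c0 _]]] := tout.
have [g1|g1|g1] := ltgtP gamma (alpha - 1).
- have [b0|b0] := ltP b 0; last first.
    by exists 0 => a _ x _ _; split=> h; try (move=> h'); exfalso; lra.
  have [a0 h] := moment_light chain tout dprime g1 b0 q0.
  exists a0 => a aa x Xx ax; split=> [g2|g2|_ _]; [exfalso; lra|exfalso; lra|exact: h].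
(* The drift is too weak to enter the rate, and [critical_fun] changes sign at nu = 1 through its
   factor 1 - nu; this is why the critical exponent is 1 here. *)
- have rE nu : rate alpha c gamma b nu = - (c * critical_fun alpha nu).
    by rewrite /rate ifF ?ifT ?sub0r//; [|apply/negbTE; rewrite -ltNge]; lra.
  have neg nu : 0 < nu -> nu < 1 -> rate alpha c gamma b nu < 0.
    move=> n0 n1; rewrite rE oppr_lt0 pmulr_rgt0// /critical_fun.
    by apply: mulr_gt0; [rewrite divr_gt0//; lra|apply: Beta_gt0; lra].
  have pos nu : 1 < nu -> nu < alpha -> 0 < rate alpha c gamma b nu.
    move=> n1 na; rewrite rE oppr_gt0 pmulr_rlt0// /critical_fun nmulr_rlt0.
      by apply: Beta_gt0; lra.
    by rewrite pmulr_llt0 ?invr_gt0; lra.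
  have ag : alpha <= 1 + gamma by lra.
  have one : 0 < (1 : R) < alpha by rewrite ltr01.
  have [a0 h] := moment_dichotomy chain tout dprime ag one q0 neg pos.
  exists a0 => a aa x Xx ax; split=> [_|g2|g2]; [exact: h|exfalso; lra|exfalso; lra].
- have [bc|bc] := ltP b (c * pi / `|sin (pi * alpha)|); last first.
    by exists 0 => a _ x _ _; split=> h; try (move=> h'); exfalso; lra.
  have bc' : b / c < pi / `|sin (pi * alpha)|.
    by rewrite ltr_pdivrMr// mulrC mulrA.
  have [nus /andP[n0 na] nE] := critical_exponent a1 a2 bc'.
  have rE nu : rate alpha c gamma b nu = b - c * critical_fun alpha nu.
    by rewrite /rate !ifT//; lra.
  have bE : b = c * critical_fun alpha nus by rewrite nE mulrCA divff ?mulr1// gt_eqF.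
  have neg nu : 0 < nu -> nu < nus -> rate alpha c gamma b nu < 0.
    by move=> nu0 nun; rewrite rE bE subr_lt0 ltr_pM2l//; exact: critical_fun_decr.
  have pos nu : nus < nu -> nu < alpha -> 0 < rate alpha c gamma b nu.
    by move=> nun nua; rewrite rE bE subr_gt0 ltr_pM2l//; exact: critical_fun_decr.
  have ag : alpha <= 1 + gamma by lra.
  have nb : 0 < nus < alpha by rewrite n0.
  have [a0 h] := moment_dichotomy chain tout dprime ag nb q0 neg pos.
  exists a0 => a aa x Xx ax; split=> [g2|_ _|g2]; [exfalso; lra| |exfalso; lra].
  exists nus; split.
  + by rewrite n0.
  + by rewrite critical_funE ?n0// nE.
  + move=> nu /andP[nu0 nua]; rewrite critical_funE ?nu0// -nE => E.
    have [lt|lt|//] := ltgtP nu nus.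
      by have := critical_fun_decr a1 a2 nu0 lt na; rewrite E ltxx.
    by have := critical_fun_decr a1 a2 n0 lt nua; rewrite E ltxx.
  + by case: (h a aa x Xx ax).
  + by case: (h a aa x Xx ax).
Qed.
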